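(* Let $f\in C^2$, $f''>0$, $\bar u_l<\bar u_r$, and let $w_0\in L^\infty(\mathbb{R})$ be $p$-periodic with zero average and satisfy $\int_0^x w_0(y)\,dy\ge 0$ for $0\le x\le p$. Let $u$ be the entropy solution of $u_t+f(u)_x=0$ with data $\bar u_l+w_0(x)$ for $x<0$ and $\bar u_r+w_0(x)$ for $x>0$, and $u_l,u_r$ the entropy solutions with data $\bar u_l+w_0$, $\bar u_r+w_0$ on $\mathbb{R}$. Then for $t>0$, $$u(x,t)=\begin{cases}u_l(x,t),& x/t<f'(\bar u_l),\\ (f')^{-1}(x/t),& f'(\bar u_l)\le x/t\le f'(\bar u_r),\\ u_r(x,t),& x/t>f'(\bar u_r).\end{cases}$$
   Context: Entropy solutions of the scalar conservation law with $L^\infty$ initial data. *)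

(* Defs.v *)
From HB Require Import structures.
From mathcomp Require Import all_boot all_order all_algebra.
From mathcomp Require Import all_classical all_reals all_analysis.
Set Implicit Arguments. Unset Strict Implicit. Unset Printing Implicit Defensive.
Import Order.TTheory GRing.Theory Num.Theory.
Import numFieldNormedType.Exports.
Local Open Scope classical_set_scope.
Local Open Scope ring_scope.

(* Lebesgue measure on R x R (first coordinate = x, second = t). *)
Definition leb2 (R : realType) :=
  ((@lebesgue_measure R) \x (@lebesgue_measure R))%E.

Definition test_fun (R : realType) (phi : R * R -> R) : Prop :=
  (forall z, differentiable phi z) /\
  continuous ('D_((1, 0) : R * R) phi) /\
  continuous ('D_((0, 1) : R * R) phi) /\
  (exists M : R, forall z : R * R, M < `|z.1| \/ M < `|z.2| -> phi z = 0) /\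
  (forall z, 0 <= phi z).

Definition Linfty1 (R : realType) (g : R -> R) : Prop :=
  measurable_fun setT g /\
  exists M : R, {ae (@lebesgue_measure R), forall x, `|g x| <= M}.

(* Kruzhkov entropy solution of u_t + f(u)_x = 0, u(x,0) = u0(x);
   u z with z = (x, t).  Only values for t > 0 matter. *)
Definition entropy_solution (R : realType) (f : R -> R) (u0 : R -> R)
    (u : R * R -> R) : Prop :=
  measurable_fun [set z : R * R | 0 < z.2] u /\
  (exists M : R, {ae (@leb2 R), forall z, 0 < z.2 -> `|u z| <= M}) /\
  forall (k : R) (phi : R * R -> R), test_fun phi ->
    0 <= Rintegral (@leb2 R) [set z : R * R | 0 < z.2]
           (fun z => `|u z - k| * 'D_((0, 1) : R * R) phi z
                     + Num.sg (u z - k) * (f (u z) - f k)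
                       * 'D_((1, 0) : R * R) phi z)
         + Rintegral (@lebesgue_measure R) setT
           (fun x => `|u0 x - k| * phi (x, 0)).

(* The inverse function g^{-1}(y): some v with g v = y if one exists
   (unique when g is injective, e.g. g = f' with f'' > 0); 0 otherwise. *)
Definition inverse_fun (R : realType) (g : R -> R) (y : R) : R :=
  match pselect (exists v, g v = y) with
  | left h => proj1_sig (cid h)
  | right _ => 0
  end.

(* Main.v *)
(* Let U be the potential of an entropy solution u: U_x = u, U_t = - f(u). Kruzhkov's
   inequalities make U a viscosity supersolution of U_t + f(U_x) = 0 at minima of U - phi,
   and since f is convex, Jensen's inequality makes box averages of U C^1 subsolutions;
   together they give a comparison principle for potentials. Let U, U_l and U_r be the
   potentials of u, u_l and u_r. As the primitive of w0 is periodic and nonnegative,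
   U(x, 0) >= a x for every a in [ubl, ubr], hence U >= a x - f(a) t; on the ray
   x = f'(a) t starting at the origin, where U = 0, equality holds. The same applies to
   U_l with a = ubl and to U_r with a = ubr. Thus U = U_l on the ray x = f'(ubl) t and
   on the negative axis, so by comparison U = U_l to the left of the ray; likewise
   U = U_r on the right. Between the two rays U is the potential of the rarefaction fan.
   Finally, averages of u are difference quotients of U, so U determines u. *)
Require Import Defs.
From HB Require Import structures.
From mathcomp Require Import all_boot all_order all_algebra.
From mathcomp Require Import all_classical all_reals all_analysis.
From mathcomp Require Import measurable_realfun.
From mathcomp Require Import ring lra.
Import Order.TTheory GRing.Theory Num.Theory.
Import numFieldNormedType.Exports.
Local Open Scope classical_set_scope.
Local Open Scope ring_scope.

(** * Bounded measurable functions and oriented integrals *)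

(** An entropy solution is given by integral inequalities alone: it has no traces, no continuity in
    time, and only almost everywhere defined values, so two solutions cannot be compared along a ray
    directly. Their potentials can, being Lipschitz; comparing them replaces doubling of variables
    and finite speed of propagation. Only the supersolution half of the viscosity notion is drawn
    from Kruzhkov's inequalities. For the other half, convexity gives much more than a viscosity
    inequality: a box average V has V_t = - avg f(u) and V_x = avg u, so V_t + f(V_x) <= 0 holds
    classically. Every comparison is therefore between a C^1 function and a potential, and equality
    of two potentials follows by exchanging their roles. Test functions need only be C^1, so cutoffs
    are made from squares of positive parts, whose Taylor remainders are explicit. The domains are
    unbounded cones, so comparison needs a growth bound; it comes from the Lipschitz bounds and a
    nearby point where the potentials agree. *)

Lemma ae_imp {R : realType} d (T : measurableType d) (mu : {measure set T -> \bar R})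
    (P Q : T -> Prop) : (forall x, P x -> Q x) ->
  {ae mu, forall x, P x} -> {ae mu, forall x, Q x}.
Proof. by move=> PQ; apply: (@filterS _ _ (ae_filter_ringOfSetsType mu)). Qed.

Lemma ae_and {R : realType} d (T : measurableType d) (mu : {measure set T -> \bar R})
    (P Q : T -> Prop) : {ae mu, forall x, P x} -> {ae mu, forall x, Q x} ->
  {ae mu, forall x, P x /\ Q x}.
Proof. by move=> aP aQ; exact: (@filterI _ _ (ae_filter_ringOfSetsType mu)). Qed.

Section bounded_measurable.
Context {R : realType} {d : measure_display} {T : measurableType d}.
Implicit Types q r : T -> R.

(** The bound holds everywhere, not almost everywhere, so that it passes to every slice and every
    composition without tracking null sets. *)
Definition bmf q := measurable_fun setT q /\ exists M : R, forall x, `|q x| <= M.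

Lemma bmf_cst (c : R) : bmf (fun=> c).
Proof. by split; [exact: measurable_cst | exists `|c|]. Qed.

Lemma bmfD q r : bmf q -> bmf r -> bmf (fun x => q x + r x).
Proof.
move=> [mq [M qM]] [mr [N rN]]; split; first exact: measurable_funD.
by exists (M + N) => x; rewrite (le_trans (ler_normD _ _)) ?lerD.
Qed.

Lemma bmfM q r : bmf q -> bmf r -> bmf (fun x => q x * r x).
Proof.
move=> [mq [M qM]] [mr [N rN]]; split; first exact: measurable_funM.
by exists (M * N) => x; rewrite normrM ler_pM.
Qed.

Lemma bmfN q : bmf q -> bmf (fun x => - q x).
Proof.
move=> [mq [M qM]]; split; last by exists M => x; rewrite normrN.
exact: measurableT_comp.
Qed.

Lemma bmfB q r : bmf q -> bmf r -> bmf (fun x => q x - r x).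
Proof. by move=> ? ?; apply: bmfD => //; exact: bmfN. Qed.

Lemma bmf_norm q : bmf q -> bmf (fun x => `|q x|).
Proof.
move=> [mq [M qM]]; split; last by exists M => x; rewrite normr_id.
exact: measurableT_comp.
Qed.

Lemma bmf_indic (A : set T) : measurable A -> bmf (\1_A : T -> R).
Proof.
move=> mA; split; first exact: measurable_indic.
by exists 1 => x; rewrite indicE; case: (_ \in _); rewrite /= ?normr1 ?normr0.
Qed.

Lemma bmf_integrable (mu : {measure set T -> \bar R}) q (D : set T) :
  measurable D -> (mu D < +oo)%E -> bmf q -> mu.-integrable D (EFin \o q).
Proof.
move=> mD Doo [mq [M qM]]; apply: measurable_bounded_integrable => //.
  exact: measurable_funTS.
exists M; split; first exact: num_real.
by move=> N MN x _; exact: le_trans (qM x) (ltW MN).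
Qed.

End bounded_measurable.

Lemma bmf_comp {R : realType} d d' (T : measurableType d) (T' : measurableType d')
    (q : T -> R) (h : T' -> T) :
  bmf q -> measurable_fun setT h -> bmf (q \o h).
Proof.
by move=> [mq [M qM]] mh; split; [exact: measurableT_comp | exists M => x /=].
Qed.

Lemma bmf_cont {R : realType} d (T : measurableType d) (f : R -> R) (q : T -> R) :
  continuous f -> bmf q -> bmf (f \o q).
Proof.
move=> cf [mq [M qM]]; split.
  by apply: measurableT_comp => //; exact: continuous_measurable_fun.
have Mm : - `|M| <= `|M| by have := normr_ge0 M; lra.
have cf' : {within `[- `|M|, `|M|], continuous f} by exact: continuous_subspaceT.
have [c _ cM] := EVT_max Mm cf'.
have [e _ em] := EVT_min Mm cf'.
exists (`|f c| + `|f e|) => x /=.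
have xM : q x \in `[- `|M|, `|M|].
  by rewrite in_itv/= -ler_norml; exact: le_trans (qM x) (ler_norm M).
rewrite ler_norml; have := cM _ xM; have := em _ xM.
have := ler_norm (f c); have := ler_norm (- f e); rewrite normrN.
have := normr_ge0 (f c); have := normr_ge0 (f e).
by move=> *; apply/andP; split; lra.
Qed.

(** * Oriented integrals on the line *)

Section oriented_integral.
Context {R : realType}.
Notation mu := (@lebesgue_measure R).
Implicit Types (q r : R -> R) (a b c : R).

(** One of the two intervals has at most one point, so one term vanishes; additivity then holds for
    endpoints in any order. *)
Definition sint q a b : R :=
  \int[mu]_(y in `[a, b]) q y - \int[mu]_(y in `[b, a]) q y.

Lemma itv_fin a b : (mu `[a, b]%classic < +oo)%E.
Proof. by rewrite lebesgue_measure_itv; case: ifP => _; rewrite ltry. Qed.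

Definition lint q := forall a b, mu.-integrable `[a, b] (EFin \o q).

Lemma bmf_lint q : bmf q -> lint q.
Proof. by move=> ? a b; apply: bmf_integrable => //; exact: itv_fin. Qed.

Lemma continuous_lint q : continuous q -> lint q.
Proof.
move=> cq a b; apply: continuous_compact_integrable; first exact: segment_compact.
exact: continuous_subspaceT.
Qed.

Lemma lint_cst (k : R) : lint (fun=> k).
Proof. exact/bmf_lint/bmf_cst. Qed.

Lemma lintD q r : lint q -> lint r -> lint (fun x => q x + r x).
Proof. by move=> lq lr a b; exact: (integrableD _ (lq a b) (lr a b)). Qed.

Lemma lintZ (k : R) q : lint q -> lint (fun x => k * q x).
Proof. by move=> lq a b; exact: (integrableZl _ k (lq a b)). Qed.

Lemma lintN q : lint q -> lint (fun x => - q x).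
Proof. by move=> lq a b; exact: (integrableN (lq a b)). Qed.

Lemma lintB q r : lint q -> lint r -> lint (fun x => q x - r x).
Proof. by move=> ? ?; apply: lintD => //; exact: lintN. Qed.

Lemma Rintegral_itvxx q a b : b <= a -> \int[mu]_(y in `[a, b]) q y = 0.
Proof.
rewrite le_eqVlt => /predU1P[->|ab]; first by rewrite set_itv1 Rintegral_set1.
by rewrite set_itv_ge ?Rintegral_set0// bnd_simp -ltNge.
Qed.

Lemma sintE q a b : a <= b -> sint q a b = \int[mu]_(y in `[a, b]) q y.
Proof. by move=> ab; rewrite /sint (Rintegral_itvxx q b a)// subr0. Qed.

Lemma sintC q a b : sint q b a = - sint q a b.
Proof. by rewrite /sint opprB. Qed.

Lemma sintxx q a : sint q a a = 0. Proof. by rewrite /sint subrr. Qed.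

Let sint_split q a b c : lint q -> a <= b -> b <= c ->
  sint q a b + sint q b c = sint q a c.
Proof.
move=> bq ab bc; rewrite !sintE ?(le_trans ab)//.
have := @Rintegral_itvB _ q (BLeft a) (BRight c) b (bq _ _).
rewrite !bnd_simp => /(_ ab bc); rewrite Rintegral_itv_obnd_cbnd.
  by move=> <-; rewrite addrC subrK.
by apply: integrableS (bq b c) => //; apply: subset_itvr; rewrite bnd_simp.
Qed.

Lemma sintD_itv q a b c : lint q -> sint q a b + sint q b c = sint q a c.
Proof.
move=> bq; have H := sint_split q; have sC := sintC q.
case: (leP a b) => [ab|/ltW ba]; case: (leP b c) => [bc|/ltW cb];
  case: (leP a c) => [ac|/ltW ca].
- exact: H.
- by have := H _ _ _ bq ab bc; have /= := H _ _ _ bq bc ca;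
    rewrite (sC a b) (sC a c); have := H _ _ _ bq ca ab; rewrite (sC b c) (sC a c); lra.
- by have := H _ _ _ bq ac cb; rewrite (sC b c); lra.
- by have := H _ _ _ bq ca ab; rewrite (sC b c) (sC a c); lra.
- by have := H _ _ _ bq ba ac; rewrite (sC b a); lra.
- by have := H _ _ _ bq bc ca; rewrite (sC b a) (sC a c); lra.
- by have := H _ _ _ bq cb ba; have := H _ _ _ bq ac cb; rewrite (sC b a) (sC b c); lra.
- by have := H _ _ _ bq cb ba; rewrite (sC b a) (sC b c) (sC a c); lra.
Qed.

Lemma sint_cst (k : R) a b : sint (fun=> k) a b = (b - a) * k.
Proof.
wlog ab : a b / a <= b => [H|].
  case: (leP a b) => [|/ltW]; first exact: H.
  by move=> /H; rewrite (sintC _ a b) => h; lra.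
rewrite sintE// Rintegral_cst//= lebesgue_measure_itv/= lte_fin.
case: ltgtP ab => //= [ab _|-> _]; first by rewrite mulrC.
by ring.
Qed.

Lemma sintD q r a b : lint q -> lint r ->
  sint (fun x => q x + r x) a b = sint q a b + sint r a b.
Proof. by move=> bq br; rewrite /sint !RintegralD//; [ring|auto..]. Qed.

Lemma sintZ (k : R) q a b : lint q -> sint (fun x => k * q x) a b = k * sint q a b.
Proof. by move=> bq; rewrite /sint !RintegralZl//; [ring|auto..]. Qed.

Lemma sintN q a b : lint q -> sint (fun x => - q x) a b = - sint q a b.
Proof.
move=> bq; rewrite -mulN1r -sintZ//; congr sint; apply/funext => x.
by rewrite mulN1r.
Qed.

Lemma sintB q r a b : lint q -> lint r ->
  sint (fun x => q x - r x) a b = sint q a b - sint r a b.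
Proof. by move=> bq br; rewrite sintD ?sintN//; exact: lintN. Qed.

Lemma le_sint q r a b : lint q -> lint r -> a <= b ->
  (forall x, a <= x <= b -> q x <= r x) -> sint q a b <= sint r a b.
Proof.
move=> bq br ab qr; rewrite !sintE//; apply: le_Rintegral; [by []|auto|auto|].
by move=> x /=; rewrite in_itv/=; exact: qr.
Qed.

Lemma eq_sint q r a b : a <= b ->
  (forall x, a <= x <= b -> q x = r x) -> sint q a b = sint r a b.
Proof.
move=> ab qr; rewrite !sintE//; apply: eq_Rintegral => x.
by rewrite inE/= in_itv/=; exact: qr.
Qed.

Lemma sint_approx q a b (k e : R) : lint q ->
  (forall x, `|x - a| <= `|b - a| -> `|q x - k| <= e) ->
  `|sint q a b - (b - a) * k| <= e * `|b - a|.
Proof.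
move=> bq qk; rewrite -sint_cst -sintB//; last exact: lint_cst.
have bqk : lint (fun x => q x - k) by apply: lintB => //; exact: lint_cst.
have be c : lint (fun _ : R => c) := lint_cst c.
case: (leP a b) => [ab|/ltW ba].
- rewrite (@ger0_norm _ (b - a)) ?subr_ge0// ler_norml; apply/andP; split.
    rewrite -mulNr mulrC -sint_cst; apply: le_sint => // x /andP[ax xb].
    have : `|x - a| <= `|b - a| by rewrite !ger0_norm ?subr_ge0// lerD2r.
    by move=> /qk; rewrite ler_norml => /andP[].
  rewrite mulrC -sint_cst; apply: le_sint => // x /andP[ax xb].
  have : `|x - a| <= `|b - a| by rewrite !ger0_norm ?subr_ge0// lerD2r.
  by move=> /qk; rewrite ler_norml => /andP[].
- rewrite sintC normrN (@ler0_norm _ (b - a)) ?subr_le0// opprB ler_norml; apply/andP; split.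
    rewrite -mulNr mulrC -sint_cst; apply: le_sint => // x /andP[ax xb].
    have : `|x - a| <= `|b - a| by rewrite !ler0_norm ?subr_le0//; lra.
    by move=> /qk; rewrite ler_norml => /andP[].
  rewrite mulrC -sint_cst; apply: le_sint => // x /andP[ax xb].
  have : `|x - a| <= `|b - a| by rewrite !ler0_norm ?subr_le0//; lra.
  by move=> /qk; rewrite ler_norml => /andP[].
Qed.

Lemma sint_bound q a b (e : R) : lint q ->
  (forall x, `|x - a| <= `|b - a| -> `|q x| <= e) ->
  `|sint q a b| <= e * `|b - a|.
Proof.
move=> bq qe; have := sint_approx q a b 0 e bq.
by rewrite mulr0 subr0; apply=> x /qe; rewrite subr0.
Qed.

Lemma eq_sint_ae q r a b : a <= b -> measurable_fun setT q -> measurable_fun setT r ->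
  {ae mu, forall x, a <= x <= b -> q x = r x} -> sint q a b = sint r a b.
Proof.
move=> ab mq mr qr; rewrite !sintE//; congr fine; apply: ae_eq_integral => //.
- by apply/measurable_EFinP; exact: measurable_funTS.
- by apply/measurable_EFinP; exact: measurable_funTS.
- by apply: ae_imp qr => x H /=; rewrite in_itv/= => /H ->.
Qed.

Lemma lipschitz_sint q a (M : R) : lint q -> (forall x, `|q x| <= M) ->
  forall x y, `|sint q a x - sint q a y| <= M * `|x - y|.
Proof.
move=> bq qM x y; rewrite -(sintD_itv q a y x)// addrAC subrr add0r.
by rewrite sint_bound.
Qed.

End oriented_integral.

#[global] Opaque sint.

Lemma Rintegral_indic {R : realType} d (T : measurableType d)
    (m : {measure set T -> \bar R}) (D : set T) (f : T -> R) :
  \int[m]_(x in D) f x = \int[m]_x (\1_D x * f x).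
Proof.
rewrite Rintegral_mkcond; congr Rintegral; apply/funext => x.
by rewrite patchE indicE; case: ifP => _; rewrite ?mul1r ?mul0r.
Qed.

(** * Iterated integrals over boxes *)

Section plane_integral.
Context {R : realType}.
Notation mu := (@lebesgue_measure R).
Notation mu2 := (mu \x mu)%E.
Implicit Types (g : R * R -> R) (a b c d : R).

Lemma bmf_slice1 g s : bmf g -> bmf (fun y => g (y, s)).
Proof.
move=> bg; apply: (@bmf_comp _ _ _ _ _ g (fun y => (y, s))) => //.
Qed.

Lemma bmf_slice2 g y : bmf g -> bmf (fun s => g (y, s)).
Proof.
move=> bg; apply: (@bmf_comp _ _ _ _ _ g (fun s => (y, s))) => //.
by apply: measurable_fun_pair.
Qed.

Lemma bmf_swap g : bmf g -> bmf (fun z => g (z.2, z.1)).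
Proof.
move=> bg; apply: (@bmf_comp _ _ _ _ _ g (fun z => (z.2, z.1))) => //.
exact: measurable_swap.
Qed.

Lemma bmf_slice (disp : measure_display) (T : measurableType disp) (g : R * T -> R) s :
  bmf g -> bmf (fun y => g (y, s)).
Proof. by move=> bg; apply: (@bmf_comp _ _ _ _ _ g (fun y => (y, s))). Qed.

Lemma bmf_sint (disp : measure_display) (T : measurableType disp) (g : R * T -> R) a b :
  bmf g -> bmf (fun s => sint (fun y => g (y, s)) a b).
Proof.
wlog ab : a b / a <= b => [H bg|bg].
  case: (leP a b) => [/H|/ltW /H]; first exact.
  move=> /(_ bg) /bmfN; congr bmf; apply/funext => s.
  by rewrite sintC opprK.
have [mg [M gM]] := bg.
split; last first.
  by exists (M * `|b - a|) => s; apply: sint_bound => //; exact/bmf_lint/(bmf_slice _ _ _ s bg).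
(* Tonelli's measurability result needs a nonnegative integrand, hence the shift by [M], undone by
   subtracting [(b - a) * M]. *)
pose f := fun z : R * T => (\1_(`[a, b]) z.1 * (g z + M))%:E.
have mf : measurable_fun setT f.
  apply/measurable_EFinP; apply: measurable_funM.
    by apply: measurableT_comp => //; exact: measurable_indic.
  by apply: measurable_funD => //; exact: measurable_cst.
have f0 z : (0 <= f z)%E.
  rewrite lee_fin mulr_ge0//.
  by have := gM z; rewrite ler_norml => /andP[]; lra.
have mG : measurable_fun setT (fubini_G mu f) by exact: measurable_fun_fubini_tonelli_G.
suff -> : (fun s => sint (fun y => g (y, s)) a b) =
    (fun s => fine (fubini_G mu f s) - (b - a) * M).
  apply: measurable_funB; last exact: measurable_cst.
  exact: measurableT_comp.
apply/funext => s; rewrite -sint_cst.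
have -> : fine (fubini_G mu f s) = sint (fun y => g (y, s) + M) a b.
  by rewrite sintE// Rintegral_indic.
rewrite -sintB; [|apply/bmf_lint/bmfD; [exact: (bmf_slice _ _ _ s bg)|exact: bmf_cst]|exact: lint_cst].
by congr sint; apply/funext => y; rewrite addrK.
Qed.

Lemma bmf_sint1 g a b : bmf g -> bmf (fun s => sint (fun y => g (y, s)) a b).
Proof. exact: bmf_sint. Qed.

Lemma bmf_sint2 g a b : bmf g -> bmf (fun y => sint (fun s => g (y, s)) a b).
Proof. by move=> /bmf_swap /(bmf_sint1 _ a b). Qed.

Lemma box_fin a b c d : (mu2 (`[a, b] `*` `[c, d])%classic < +oo)%E.
Proof.
rewrite product_measure1E//; apply: lte_mul_pinfty => //; last exact: itv_fin.
by rewrite ge0_fin_numE//; exact: itv_fin.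
Qed.

Lemma bmf_box g a b c d : bmf g ->
  mu2.-integrable (`[a, b] `*` `[c, d]) (EFin \o g).
Proof. by move=> bg; apply: bmf_integrable => //; [exact: measurableX|exact: box_fin]. Qed.

Let box_indicE g a b c d : bmf g ->
  mu2.-integrable setT (EFin \o (fun z => \1_(`[a, b] `*` `[c, d]) z * g z)).
Proof.
move=> bg; have mB : measurable (`[a, b] `*` `[c, d] : set (R * R)) by exact: measurableX.
have := bmf_box g a b c d bg; rewrite integrable_mkcond//.
apply: eq_integrable => // z _; rewrite patchE /= indicE.
by case: ifP => _; rewrite ?mul1r ?mul0r.
Qed.

Let itv_indicE (q : R -> R) a b : bmf q ->
  mu.-integrable setT (EFin \o (fun y => \1_(`[a, b]) y * q y)).
Proof.
move=> bq; have := bmf_lint q bq a b; rewrite integrable_mkcond//.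
apply: eq_integrable => // z _; rewrite patchE /= indicE.
by case: ifP => _; rewrite ?mul1r ?mul0r.
Qed.

Lemma Rintegral_box g a b c d : bmf g -> a <= b -> c <= d ->
  \int[mu2]_(z in `[a, b] `*` `[c, d]) g z =
  sint (fun y => sint (fun s => g (y, s)) c d) a b.
Proof.
move=> bg ab cd; rewrite Rintegral_indic {1}/Rintegral.
rewrite -integral12_prod_meas1; last exact: box_indicE.
rewrite sintE// Rintegral_indic; congr fine; apply: eq_integral => x _.
have [xab|xab] := boolP (x \in `[a, b]%classic); last first.
  rewrite /fubini_F indicE (negbTE xab) mul0r; apply: integral0_eq => y _.
  by rewrite /= indicE in_setX (negbTE xab) mul0r.
rewrite [in RHS]indicE xab mul1r sintE// Rintegral_indic /fubini_F.
rewrite /Rintegral fineK; first by apply: eq_integral => y _;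
  rewrite /= !indicE in_setX xab.
apply: integrable_fin_num => //.
exact: itv_indicE (bmf_slice2 g x bg).
Qed.

Let swap_le g a b c d : bmf g -> a <= b -> c <= d ->
  sint (fun s => sint (fun y => g (y, s)) a b) c d =
  sint (fun y => sint (fun s => g (y, s)) c d) a b.
Proof.
move=> bg ab cd; rewrite -Rintegral_box// Rintegral_indic {1}/Rintegral.
rewrite -integral21_prod_meas1; last exact: box_indicE.
rewrite sintE// Rintegral_indic; congr fine; apply: eq_integral => x _.
have [xab|xab] := boolP (x \in `[c, d]%classic); last first.
  rewrite /fubini_G indicE (negbTE xab) mul0r; apply/esym/integral0_eq => y _.
  by rewrite /= indicE in_setX (negbTE xab) andbF mul0r.
rewrite [in LHS]indicE xab mul1r sintE// Rintegral_indic /fubini_G.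
rewrite /Rintegral fineK; first by apply: eq_integral => y _;
  rewrite /= !indicE in_setX xab andbT.
apply: integrable_fin_num => //.
exact: itv_indicE (bmf_slice1 g x bg).
Qed.

Lemma sint_swap g a b c d : bmf g ->
  sint (fun s => sint (fun y => g (y, s)) a b) c d =
  sint (fun y => sint (fun s => g (y, s)) c d) a b.
Proof.
move=> bg.
wlog ab : a b / a <= b => [H|].
  case: (leP a b) => [/H//|/ltW /H e].
  rewrite [RHS]sintC -e -sintN; last exact/bmf_lint/bmf_sint1.
  by congr sint; apply/funext => s; rewrite sintC.
wlog cd : c d / c <= d => [H|]; last exact: swap_le.
case: (leP c d) => [/H//|/ltW /H e].
rewrite [LHS]sintC e -sintN; last exact/bmf_lint/bmf_sint2.
by congr sint; apply/funext => s; rewrite [in RHS]sintC.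
Qed.

(** The product sigma-algebra is generated by rectangles, so the preimage of an open interval is
    written as a countable union of open boxes with rational corners. *)
Lemma continuous_measurable2 g : continuous g -> measurable_fun setT g.
Proof.
move=> cg; apply: (measurability _ (RGenOpens.measurableE R)) => //.
move=> _ [_ [a [b ->] <-]]; rewrite setTI.
pose box (q : (rat * rat) * (rat * rat)) : set (R * R) :=
  `]ratr q.1.1, ratr q.1.2[%classic `*` `]ratr q.2.1, ratr q.2.2[%classic.
have -> : g @^-1` `]a, b[%classic =
    \bigcup_(q in [set q | box q `<=` g @^-1` `]a, b[%classic]) box q.
  apply/seteqP; split => [z gz|z [q qs]]; last exact: qs.
  have : nbhs z (g @^-1` `]a, b[%classic).
    apply: cg; apply: open_nbhs_nbhs; split; [exact: interval_open|exact: gz].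
  move=> /nbhs_ballP[e /= e0 he].
  have [q1 /andP[q1a q1b]] : exists q : rat, z.1 - e < ratr q < z.1.
    have /rat_in_itvoo[q] : z.1 - e < z.1 by lra.
    by rewrite in_itv/=; exists q.
  have [q2 /andP[q2a q2b]] : exists q : rat, z.1 < ratr q < z.1 + e.
    have /rat_in_itvoo[q] : z.1 < z.1 + e by lra.
    by rewrite in_itv/=; exists q.
  have [q3 /andP[q3a q3b]] : exists q : rat, z.2 - e < ratr q < z.2.
    have /rat_in_itvoo[q] : z.2 - e < z.2 by lra.
    by rewrite in_itv/=; exists q.
  have [q4 /andP[q4a q4b]] : exists q : rat, z.2 < ratr q < z.2 + e.
    have /rat_in_itvoo[q] : z.2 < z.2 + e by lra.
    by rewrite in_itv/=; exists q.
  exists ((q1, q2), (q3, q4)).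
    move=> w [/=]; rewrite !in_itv/= => /andP[? ?] /andP[? ?].
    by apply: he; split => /=; rewrite /ball/= ltr_norml; apply/andP; split; lra.
  by split; rewrite /= in_itv/=; apply/andP; split.
rewrite bigcup_mkcond; apply: countable_bigcupT_measurable => // q.
by case: ifP => _ //; exact: measurableX.
Qed.

End plane_integral.

(** * Quadratic remainders and C^1 functions of two variables *)

Section quadratic_remainder.
Context {R : realType}.
Implicit Types (F : R * R -> R) (z w : R * R) (a b : R).

(* The first-order expansion of [F] at [z] with a remainder that is quadratic on the
   unit box: stronger than differentiability, but stable under all operations used here. *)
Definition qdiff F z a b := exists2 L, 0 <= L & forall w, `|w.1| <= 1 -> `|w.2| <= 1 ->
  `|F (z.1 + w.1, z.2 + w.2) - F z - (w.1 * a + w.2 * b)| <= L * (`|w.1| + `|w.2|) ^+ 2.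

Definition C1 F Fx Ft :=
  [/\ forall z, qdiff F z (Fx z) (Ft z), continuous Fx & continuous Ft].

Definition lin2 a b w : R := w.1 * a + w.2 * b.

Lemma lin2_is_linear a b : linear (lin2 a b).
Proof. by move=> k u v; rewrite /lin2/= /GRing.scale/=; ring. Qed.

HB.instance Definition _ a b :=
  GRing.isLinear.Build R (R * R)%type R _ (lin2 a b) (lin2_is_linear a b).

Lemma lin2_continuous a b : continuous (lin2 a b).
Proof.
move=> z; apply: cvgD; apply: cvgMl; [exact: cvg_fst|exact: cvg_snd].
Qed.

Lemma qdiff_differentiable F z a b : qdiff F z a b ->
  [/\ differentiable F z, 'D_((1, 0) : R * R) F z = a & 'D_((0, 1) : R * R) F z = b].
Proof.
move=> [L L0 H].
have E : F \o shift z = cst (F z) + lin2 a b +o_ (0 : R * R) id.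
  apply/eqaddoP => e e0.
  (* In the sup norm the remainder is at most [L * (2 * |w|) ^+ 2], which is below [e * |w|] once
     [|w| < e / (4 * L + 1)]. *)
  have d0 : 0 < Num.min 1 (e / (4 * L + 1)).
    by rewrite lt_min ltr01 divr_gt0//; lra.
  near=> w.
  have nw : `|w| < Num.min 1 (e / (4 * L + 1)).
    near: w; apply/nbhs_ballP; eexists; first exact: d0.
    move=> v [/=]; rewrite /ball/= !sub0r !normrN => v1 v2.
    by rewrite prod_normE gt_max v1 v2.
  move: nw; rewrite lt_min => /andP[w1 wL].
  have n1 : `|w.1| <= `|w| by rewrite prod_normE le_max lexx.
  have n2 : `|w.2| <= `|w| by rewrite prod_normE le_max lexx orbT.
  have := H w (le_trans n1 (ltW w1)) (le_trans n2 (ltW w1)).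
  have wz : w + z = (z.1 + w.1, z.2 + w.2) by rewrite addrC; case: (z) (w) => ? ? [].
  have -> : (F \o shift z - (cst (F z) + lin2 a b)) w =
    F (w + z) - F z - (w.1 * a + w.2 * b) by rewrite !fctE /= /lin2; ring.
  rewrite wz.
  move=> h; apply: (le_trans h).
  have s2 : (`|w.1| + `|w.2|) ^+ 2 <= (2 * `|w|) ^+ 2.
    by rewrite ler_pXn2r// ?nnegrE ?addr_ge0 ?mulr_ge0//; lra.
  move: wL; rewrite ltr_pdivlMr; last by lra.
  move=> wL; apply: (le_trans (ler_wpM2l L0 s2)).
  have := normr_ge0 w; nra.
have dE := @diff_unique _ _ _ F (lin2 a b) z (lin2_continuous a b) E.
have dF : differentiable F z.
  apply/diff_locallyP; rewrite dE; split => //; exact: lin2_continuous.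
split => //.
  by transitivity (lin2 a b (1, 0)); [rewrite deriveE// dE|rewrite /lin2/=; ring].
by transitivity (lin2 a b (0, 1)); [rewrite deriveE// dE|rewrite /lin2/=; ring].
Unshelve. all: by end_near. Qed.

Lemma qdiff_lip F z a b : qdiff F z a b -> exists2 K, 0 <= K & forall w,
  `|w.1| <= 1 -> `|w.2| <= 1 ->
  `|F (z.1 + w.1, z.2 + w.2) - F z| <= K * (`|w.1| + `|w.2|).
Proof.
move=> [L L0 H]; exists (`|a| + `|b| + 2 * L).
  by rewrite !addr_ge0// mulr_ge0.
move=> w w1 w2; have := H w w1 w2.
set D := F _ - F z; move=> h.
have : `|D| <= `|w.1 * a + w.2 * b| + L * (`|w.1| + `|w.2|) ^+ 2.
  rewrite -[D](subrK (w.1 * a + w.2 * b)) (le_trans (ler_normD _ _))//.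
  by rewrite addrC lerD2l.
have : `|w.1 * a + w.2 * b| <= `|w.1| * `|a| + `|w.2| * `|b|.
  by rewrite (le_trans (ler_normD _ _))// !normrM.
have := normr_ge0 w.1; have := normr_ge0 w.2; have := normr_ge0 a; have := normr_ge0 b.
move: (`|w.1|) (`|w.2|) (`|a|) (`|b|) w1 w2 => p q A B p1 q1 B0 A0 q0 p0 e1 e2.
apply: (le_trans e2); apply: (le_trans (lerD e1 (lexx _))).
have : 0 <= L * (p + q) * (2 - (p + q)) by rewrite !mulr_ge0//; lra.
nra.
Qed.

Lemma qdiff_affine (c a b : R) z : qdiff (fun w => c + w.1 * a + w.2 * b) z a b.
Proof.
exists 0 => // w _ _; rewrite mul0r /=.
by rewrite (_ : _ - _ = 0) ?normr0//; ring.
Qed.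

Lemma qdiffD F G z a b c d : qdiff F z a b -> qdiff G z c d ->
  qdiff (fun w => F w + G w) z (a + c) (b + d).
Proof.
move=> [L L0 H] [K K0 H']; exists (L + K); first exact: addr_ge0.
move=> w w1 w2; have h := H w w1 w2; have h' := H' w w1 w2.
rewrite mulrDl; apply: le_trans (lerD h h'); apply: le_trans (ler_normD _ _).
by rewrite le_eqVlt; apply/orP; left; apply/eqP; congr `| _ |; ring.
Qed.

Lemma qdiffM F G z a b c d : qdiff F z a b -> qdiff G z c d ->
  qdiff (fun w => F w * G w) z (F z * c + G z * a) (F z * d + G z * b).
Proof.
move=> qF qG; have [K1 K10 lF] := qdiff_lip _ _ _ _ qF.
have [K2 K20 lG] := qdiff_lip _ _ _ _ qG.
move: qF qG => [L1 L10 rF] [L2 L20 rG].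
exists (`|F z| * L2 + `|G z| * L1 + K1 * K2).
  by rewrite !addr_ge0// ?mulr_ge0.
move=> w w1 w2; have {}rF := rF w w1 w2; have {}rG := rG w w1 w2.
have {}lF := lF w w1 w2; have {}lG := lG w w1 w2.
set F' := F (_, _) in rF lF *; set G' := G (_, _) in rG lG *.
set n := `|w.1| + `|w.2| in rF lF rG lG *.
rewrite (_ : _ - _ = F z * (G' - G z - (w.1 * c + w.2 * d)) +
  G z * (F' - F z - (w.1 * a + w.2 * b)) + (F' - F z) * (G' - G z)); last by ring.
apply: (le_trans (ler_normD _ _)).
rewrite [leRHS]mulrDl; apply: lerD.
  apply: (le_trans (ler_normD _ _)); rewrite [leRHS]mulrDl.
  by apply: lerD; rewrite normrM -mulrA; exact: ler_wpM2l.
by rewrite normrM (_ : _ * n ^+ 2 = (K1 * n) * (K2 * n)) ?ler_pM//; ring.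
Qed.

Definition pos (s : R) := Num.max s 0.

Lemma pos_ge0 s : 0 <= pos s. Proof. by rewrite /pos le_max lexx orbT. Qed.

Lemma pos_continuous : continuous pos.
Proof. by move=> x; apply: continuous_max; [exact: cvg_id|exact: cvg_cst]. Qed.

(** The positive part is not differentiable, but its square is C^1 with the 2-Lipschitz derivative
    [2 * pos s]. All cutoffs are built from such squares. *)
Lemma pos_sq_rem (s d : R) : `|pos (s + d) ^+ 2 - pos s ^+ 2 - d * (2 * pos s)| <= d ^+ 2.
Proof.
rewrite ler_norml /pos; case: (leP s 0) => s0; case: (leP (s + d) 0) => sd0;
  apply/andP; split; nra.
Qed.

Lemma qdiff_pos_sq F z a b : qdiff F z a b ->
  qdiff (fun w => pos (F w) ^+ 2) z (2 * pos (F z) * a) (2 * pos (F z) * b).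
Proof.
move=> qF; have [K K0 lF] := qdiff_lip _ _ _ _ qF.
move: qF => [L L0 H]; have p0 := pos_ge0 (F z).
exists (K ^+ 2 + 2 * pos (F z) * L); first by rewrite addr_ge0 ?mulr_ge0 ?sqr_ge0.
move=> w w1 w2; have {}H := H w w1 w2; have {}lF := lF w w1 w2.
have := pos_sq_rem (F z) (F (z.1 + w.1, z.2 + w.2) - F z).
rewrite [F z + _]addrC subrK.
set D := F _ - F z in H lF *; set n := `|w.1| + `|w.2| in H lF * => h.
rewrite (_ : _ - (_ + _) = (pos (F (z.1 + w.1, z.2 + w.2)) ^+ 2 - pos (F z) ^+ 2
  - D * (2 * pos (F z))) + (2 * pos (F z)) * (D - (w.1 * a + w.2 * b))); last by ring.
apply: (le_trans (ler_normD _ _)); rewrite [leRHS]mulrDl; apply: lerD.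
  apply: (le_trans h); rewrite -[leLHS]real_normK ?num_real// -exprMn.
  by rewrite ler_pXn2r// nnegrE mulr_ge0// addr_ge0.
rewrite normrM ger0_norm ?mulr_ge0// -mulrA; apply: ler_wpM2l => //.
by rewrite mulr_ge0.
Qed.

(** A smooth substitute for |x| with slope at most 1; it serves to penalise large x in the
    comparison theorem. *)
Lemma qdiff_sqrt z :
  qdiff (fun w => Num.sqrt (1 + w.1 ^+ 2)) z (z.1 / Num.sqrt (1 + z.1 ^+ 2)) 0.
Proof.
exists 1 => // w _ _ /=; rewrite mul1r mulr0 addr0.
have s1 (y : R) : 1 <= Num.sqrt (1 + y ^+ 2).
  by rewrite -[leLHS]sqrtr1 ler_wsqrtr// lerDl sqr_ge0.
have sq (y : R) : Num.sqrt (1 + y ^+ 2) ^+ 2 = 1 + y ^+ 2.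
  by rewrite sqr_sqrtr// addr_ge0// sqr_ge0.
have := s1 z.1; have := s1 (z.1 + w.1); have := sq z.1; have := sq (z.1 + w.1).
set A := Num.sqrt _; set B := Num.sqrt _ => A2 B2 A1 B1.
set x := z.1 in A2 B2 *; set h := w.1 in A2 B2 *.
have B0 : B != 0 by rewrite gt_eqF//; lra.
have xB : `|x| <= B by rewrite -(@ler_pXn2r _ 2)// ?nnegrE ?real_normK ?num_real//; lra.
have AB : `|A - B| <= `|h|.
  have -> : A - B = h * ((2 * x + h) / (A + B)).
    rewrite mulrA -[LHS](mulfK (x := A + B)) ?gt_eqF//; last by lra.
    congr (_ / _); rewrite -subr_sqr A2 B2; ring.
  rewrite normrM ler_piMr// normrM normfV (gtr0_norm (x := A + B)); last by lra.
  rewrite ler_pdivrMr; last by lra.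
  rewrite mul1r (_ : 2 * x + h = (x + h) + x); last by ring.
  rewrite (le_trans (ler_normD _ _))// lerD//.
  by rewrite -(@ler_pXn2r _ 2)// ?nnegrE ?real_normK ?num_real//; lra.
have -> : A - B - h * (x / B) = (h ^+ 2 * B + h * x * (B - A)) / (B * (A + B)).
  have AB0 : A + B != 0 by rewrite gt_eqF//; lra.
  apply: (canRL (mulfK _)); first by rewrite mulf_neq0.
  have -> : (A - B - h * (x / B)) * (B * (A + B)) = B * (A ^+ 2 - B ^+ 2) - h * x * (A + B).
    by field.
  by rewrite A2 B2; ring.
rewrite normrM normfV (gtr0_norm (x := B * (A + B))); last by rewrite mulr_gt0//; lra.
rewrite ler_pdivrMr; last by rewrite mulr_gt0//; lra.
have e1 : `|h ^+ 2 * B + h * x * (B - A)| <= 2 * (`|h| ^+ 2 * B).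
  apply: (le_trans (ler_normD _ _)); rewrite !normrM (gtr0_norm (x := B)); last by lra.
  rewrite (distrC B); have := normr_ge0 h; have := normr_ge0 x.
  move: (`|h|) (`|x|) (`|A - B|) xB AB (normr_ge0 (A - B)) => H X D XB DH D0 X0 H0.
  have : H * X * D <= H * B * H by rewrite ler_pM// ?mulr_ge0// ler_pM.
  by lra.
apply: (le_trans e1); have := normr_ge0 h; have := normr_ge0 w.2.
move: (`|h|) (`|w.2|) => H W W0 H0.
have : H ^+ 2 <= (H + W) ^+ 2 by rewrite ler_pXn2r// ?nnegrE//; lra.
have : 0 <= H ^+ 2 by rewrite sqr_ge0.
move: (H ^+ 2) ((H + W) ^+ 2) => P Q P0 PQ.
have : P * (2 * B) <= Q * (B * (A + B)).
  by apply: ler_pM => //; [lra|nra].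
by lra.
Qed.

End quadratic_remainder.

(** * Box averages of Lipschitz functions *)

Section box_average.
Context {R : realType}.
Implicit Types (U : R * R -> R) (q : R -> R).

Definition lip1 (C : R) q := forall x y, `|q x - q y| <= C * `|x - y|.

Definition lip2 (C : R) U :=
  forall z w, `|U z - U w| <= C * (`|z.1 - w.1| + `|z.2 - w.2|).

Lemma lip1_continuous C q : lip1 C q -> continuous q.
Proof.
move=> lq x; apply/cvgrPdist_lt => e e0.
have C1 : 0 < `|C| + 1 by rewrite ltr_wpDl.
near=> y.
have : `|x - y| < e / (`|C| + 1).
  near: y; apply: cvgr_dist_lt => //; exact: divr_gt0.
rewrite ltr_pdivlMr// => xy; apply: (le_lt_trans (lq x y)).
apply: le_lt_trans xy; rewrite mulrC ler_wpM2l//.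
by rewrite (le_trans (ler_norm C))// lerDl.
Unshelve. all: by end_near. Qed.

Lemma near_box (z : R * R) (d : R) : 0 < d ->
  \forall w \near z, `|w.1 - z.1| < d /\ `|w.2 - z.2| < d.
Proof.
move=> d0; near=> w.
have [] : ball z d w by near: w; exact: (@nbhsx_ballx R (R * R)%type z d d0).
by rewrite /ball/= !(distrC z.1) !(distrC z.2).
Unshelve. all: by end_near. Qed.

Lemma loclip2_continuous U : (forall z, exists K, forall w, `|w.1| <= 1 -> `|w.2| <= 1 ->
  `|U (z.1 + w.1, z.2 + w.2) - U z| <= K * (`|w.1| + `|w.2|)) -> continuous U.
Proof.
move=> lU z; have [K H] := lU z; apply/cvgrPdist_lt => e e0.
have C1 : 0 < `|K| + 1 by rewrite ltr_wpDl.
have d0 : 0 < Num.min 1 (e / (2 * (`|K| + 1))).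
  by rewrite lt_min ltr01 divr_gt0// mulr_gt0.
near=> w.
have [] : `|w.1 - z.1| < Num.min 1 (e / (2 * (`|K| + 1))) /\
    `|w.2 - z.2| < Num.min 1 (e / (2 * (`|K| + 1))).
  by near: w; exact: near_box.
rewrite !lt_min => /andP[a1 a2] /andP[b1 b2].
have := H (w.1 - z.1, w.2 - z.2) (ltW a1) (ltW b1) => /=.
rewrite ![_ + (_ - _)]addrC !subrK -surjective_pairing distrC => h.
apply: (le_lt_trans h).
move: a2 b2; rewrite !ltr_pdivlMr ?mulr_gt0// => a2 b2.
have := ler_norm K.
have := normr_ge0 (w.1 - z.1); have := normr_ge0 (w.2 - z.2).
move: (`|w.1 - z.1|) (`|w.2 - z.2|) a2 b2 => p q a2 b2 q0 p0 KK.
have : K * (p + q) <= `|K| * (p + q) by rewrite ler_wpM2r// addr_ge0.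
by nra.
Unshelve. all: by end_near. Qed.

Lemma lip2_slice1 C U s : lip2 C U -> lip1 C (fun y => U (y, s)).
Proof. by move=> lU x y; have := lU (x, s) (y, s); rewrite /= subrr normr0 addr0. Qed.

Lemma lip2_slice2 C U x : lip2 C U -> lip1 C (fun s => U (x, s)).
Proof. by move=> lU s t; have := lU (x, s) (x, t); rewrite /= subrr normr0 add0r. Qed.

Lemma lip2_continuous C U : lip2 C U -> continuous U.
Proof.
move=> lU; apply: loclip2_continuous => z; exists C => w _ _.
by rewrite (le_trans (lU _ _))//= !(addrAC _ _ (- _)) !subrr !add0r.
Qed.

Lemma lip1_lint C q : lip1 C q -> lint q.
Proof. by move=> /lip1_continuous /continuous_lint. Qed.

Lemma sint_lip C q (t b : R) : lip1 C q -> 0 <= C ->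
  `|sint q t (t + b) - b * q t| <= C * b ^+ 2.
Proof.
move=> lq C0; have := sint_approx q t (t + b) (q t) (C * `|b|) (lip1_lint C q lq).
rewrite (addrC t) addrK -mulrA -normrM (ger0_norm (x := b * b)) ?sqr_ge0//.
apply => x xb; rewrite (le_trans (lq _ _))//; exact: ler_wpM2l.
Qed.

(** Sliding the window by [b] gains a strip at the right end and loses one at the left end; each is
    [b] times an end value of [q], up to [C * b ^+ 2]. *)
Lemma sint_window C q (t b k : R) : lip1 C q -> 0 <= C ->
  `|sint q (t + b) (t + b + k) - sint q t (t + k) - b * (q (t + k) - q t)|
  <= 2 * C * b ^+ 2.
Proof.
move=> lq C0; have lint_q := lip1_lint C q lq.
have h1 := sint_lip C q t b lq C0; have h2 := sint_lip C q (t + k) b lq C0.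
have e1 := sintD_itv q t (t + b) (t + b + k) lint_q.
have e2 := sintD_itv q t (t + k) (t + k + b) lint_q.
rewrite (_ : t + b + k = t + k + b) in e1 *; last by ring.
rewrite (_ : _ - _ - _ = (sint q (t + k) (t + k + b) - b * q (t + k))
   - (sint q t (t + b) - b * q t)); last by lra.
by rewrite (le_trans (ler_normB _ _))//; lra.
Qed.

Section average.
Variables (U : R * R -> R) (C h k : R).
Hypotheses (C0 : 0 <= C) (h0 : 0 < h) (k0 : 0 < k) (lU : lip2 C U).

Let Y y t := sint (fun s => U (y, s)) t (t + k).

Definition box_int z := sint (fun y => sint (fun s => U (y, s)) z.2 (z.2 + k)) z.1 (z.1 + h).
Definition box_int_x z := sint (fun s => U (z.1 + h, s) - U (z.1, s)) z.2 (z.2 + k).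
Definition box_int_t z := sint (fun y => U (y, z.2 + k) - U (y, z.2)) z.1 (z.1 + h).

Let lintU1 s : lint (fun y => U (y, s)).
Proof. exact: lip1_lint (lip2_slice1 _ _ _ lU). Qed.

Let lintU2 y : lint (fun s => U (y, s)).
Proof. exact: lip1_lint (lip2_slice2 _ _ _ lU). Qed.

Let lipY t : lip1 (C * k) (Y ^~ t).
Proof.
move=> x y; rewrite /Y -sintB; [|exact: lintU2..].
apply: (le_trans (sint_bound _ _ _ (C * `|x - y|) _ _)).
- by apply: lintB; exact: lintU2.
- by move=> s _; exact: (lip2_slice1 _ _ s lU).
- by rewrite (addrC t) addrK (gtr0_norm k0) mulrAC.
Qed.

Let Ck0 : 0 <= C * k. Proof. by rewrite mulr_ge0// ltW. Qed.

Let lintY t : lint (Y ^~ t). Proof. exact: lip1_lint (lipY t). Qed.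

Let Y_window y t b : `|Y y (t + b) - Y y t - b * (U (y, t + k) - U (y, t))| <= 2 * C * b ^+ 2.
Proof. exact: sint_window (lip2_slice2 _ _ y lU) C0. Qed.

Let Y_t y t b : `|b| <= 1 -> `|Y y (t + b) - Y y t| <= (C * k + 2 * C) * `|b|.
Proof.
move=> b1; have hw := Y_window y t b.
have hU : `|U (y, t + k) - U (y, t)| <= C * k.
  by have := lU (y, t + k) (y, t); rewrite /= subrr normr0 add0r addrAC subrr add0r (gtr0_norm k0).
rewrite -[X in `|X|](subrK (b * (U (y, t + k) - U (y, t)))).
rewrite (le_trans (ler_normD _ _))// normrM.
have : b ^+ 2 <= `|b| by rewrite -[leLHS]real_normK ?num_real// expr2 ler_piMr.
move: (`|b|) (`|_ - _ - _|) hw hU (normr_ge0 b) => B D hw hU B0 b2.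
have : B * `|U (y, t + k) - U (y, t)| <= B * (C * k) by rewrite ler_wpM2l.
have : C * b ^+ 2 <= C * B by rewrite ler_wpM2l.
lra.
Qed.

Let box_int_xE z : box_int_x z = Y (z.1 + h) z.2 - Y z.1 z.2.
Proof. by rewrite /box_int_x sintB. Qed.

(** The displacement (a, b) is split into a move by [a] at the new time and a move by [b] at the old
    position; the mismatch is [a] times an increment of order [b]. The derivatives are increments of
    [U] across the box, which for a potential are integrals of [g] and of [- f(g)]. *)
Lemma box_int_qdiff z : qdiff box_int z (box_int_x z) (box_int_t z).
Proof.
exists (2 * (C * k) + 2 * (C * k + 2 * C) + 2 * C * h).
  by rewrite !addr_ge0 ?mulr_ge0// ?addr_ge0 ?mulr_ge0// ltW.
move=> [a b] /= a1 b1; case: z => x t /=; rewrite /box_int /box_int_t /=.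
have h1 := sint_window _ (Y ^~ (t + b)) x a h (lipY (t + b)) Ck0.
have h2 : `|sint (Y ^~ (t + b)) x (x + h) - sint (Y ^~ t) x (x + h) -
   b * sint (fun y => U (y, t + k) - U (y, t)) x (x + h)| <= 2 * C * b ^+ 2 * h.
  rewrite -sintB// -sintZ; last exact: lintB.
  rewrite -sintB; [|exact: lintB|exact/lintZ/lintB].
  rewrite (le_trans (sint_bound _ _ _ (2 * C * b ^+ 2) _ _))//.
    by apply: lintB; [exact: lintB|exact/lintZ/lintB].
  by rewrite (addrC x) addrK (gtr0_norm h0).
have h3 : `|a * ((Y (x + h) (t + b) - Y x (t + b)) - (Y (x + h) t - Y x t))| <=
    `|a| * (2 * (C * k + 2 * C) * `|b|).
  rewrite normrM; apply: ler_wpM2l => //.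
  rewrite (_ : _ - _ = (Y (x + h) (t + b) - Y (x + h) t) - (Y x (t + b) - Y x t)); last by ring.
  rewrite (le_trans (ler_normB _ _))//.
  by have := Y_t (x + h) t b b1; have := Y_t x t b b1; lra.
rewrite -/(Y _ _) box_int_xE /=.
have -> : (fun y => sint (fun s => U (y, s)) (t + b) (t + b + k)) = Y ^~ (t + b) by [].
have -> : (fun y => sint (fun s => U (y, s)) t (t + k)) = Y ^~ t by [].
set A := sint (Y ^~ (t + b)) (x + a) _ in h1 *.
set B := sint (Y ^~ (t + b)) x _ in h1 h2 *; set D := sint (Y ^~ t) x _ in h2 *.
set G := sint _ x _ in h2 *.
move: A B D G (Y (x + h) (t + b)) (Y x (t + b)) (Y (x + h) t) (Y x t) h1 h2 h3
  => A B D G y1 y2 y3 y4 h1 h2 h3.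
have -> : A - D - (a * (y3 - y4) + b * G) = (A - B - a * (y1 - y2)) + (B - D - b * G) +
  a * ((y1 - y2) - (y3 - y4)) by ring.
rewrite (le_trans (ler_normD _ _))//.
apply: (le_trans (lerD (le_trans (ler_normD _ _) (lerD h1 h2)) h3)).
rewrite -[a ^+ 2]real_normK ?num_real// -[b ^+ 2]real_normK ?num_real//.
have := normr_ge0 a; have := normr_ge0 b; move: (`|a|) (`|b|) => p q q0 p0.
have P0 : 0 <= C * k := Ck0.
have Q0 : 0 <= C * h by rewrite mulr_ge0// ltW.
move: (C * k) P0 => P P0.
rewrite (_ : 2 * C * q ^+ 2 * h = 2 * (C * h) * q ^+ 2); last by ring.
rewrite (_ : 2 * C * h = 2 * (C * h)); last by ring.
move: (C * h) Q0 => Q Q0.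
have e1 : p ^+ 2 <= (p + q) ^+ 2 by rewrite ler_pXn2r// ?nnegrE; lra.
have e2 : q ^+ 2 <= (p + q) ^+ 2 by rewrite ler_pXn2r// ?nnegrE; lra.
have e3 : p * q <= (p + q) ^+ 2 by nra.
have : P * p ^+ 2 <= P * (p + q) ^+ 2 by rewrite ler_wpM2l.
have : Q * q ^+ 2 <= Q * (p + q) ^+ 2 by rewrite ler_wpM2l.
have : (P + 2 * C) * (p * q) <= (P + 2 * C) * (p + q) ^+ 2.
  by rewrite ler_wpM2l// addr_ge0// mulr_ge0.
lra.
Qed.

Lemma box_int_x_continuous : continuous box_int_x.
Proof.
apply: loclip2_continuous => -[x t]; exists (2 * (C * k) + 2 * (C * k + 2 * C)).
move=> [a b] /= a1 b1; rewrite !box_int_xE /=.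
have h1 := Y_t (x + h) t b b1; have h2 := Y_t x t b b1.
have h3 := lipY (t + b) (x + a + h) (x + h).
have h4 := lipY (t + b) (x + a) x.
rewrite (_ : x + a + h - (x + h) = a) in h3; last by ring.
rewrite (_ : x + a - x = a) in h4; last by ring.
rewrite (_ : _ - _ - _ = (Y (x + a + h) (t + b) - Y (x + h) (t + b)) -
  (Y (x + a) (t + b) - Y x (t + b)) + ((Y (x + h) (t + b) - Y (x + h) t) -
  (Y x (t + b) - Y x t))); last by ring.
rewrite (le_trans (ler_normD _ _))//.
apply: (le_trans (lerD (ler_normB _ _) (ler_normB _ _))).
apply: (le_trans (lerD (lerD h3 h4) (lerD h1 h2))).
have := normr_ge0 a; have := normr_ge0 b; move: (`|a|) (`|b|) => p q q0 p0.
have : 0 <= C * k * q by rewrite mulr_ge0.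
have : 0 <= C * k * p by rewrite mulr_ge0.
have : 0 <= C * p by rewrite mulr_ge0.
nra.
Qed.

Lemma box_int_t_continuous : continuous box_int_t.
Proof.
apply: loclip2_continuous => -[x t]; exists (2 * (C * h) + 2 * (C * h) + 4 * C).
move=> [a b] /= a1 b1; rewrite /box_int_t /=.
pose D s y := U (y, s + k) - U (y, s).
have lD s : lip1 (2 * C) (D s).
  move=> y y'; rewrite /D (_ : _ - _ = (U (y, s + k) - U (y', s + k)) - (U (y, s) - U (y', s))); last by ring.
  rewrite (le_trans (ler_normB _ _))//.
  by have := lip2_slice1 _ _ (s + k) lU y y'; have := lip2_slice1 _ _ s lU y y'; lra.
have DC s y : `|D s y| <= C * k.
  by have := lU (y, s + k) (y, s); rewrite /= subrr normr0 add0r addrAC subrr add0r (gtr0_norm k0).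
have C20 : 0 <= 2 * C by rewrite mulr_ge0.
have h1 := sint_window _ (D (t + b)) x a h (lD (t + b)) C20.
have h2 : `|sint (D (t + b)) x (x + h) - sint (D t) x (x + h)| <= 2 * C * `|b| * h.
  rewrite -sintB; [|exact: lip1_lint (lD _)..].
  rewrite (le_trans (sint_bound _ _ _ (2 * C * `|b|) _ _))//.
  - by apply: lintB; exact: lip1_lint (lD _).
  - move=> y _; rewrite /D (_ : _ - _ = (U (y, t + b + k) - U (y, t + k)) - (U (y, t + b) - U (y, t))); last by ring.
    rewrite (le_trans (ler_normB _ _))//.
    have := lip2_slice2 _ _ y lU (t + b + k) (t + k).
    have := lip2_slice2 _ _ y lU (t + b) t.
    rewrite (_ : t + b + k - (t + k) = b); last by ring.
    by rewrite (_ : t + b - t = b); [lra|ring].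
  - by rewrite (addrC x) addrK (gtr0_norm h0).
have h3 : `|a * (D (t + b) (x + h) - D (t + b) x)| <= `|a| * (2 * C * h).
  rewrite normrM ler_wpM2l//; have := lD (t + b) (x + h) x.
  by rewrite [x + h - x]addrAC subrr add0r (gtr0_norm h0).
rewrite -/(D _) -[sint _ (x + a) _ - _](subrK (a * (D (t + b) (x + h) - D (t + b) x))).
rewrite -/(D t).
have -> : sint (D (t + b)) (x + a) (x + a + h) - sint (D t) x (x + h) -
   a * (D (t + b) (x + h) - D (t + b) x) =
   (sint (D (t + b)) (x + a) (x + a + h) - sint (D (t + b)) x (x + h) -
   a * (D (t + b) (x + h) - D (t + b) x)) +
   (sint (D (t + b)) x (x + h) - sint (D t) x (x + h)) by ring.
rewrite (le_trans (ler_normD _ _))//.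
apply: (le_trans (lerD (le_trans (ler_normD _ _) (lerD h1 h2)) h3)).
have : a ^+ 2 <= `|a| by rewrite -[leLHS]real_normK ?num_real// expr2 ler_piMr.
have := normr_ge0 a; have := normr_ge0 b; move: (`|a|) (`|b|) (a ^+ 2) => p q s q0 p0 sp.
have : C * s <= C * p by rewrite ler_wpM2l.
have : 0 <= C * h * q by rewrite !mulr_ge0// ltW.
have : 0 <= C * h * p by rewrite !mulr_ge0// ltW.
have : 0 <= C * q by rewrite mulr_ge0.
nra.
Qed.

Definition box_avg z := (h * k)^-1 * box_int z.
Definition box_avg_x z := (h * k)^-1 * box_int_x z.
Definition box_avg_t z := (h * k)^-1 * box_int_t z.

Let hk0 : 0 < h * k. Proof. exact: mulr_gt0. Qed.

Lemma box_avg_C1 : C1 box_avg box_avg_x box_avg_t.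
Proof.
split.
- move=> z; have := qdiffM _ _ _ _ _ _ _ (qdiff_affine (h * k)^-1 0 0 z) (box_int_qdiff z).
  rewrite !mulr0 !addr0.
  by congr qdiff; apply/funext => w; rewrite !mulr0 !addr0.
- by move=> z; apply: cvgMr; exact: box_int_x_continuous.
- by move=> z; apply: cvgMr; exact: box_int_t_continuous.
Qed.

Lemma box_avg_approx z : `|box_avg z - U z| <= C * (h + k).
Proof.
case: z => x t; rewrite /box_avg.
rewrite -[X in _ - X](mulKf (x := h * k)) ?gt_eqF// -mulrBr normrM normfV.
rewrite (gtr0_norm hk0) ler_pdivrMl// /box_int/=.
have := sint_approx (Y ^~ t) x (x + h) (k * U (x, t)) (C * (h + k) * k) (lintY t).
rewrite (addrC x) addrK (gtr0_norm h0) (mulrA h) [leRHS]mulrC.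
rewrite (_ : h * k * (C * (h + k)) = h * (C * (h + k) * k)); last by ring.
apply => y yh; have := sint_approx (fun s => U (y, s)) t (t + k) (U (x, t)) (C * (h + k)) (lintU2 y).
rewrite [X in X - t](addrC t) addrK (gtr0_norm k0); apply => s sk.
by rewrite (le_trans (lU _ _))//= ler_wpM2l// lerD.
Qed.

Lemma box_avg_x_bound z : `|box_avg_x z| <= C.
Proof.
rewrite /box_avg_x normrM normfV (gtr0_norm hk0) ler_pdivrMl//.
rewrite (le_trans (sint_bound _ _ _ (C * h) _ _))//.
- by apply: lintB.
- move=> s _; rewrite (le_trans (lU _ _))//= subrr normr0 addr0 addrAC subrr add0r.
  by rewrite (gtr0_norm h0).
- by rewrite (addrC z.2) addrK (gtr0_norm k0)// (mulrC C) mulrAC.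
Qed.

Lemma box_avg_t_bound z : `|box_avg_t z| <= C.
Proof.
rewrite /box_avg_t normrM normfV (gtr0_norm hk0) ler_pdivrMl//.
rewrite (le_trans (sint_bound _ _ _ (C * k) _ _))//.
- by apply: lintB.
- move=> y _; rewrite (le_trans (lU _ _))//= subrr normr0 add0r addrAC subrr add0r.
  by rewrite (gtr0_norm k0).
- by rewrite (addrC z.1) addrK (gtr0_norm h0)// (mulrC C) mulrAC (mulrC k).
Qed.

End average.
End box_average.

(** * Bounded versions of entropy solutions *)

Section entropy_iterated.
Context {R : realType}.
Notation mu := (@lebesgue_measure R).
Notation mu2 := (mu \x mu)%E.
Implicit Types (g phi phix phit F Fx Ft G : R * R -> R) (f v : R -> R) (k r : R).

Definition in_box r (z : R * R) := `|z.1| <= r /\ `|z.2| <= r.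

Lemma box_compact r : compact [set z : R * R | in_box r z].
Proof.
have -> : [set z : R * R | in_box r z] = (`[- r, r] : set R) `*` (`[- r, r] : set R).
  by apply/seteqP; split => -[x t]; rewrite /in_box /= !in_itv/= !ler_norml => -[].
by apply: compact_setX; exact: segment_compact.
Qed.

Lemma cont_box_bmf r G : continuous G -> (forall z, ~ in_box r z -> G z = 0) -> bmf G.
Proof.
move=> cG G0; split; first exact: continuous_measurable2.
have [B0|/set0P/negP] := pselect ([set z : R * R | in_box r z] !=set0).
  have cN : {within [set z : R * R | in_box r z], continuous (fun z => `|G z|)}.
    by apply: continuous_subspaceT => z; apply: cvg_norm; exact: cG.
  have [c _ Hc] := compact_EVT_max B0 (box_compact r) cN.
  exists `|G c| => z; have [zb|/G0 ->] := pselect (in_box r z); last by rewrite normr0.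
  by apply: Hc; rewrite inE.
rewrite negbK => /eqP B0; exists 0 => z; rewrite G0 ?normr0// => zb.
by have : [set z : R * R | in_box r z] z by []; rewrite B0.
Qed.

Lemma measurable_sgr d (T : measurableType d) D (q : T -> R) :
  measurable_fun D q -> measurable_fun D (fun x => Num.sg (q x)).
Proof.
move=> mq; have -> : (fun x => Num.sg (q x)) = (@Num.sg R) \o q by [].
apply: measurableT_comp => //.
have -> : @Num.sg R = (fun x => (if 0 < x then 1 else 0) - (if x < 0 then 1 else 0)).
  by apply/funext => x; case: sgrP => //; rewrite ?subr0 ?sub0r ?subrr.
by apply: measurable_funB; apply: measurable_fun_ifT => //; exact: measurable_fun_ltr.
Qed.

Lemma half_plane_integral G r : 0 <= r -> bmf G -> (forall z, ~ in_box r z -> G z = 0) ->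
  \int[mu2]_(z in [set z | 0 < z.2]) G z =
  sint (fun y => sint (fun s => G (y, s)) 0 r) (- r) r.
Proof.
move=> r0 bG G0; set D := [set z : R * R | 0 < z.2].
have mD : measurable D.
  have -> : D = setT `*` `]0, +oo[%classic.
    by apply/seteqP; split => -[x t] /=; rewrite in_itv/= andbT// => -[].
  exact: measurableX.
have bDG : bmf (fun z => \1_D z * G z) by apply: bmfM => //; exact: bmf_indic.
rewrite Rintegral_indic.
have -> : (fun z => \1_D z * G z) =
    (fun z => \1_(`[- r, r] `*` `[- r, r]) z * (\1_D z * G z)).
  apply/funext => z; have [[z1 z2]|/G0 ->] := pselect (in_box r z); last by rewrite !mulr0.
  rewrite [X in _ = X * _]indicE mem_set ?mul1r//.
  by split; rewrite /= in_itv/= -ler_norml.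
have rr : - r <= r by lra.
rewrite -(Rintegral_indic _ _ mu2 (`[- r, r] `*` `[- r, r]) (fun z => \1_D z * G z)).
rewrite (Rintegral_box _ (- r) r (- r) r bDG rr rr); apply: (eq_sint _ _ _ _ rr) => y _.
rewrite -(sintD_itv _ _ 0); last exact/bmf_lint/(bmf_slice2 _ y bDG).
rewrite (@eq_sint _ _ (fun=> 0)); [|by lra|]; last first.
  by move=> s /andP[_ s0]; rewrite indicE memNset ?mul0r//= /D /=; apply/negP; rewrite -leNgt.
rewrite sint_cst mulr0 add0r !sintE//.
have lG : mu.-integrable `[0, r] (EFin \o (fun s => \1_D (y, s) * G (y, s))).
  exact/bmf_lint/(bmf_slice2 _ y bDG).
have lG' : mu.-integrable `[0, r] (EFin \o (fun s => G (y, s))).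
  exact/bmf_lint/(bmf_slice2 _ y bG).
rewrite -!Rintegral_itv_obnd_cbnd.
- apply: eq_Rintegral => s; rewrite inE/= in_itv/= => /andP[s0 _].
  by rewrite indicE mem_set ?mul1r.
- by apply: integrableS lG' => //; apply: subset_itvr; rewrite bnd_simp.
- by apply: integrableS lG => //; apply: subset_itvr; rewrite bnd_simp.
Qed.

Lemma line_integral (q : R -> R) r : 0 <= r -> bmf q -> (forall x, r < `|x| -> q x = 0) ->
  \int[mu]_x q x = sint q (- r) r.
Proof.
move=> r0 bq q0; rewrite sintE; last by lra.
rewrite [RHS]Rintegral_indic; congr Rintegral; apply/funext => x.
rewrite indicE; have [xr|/q0 ->] := leP `|x| r; last by rewrite mulr0.
by rewrite mem_set ?mul1r//= in_itv/= -ler_norml.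
Qed.

Definition entropy_integrand f g phix phit k (z : R * R) :=
  `|g z - k| * phit z + Num.sg (g z - k) * (f (g z) - f k) * phix z.

(* [g] is bounded everywhere, and the integrals are iterated over a box [-r, r] x [0, r]
   outside which the test function vanishes. *)
Definition bounded_entropy_solution f v g := [/\ bmf g, bmf v &
  forall k r phi phix phit, C1 phi phix phit -> 0 <= r ->
  (forall z, ~ in_box r z -> [/\ phi z = 0, phix z = 0 & phit z = 0]) ->
  (forall z, 0 <= phi z) ->
  0 <= sint (fun y => sint (fun s => entropy_integrand f g phix phit k (y, s)) 0 r) (- r) r
     + sint (fun x => `|v x - k| * phi (x, 0)) (- r) r].

Lemma C1_continuous F Fx Ft : C1 F Fx Ft -> continuous F.
Proof.
move=> [qF _ _] z; have [dF _ _] := qdiff_differentiable _ _ _ _ (qF z).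
exact: differentiable_continuous.
Qed.

Lemma C1_test_fun phi phix phit r : C1 phi phix phit ->
  (forall z, ~ in_box r z -> phi z = 0) -> (forall z, 0 <= phi z) ->
  [/\ test_fun phi, forall z, 'D_((1, 0) : R * R) phi z = phix z &
      forall z, 'D_((0, 1) : R * R) phi z = phit z].
Proof.
move=> [qphi cx ct] phi0 phi_ge0.
have Dx : 'D_((1, 0) : R * R) phi = phix.
  by apply/funext => z; have [_ -> _] := qdiff_differentiable _ _ _ _ (qphi z).
have Dt : 'D_((0, 1) : R * R) phi = phit.
  by apply/funext => z; have [_ _ ->] := qdiff_differentiable _ _ _ _ (qphi z).
split=> [|z|z]; [|by rewrite -Dx|by rewrite -Dt].
split.
  by move=> z; have [] := qdiff_differentiable _ _ _ _ (qphi z).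
rewrite Dx Dt; split => //; split => //; split => //.
by exists r => z zr; apply: phi0 => -[z1 z2]; case: zr; rewrite ltNge ?z1 ?z2.
Qed.

Lemma bmf_entropy_integrand f g phix phit k : continuous f -> bmf g -> bmf phix -> bmf phit ->
  bmf (entropy_integrand f g phix phit k).
Proof.
move=> cf bg bx bt.
have bgk : bmf (fun z => g z - k) by apply: bmfB => //; exact: bmf_cst.
have bfg : bmf (fun z => f (g z) - f k) by apply: bmfB; [exact: bmf_cont|exact: bmf_cst].
apply: bmfD; first by apply: bmfM => //; exact: bmf_norm.
apply: bmfM => //; apply: bmfM => //; split; first exact: measurable_sgr bgk.1.
by exists 1 => z; rewrite normr_sg; case: (_ == _).
Qed.

Definition clamp (M s : R) := Num.max (- M) (Num.min M s).

Lemma clamp_bound M s : 0 <= M -> `|clamp M s| <= M.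
Proof.
move=> M0; rewrite ler_norml /clamp le_max lexx /= ge_max ge_min lexx /= andbT.
by lra.
Qed.

Lemma clamp_id M s : `|s| <= M -> clamp M s = s.
Proof. by rewrite ler_norml /clamp => /andP[a b]; rewrite (min_idPr b) (max_idPr a). Qed.

Lemma measurable_clamp M : measurable_fun setT (clamp M).
Proof.
apply: measurable_maxr; first exact: measurable_cst.
by apply: measurable_minr; first exact: measurable_cst.
Qed.

(** Changing the solution and its data on null sets alters neither integral, and C^1 functions
    vanishing outside a box are test functions. *)
Lemma bounded_version f u0 u M0 : continuous f -> entropy_solution f u0 u ->
  measurable_fun setT u0 -> {ae mu, forall x, `|u0 x| <= M0} ->
  exists g v, [/\ bounded_entropy_solution f v g,
    {ae mu2, forall z, 0 < z.2 -> g z = u z} & {ae mu, forall x, v x = u0 x}].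
Proof.
move=> cf [mu_ [[M1 uM] ent]] mu0 u0M.
set D := [set z : R * R | 0 < z.2] in mu_ ent.
have mD : measurable D.
  have -> : D = setT `*` `]0, +oo[%classic.
    by apply/seteqP; split => -[x t] /=; rewrite in_itv/= andbT// => -[].
  exact: measurableX.
pose M := `|M0| + `|M1|.
have M_ge0 : 0 <= M by rewrite addr_ge0.
(* Truncation at a level above both essential bounds changes values only on null sets. Outside t > 0
   the value is set to 0, which makes [g] bounded and measurable on the whole plane. *)
pose g := (clamp M \o u) \_ D; pose v := clamp M \o u0.
have gu : {ae mu2, forall z, 0 < z.2 -> g z = u z}.
  apply: ae_imp uM => z H z2; rewrite /g patchE mem_set//= clamp_id//.
  by rewrite (le_trans (H z2))// (le_trans (ler_norm _))// lerDr.
have vu : {ae mu, forall x, v x = u0 x}.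
  apply: ae_imp u0M => x H; rewrite /v /= clamp_id//.
  by rewrite (le_trans H)// (le_trans (ler_norm _))// lerDl.
have bg : bmf g.
  split.
    apply: (iffLR (measurable_restrictT _ mD)).
    exact: (measurableT_comp (measurable_clamp M) mu_).
  exists M => z; rewrite /g patchE; case: ifP => _; last by rewrite normr0.
  exact: clamp_bound.
have bv : bmf v.
  split; first exact: (measurableT_comp (measurable_clamp M) mu0).
  by exists M => x; exact: clamp_bound.
exists g, v; split => //; split => // k r phi phix phit C1phi r0 phi0 phi_ge0.
have [tphi Dx Dt] := C1_test_fun phi phix phit r C1phi
  (fun z zr => let: And3 h _ _ := phi0 z zr in h) phi_ge0.
have := ent k phi tphi.
have -> : (fun z => `|u z - k| * 'D_((0, 1) : R * R) phi z +
    Num.sg (u z - k) * (f (u z) - f k) * 'D_((1, 0) : R * R) phi z) =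
  (fun z => `|u z - k| * phit z + Num.sg (u z - k) * (f (u z) - f k) * phix z).
  by apply/funext => z; rewrite Dx Dt.
have [_ cx ct] := C1phi.
have bx : bmf phix by apply: (cont_box_bmf r) => // z /phi0[].
have bt : bmf phit by apply: (cont_box_bmf r) => // z /phi0[].
have bp : bmf phi.
  by apply: (cont_box_bmf r) => [|z /phi0[]//]; exact: C1_continuous C1phi.
have bE := bmf_entropy_integrand f g phix phit k cf bg bx bt.
rewrite -half_plane_integral//; last first.
  by move=> z /phi0[_ px pt]; rewrite /entropy_integrand px pt !mulr0 addr0.
have bvp : bmf (fun x => `|v x - k| * phi (x, 0)).
  by apply: bmfM; [apply/bmf_norm/bmfB => //; exact: bmf_cst|exact: (bmf_slice1 _ 0 bp)].
rewrite -line_integral//; last first.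
  move=> x xr; have [|-> _ _] := phi0 (x, 0); last by rewrite mulr0.
  by rewrite /in_box /= => -[]; rewrite leNgt xr.
have -> : Rintegral mu setT (fun x => `|v x - k| * phi (x, 0)) =
          Rintegral mu setT (fun x => `|u0 x - k| * phi (x, 0)).
  congr fine; apply: ae_eq_integral => //.
  - by apply/measurable_EFinP; exact: bvp.1.
  - apply/measurable_EFinP; apply: measurable_funM; last exact: (bmf_slice1 _ 0 bp).1.
    by apply: measurableT_comp => //; apply: measurable_funB => //; exact: measurable_cst.
  - by apply: ae_imp vu => x /= ->.
have -> // : Rintegral mu2 D (entropy_integrand f g phix phit k) = Rintegral (@leb2 R) D
   (fun z => `|u z - k| * phit z + Num.sg (u z - k) * (f (u z) - f k) * phix z).
congr fine; apply: ae_eq_integral => //.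
- by apply/measurable_EFinP; exact: measurable_funTS bE.1.
- apply/measurable_EFinP.
  have muk : measurable_fun D (fun z => u z - k) by apply: measurable_funB.
  apply: measurable_funD; apply: measurable_funM; rewrite ?bt.1 ?bx.1//.
  + exact: measurableT_comp.
  + exact: measurable_funTS bt.1.
  + apply: measurable_funM; first exact: measurable_sgr.
    apply: measurable_funB => //; apply: measurableT_comp => //.
    exact: continuous_measurable_fun.
  + exact: measurable_funTS bx.1.
- by apply: ae_imp gu => z H zD; rewrite /entropy_integrand /= H.
Qed.

End entropy_iterated.

(** * Kernels and Lebesgue points *)

Section smooth_step.
Context {R : realType}.
Implicit Types (s t d e x y a b : R).

(** Cutting [0, x] into n equal steps bounds the total increment by [C * x ^+ 2 / n], which tends to
    0. This takes the place of the fundamental theorem of calculus for the explicit primitives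
    below. *)
Lemma sublinear_increments_cst (G : R -> R) C :
  (forall t b, 0 <= t -> 0 <= b -> `|G (t + b) - G t| <= C * b ^+ 2) ->
  forall x, 0 <= x -> G x = G 0.
Proof.
move=> H x x0; apply/eqP; rewrite -subr_eq0 -normr_le0 leNgt; apply/negP => D0.
set D := `|_| in D0.
have step n (d : R) : 0 <= d -> `|G (n%:R * d) - G 0| <= n%:R * (C * d ^+ 2).
  move=> d0; elim: n => [|n IH]; first by rewrite !mul0r subrr normr0.
  rewrite -natr1 !mulrDl !mul1r.
  rewrite (_ : _ - _ = (G (n%:R * d) - G 0) + (G (n%:R * d + d) - G (n%:R * d))); last by ring.
  by rewrite (le_trans (ler_normD _ _))// lerD// H// mulr_ge0.
have key n : n.+1%:R * D <= C * x ^+ 2.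
  have n0 : (n.+1%:R : R) != 0 by rewrite pnatr_eq0.
  have E : n.+1%:R * (x / n.+1%:R) = x by field.
  have := step n.+1 (x / n.+1%:R); rewrite E divr_ge0// => /(_ isT) h.
  apply: (le_trans (ler_wpM2l (ler0n R n.+1) h)).
  by rewrite le_eqVlt; apply/orP; left; apply/eqP; field.
have := key (Num.truncn (C * x ^+ 2 / D)); apply/negP; rewrite -ltNge.
by rewrite -ltr_pdivrMr//; exact: truncnS_gt.
Qed.

(** The tent on [0, 1] with peak 2 at 1/2, hence of integral 1. Its primitive [smooth_step] is a
    combination of squares of positive parts. *)
Definition hat s : R := 4 * (pos s - 2 * pos (s - 2^-1) + pos (s - 1)).

Definition smooth_step s : R :=
  2 * (pos s ^+ 2 - 2 * pos (s - 2^-1) ^+ 2 + pos (s - 1) ^+ 2).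

Let half : 2 * (2^-1 : R) = 1. Proof. by rewrite mulfV. Qed.

Lemma hat_ge0 s : 0 <= hat s.
Proof.
rewrite /hat /pos; have := half; case: (leP s 0) => ?; case: (leP (s - 2^-1) 0) => ?;
  case: (leP (s - 1) 0) => ?; lra.
Qed.

Lemma hat_le2 s : hat s <= 2.
Proof.
rewrite /hat /pos; have := half; case: (leP s 0) => ?; case: (leP (s - 2^-1) 0) => ?;
  case: (leP (s - 1) 0) => ?; lra.
Qed.

Lemma hat_out s : s <= 0 \/ 1 <= s -> hat s = 0.
Proof.
rewrite /hat /pos; have := half; case: (leP s 0) => ?; case: (leP (s - 2^-1) 0) => ?;
  case: (leP (s - 1) 0) => ? ?; case=> ?; lra.
Qed.

Lemma pos_lip s t : `|pos s - pos t| <= `|s - t|.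
Proof.
have := ler_norm (s - t); have := ler_norm (t - s); rewrite (distrC t).
by rewrite ler_norml /pos; case: (leP s 0) => ?; case: (leP t 0) => ? ? ?;
  apply/andP; split; lra.
Qed.

Lemma hat_lip : lip1 16 hat.
Proof.
move=> s t; rewrite /hat.
have h1 := pos_lip s t; have h2 := pos_lip (s - 2^-1) (t - 2^-1).
have h3 := pos_lip (s - 1) (t - 1).
have e u : s - u - (t - u) = s - t by ring.
rewrite !e in h2 h3; move: h1 h2 h3; rewrite !ler_norml.
by move=> /andP[? ?] /andP[? ?] /andP[? ?]; apply/andP; split; lra.
Qed.

Lemma smooth_step_rem s d : `|smooth_step (s + d) - smooth_step s - d * hat s| <= 8 * d ^+ 2.
Proof.
have h1 := pos_sq_rem s d; have h2 := pos_sq_rem (s - 2^-1) d.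
have h3 := pos_sq_rem (s - 1) d; rewrite /smooth_step /hat.
rewrite ![s + d - _]addrAC; move: h1 h2 h3; rewrite !ler_norml.
by move=> /andP[? ?] /andP[? ?] /andP[? ?]; apply/andP; split; lra.
Qed.

Lemma smooth_step0 s : s <= 0 -> smooth_step s = 0.
Proof.
move=> s0; have := half; rewrite /smooth_step /pos; case: (leP s 0) => ?;
  case: (leP (s - 2^-1) 0) => ?; case: (leP (s - 1) 0) => ? ?; lra.
Qed.

Lemma smooth_step1 s : 1 <= s -> smooth_step s = 1.
Proof.
move=> s0; have h := half; rewrite /smooth_step /pos; case: (leP s 0) => ?;
  case: (leP (s - 2^-1) 0) => ?; case: (leP (s - 1) 0) => ?; try lra; try by field.
have s1 : s = 1 by lra.
by rewrite s1; field.
Qed.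

Lemma lint_hat : lint hat. Proof. exact: lip1_lint hat_lip. Qed.

Lemma sint_hat a b : a <= b -> sint hat a b = smooth_step b - smooth_step a.
Proof.
move=> ab; pose G x := smooth_step (a + x) - sint hat a (a + x).
(* 24 = 8 + 16: the remainder of [smooth_step] plus the Lipschitz constant of [hat]. *)
have := @sublinear_increments_cst G 24 _ (b - a); rewrite subr_ge0 => /(_ _ ab).
rewrite /G !addr0 sintxx subr0 [a + _]addrC subrK => <-; first by ring.
move=> t c _ _; rewrite -(sintD_itv hat a (a + t) (a + (t + c)) lint_hat) addrA.
have h1 := smooth_step_rem (a + t) c.
have h2 := sint_lip 16 hat (a + t) c hat_lip (ler0n _ _).
move: h1 h2; set A := smooth_step _; set B := smooth_step _; set S := sint _ _ _.
set H := hat _; set T := sint _ _ _.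
move: A B S H T => A B S H T; rewrite !ler_norml.
by move=> /andP[? ?] /andP[? ?]; apply/andP; split; lra.
Qed.

Lemma smooth_step_le s t : s <= t -> smooth_step s <= smooth_step t.
Proof.
move=> st; rewrite -subr_ge0 -sint_hat// sintE//; apply: Rintegral_ge0 => x _.
exact: hat_ge0.
Qed.

Lemma smooth_step_ge0 s : 0 <= smooth_step s.
Proof.
have [s0|s0] := leP s 0; first by rewrite smooth_step0.
by rewrite -(smooth_step0 0)// smooth_step_le// ltW.
Qed.

Lemma smooth_step_le1 s : smooth_step s <= 1.
Proof.
have [s0|s0] := leP s 1; last by rewrite smooth_step1// ltW.
by rewrite -(smooth_step1 1)// smooth_step_le.
Qed.

Lemma smooth_step_lip : lip1 2 smooth_step.
Proof.
move=> x y; wlog yx : x y / y <= x => [H|].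
  by case: (leP y x) => [|/ltW] /H//; rewrite distrC (distrC y).
rewrite -sint_hat// sint_bound//; first exact: lint_hat.
by move=> z _; rewrite ger0_norm ?hat_ge0 ?hat_le2.
Qed.

Lemma bmf_smooth_step : bmf smooth_step.
Proof.
split; first exact: continuous_measurable_fun (lip1_continuous _ _ smooth_step_lip).
by exists 1 => x; rewrite ger0_norm ?smooth_step_ge0 ?smooth_step_le1.
Qed.

Lemma bmf_hat : bmf hat.
Proof.
split; first exact: continuous_measurable_fun (lip1_continuous _ _ hat_lip).
by exists 2 => x; rewrite ger0_norm ?hat_ge0 ?hat_le2.
Qed.

End smooth_step.

(** * Calculus of C^1 functions of two variables *)

Section C1_calculus.
Context {R : realType}.
Implicit Types (F Fx Ft G Gx Gt : R * R -> R).

Lemma C1_affine (c a b : R) : C1 (fun z => c + z.1 * a + z.2 * b) (fun=> a) (fun=> b).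
Proof. by split=> z; [exact: qdiff_affine|exact: cvg_cst|exact: cvg_cst]. Qed.

Lemma C1D F Fx Ft G Gx Gt : C1 F Fx Ft -> C1 G Gx Gt ->
  C1 (fun z => F z + G z) (fun z => Fx z + Gx z) (fun z => Ft z + Gt z).
Proof.
move=> [qF cFx cFt] [qG cGx cGt]; split=> z; first exact: qdiffD.
  by apply: cvgD; [exact: cFx|exact: cGx].
by apply: cvgD; [exact: cFt|exact: cGt].
Qed.

Lemma C1M F Fx Ft G Gx Gt : C1 F Fx Ft -> C1 G Gx Gt ->
  C1 (fun z => F z * G z) (fun z => F z * Gx z + G z * Fx z)
     (fun z => F z * Gt z + G z * Ft z).
Proof.
move=> C1F C1G; have cF := C1_continuous _ _ _ C1F; have cG := C1_continuous _ _ _ C1G.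
move: C1F C1G => [qF cFx cFt] [qG cGx cGt]; split=> z; first exact: qdiffM.
  by apply: cvgD; apply: cvgM; [exact: cF|exact: cGx|exact: cG|exact: cFx].
by apply: cvgD; apply: cvgM; [exact: cF|exact: cGt|exact: cG|exact: cFt].
Qed.

Lemma C1Z (k : R) F Fx Ft : C1 F Fx Ft ->
  C1 (fun z => k * F z) (fun z => k * Fx z) (fun z => k * Ft z).
Proof.
move=> C1F; have := C1M _ _ _ _ _ _ (C1_affine k 0 0) C1F.
congr C1; apply/funext => z; rewrite !mulr0 !addr0 ?mulr0 ?addr0//.
Qed.

Lemma C1_pos_sq F Fx Ft : C1 F Fx Ft -> C1 (fun z => pos (F z) ^+ 2)
  (fun z => 2 * pos (F z) * Fx z) (fun z => 2 * pos (F z) * Ft z).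
Proof.
move=> C1F; have cF := C1_continuous _ _ _ C1F; move: C1F => [qF cFx cFt].
have cp : continuous (fun z => 2 * pos (F z)).
  move=> z; apply: cvgMr; apply: (cvg_comp F pos); first exact: cF.
  exact: pos_continuous.
split=> z; first exact: qdiff_pos_sq.
  by apply: cvgM; [exact: cp|exact: cFx].
by apply: cvgM; [exact: cp|exact: cFt].
Qed.

Lemma C1_smooth_step (c a b : R) : let F z := c + z.1 * a + z.2 * b in
  C1 (fun z => smooth_step (F z)) (fun z => hat (F z) * a) (fun z => hat (F z) * b).
Proof.
move=> F.
have H (u : R) := C1_pos_sq _ _ _ (C1_affine (c - u) a b).
have := C1Z 2 _ _ _ (C1D _ _ _ _ _ _ (C1D _ _ _ _ _ _ (H 0) (C1Z (-2) _ _ _ (H 2^-1))) (H 1)).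
have E (u : R) (z : R * R) : c - u + z.1 * a + z.2 * b = F z - u by rewrite /F; ring.
by congr C1; apply/funext => z; rewrite !E subr0 /smooth_step /hat; ring.
Qed.

End C1_calculus.

#[global] Opaque hat smooth_step.

(** * One-sided kernels and right Lebesgue points *)

Section kernels.
Context {R : realType}.
Implicit Types (q G h : R -> R) (a b e l r x y : R).

Lemma sint_quadratic_primitive G h a b (C D : R) : lip1 C h -> 0 <= C ->
  (forall s d, `|G (s + d) - G s - d * h s| <= D * d ^+ 2) ->
  a <= b -> sint h a b = G b - G a.
Proof.
move=> lh C0 HG ab; pose K x := G (a + x) - sint h a (a + x).
have := @sublinear_increments_cst _ K (C + D) _ (b - a); rewrite subr_ge0 => /(_ _ ab).
rewrite /K !addr0 sintxx subr0 [a + _]addrC subrK => <-; first by ring.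
move=> t c _ _; rewrite -(sintD_itv h a (a + t) (a + (t + c)) (lip1_lint _ _ lh)) addrA.
have h1 := HG (a + t) c; have h2 := sint_lip C h (a + t) c lh C0.
move: h1 h2; set A := G _; set B := G _; set S := sint _ _ _.
set H := h _; set T := sint _ _ _.
move: A B S H T => A B S H T; rewrite !ler_norml.
by move=> /andP[? ?] /andP[? ?]; apply/andP; split; lra.
Qed.

(* A C^1 transition from 0 to 1 across [a, a + e], and its derivative. *)
Definition st a e y : R := smooth_step ((y - a) / e).
Definition kr a e y : R := hat ((y - a) / e) / e.

Lemma sint_kr a e x y : 0 < e -> x <= y -> sint (kr a e) x y = st a e y - st a e x.
Proof.
move=> e0 xy; have ei : 0 < e^-1 by rewrite invr_gt0.
apply: (@sint_quadratic_primitive _ _ _ _ (16 * e^-1 ^+ 2) (8 * e^-1 ^+ 2)) => //.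
- move=> s t; rewrite /kr -mulrBl normrM (gtr0_norm ei).
  have := hat_lip ((s - a) / e) ((t - a) / e).
  rewrite (_ : (s - a) / e - (t - a) / e = (s - t) / e); last by ring.
  rewrite normrM (gtr0_norm ei) => h; have := ler_wpM2r (ltW ei) h.
  by move/le_trans; apply; rewrite le_eqVlt; apply/orP; left; apply/eqP; ring.
- by rewrite mulr_ge0// sqr_ge0.
- move=> s d; have := smooth_step_rem ((s - a) / e) (d / e).
  rewrite (_ : (s - a) / e + d / e = (s + d - a) / e); last by ring.
  by rewrite /st /kr exprMn [d / e * _]mulrAC (mulrA d) -[8 * e^-1 ^+ 2 * _]mulrA (mulrC (e^-1 ^+ 2)).
Qed.

Lemma bmf_st a e : bmf (st a e).
Proof.
apply: (@bmf_comp _ _ _ _ _ smooth_step (fun y => (y - a) / e)); first exact: bmf_smooth_step.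
by apply: continuous_measurable_fun => y; apply: cvgMl; apply: cvgB; [exact: cvg_id|exact: cvg_cst].
Qed.

Lemma bmf_kr a e : bmf (kr a e).
Proof.
apply: bmfM; last exact: bmf_cst.
apply: (@bmf_comp _ _ _ _ _ hat (fun y => (y - a) / e)); first exact: bmf_hat.
by apply: continuous_measurable_fun => y; apply: cvgMl; apply: cvgB; [exact: cvg_id|exact: cvg_cst].
Qed.

Lemma st0 a e y : 0 < e -> y <= a -> st a e y = 0.
Proof. by move=> e0 ya; rewrite /st smooth_step0// pmulr_lle0 ?invr_gt0// subr_le0. Qed.

Lemma st1 a e y : 0 < e -> a + e <= y -> st a e y = 1.
Proof. by move=> e0 ya; rewrite /st smooth_step1// ler_pdivlMr// mul1r lerBrDl. Qed.

Lemma st_ge0 a e y : 0 <= st a e y. Proof. exact: smooth_step_ge0. Qed.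
Lemma st_le1 a e y : st a e y <= 1. Proof. exact: smooth_step_le1. Qed.

Lemma st_anti a b e y : 0 < e -> a <= b -> st b e y <= st a e y.
Proof.
by move=> e0 ab; apply: smooth_step_le; rewrite ler_pM2r ?invr_gt0// lerB.
Qed.

Lemma kr_ge0 a e y : 0 < e -> 0 <= kr a e y.
Proof. by move=> e0; rewrite mulr_ge0 ?hat_ge0 ?invr_ge0 ?ltW. Qed.

Lemma kr_le a e y : 0 < e -> kr a e y <= 2 / e.
Proof. by move=> e0; rewrite ler_pM2r ?invr_gt0// hat_le2. Qed.

Lemma kr_out a e y : 0 < e -> y <= a \/ a + e <= y -> kr a e y = 0.
Proof.
move=> e0 H; rewrite /kr hat_out ?mul0r//; case: H => h; [left|right].
  by rewrite pmulr_lle0 ?invr_gt0// subr_le0.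
by rewrite ler_pdivlMr// mul1r lerBrDl.
Qed.

(** The step differs from the indicator of [a, +oo) only on an interval of length [e]. *)
Lemma sint_st_approx q a e l r (M : R) : bmf q -> (forall y, `|q y| <= M) -> 0 < e ->
  l <= a -> a + e <= r -> `|sint (fun y => q y * st a e y) l r - sint q a r| <= M * e.
Proof.
move=> bq qM e0 la ar; have bqs : bmf (fun y => q y * st a e y) := bmfM _ _ bq (bmf_st a e).
have ae : a <= a + e by lra.
rewrite -(sintD_itv _ l a r (bmf_lint _ bqs)) -(sintD_itv _ a (a + e) r (bmf_lint _ bqs)).
rewrite (@eq_sint _ _ (fun=> 0) l a la); last by move=> y /andP[_ ?]; rewrite st0 ?mulr0.
rewrite (@eq_sint _ _ q (a + e) r ar); last by move=> y /andP[? _]; rewrite st1 ?mulr1.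
rewrite -(sintD_itv q a (a + e) r (bmf_lint _ bq)) sint_cst mulr0 add0r.
rewrite opprD addrACA subrr addr0 -sintB; try exact: bmf_lint.
rewrite (le_trans (sint_bound _ _ _ M _ _))//.
- exact/bmf_lint/bmfB.
- move=> y _; rewrite -[X in _ - X]mulr1 -mulrBr normrM -[leRHS]mulr1 ler_pM// distrC.
  rewrite ger0_norm; first by have := st_ge0 a e y; lra.
  by have := st_le1 a e y; lra.
- by rewrite (addrC a) addrK gtr0_norm.
Qed.

Lemma sint_kr_local q a e l r : bmf q -> 0 < e -> l <= a -> a + e <= r ->
  sint (fun y => kr a e y * q y) l r = sint (fun y => kr a e y * q y) a (a + e).
Proof.
move=> bq e0 la ar; have b : bmf (fun y => kr a e y * q y) := bmfM _ _ (bmf_kr a e) bq.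
rewrite -(sintD_itv _ l a r (bmf_lint _ b)) -(sintD_itv _ a (a + e) r (bmf_lint _ b)).
rewrite (@eq_sint _ _ (fun=> 0) l a la); last first.
  by move=> y /andP[_ ?]; rewrite kr_out ?mul0r//; left.
rewrite (@eq_sint _ _ (fun=> 0) (a + e) r ar); last first.
  by move=> y /andP[? _]; rewrite kr_out ?mul0r//; right.
by rewrite !sint_cst !mulr0 add0r addr0.
Qed.

Lemma sint_kr1 a e : 0 < e -> sint (kr a e) a (a + e) = 1.
Proof.
move=> e0; have ae : a <= a + e by rewrite lerDl ltW.
by rewrite (sint_kr a e _ _ e0 ae) (st1 a e _ e0 (lexx _)) (st0 a e _ e0 (lexx _)) subr0.
Qed.

Lemma le_normr_sint q a b : lint q -> a <= b -> `|sint q a b| <= sint (fun y => `|q y|) a b.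
Proof. by move=> lq ab; rewrite !sintE//; exact: le_normr_Rintegral. Qed.

(** The kernel has mass 1 and is at most [2 / e], so its averages converge at right Lebesgue
    points. *)
Lemma sint_kr_dist q a e (c : R) : bmf q -> 0 < e ->
  `|sint (fun y => kr a e y * q y) a (a + e) - c|
  <= 2 / e * sint (fun y => `|q y - c|) a (a + e).
Proof.
move=> bq e0; have ae : a <= a + e by lra.
have bqc : bmf (fun y => q y - c) by apply: bmfB => //; exact: bmf_cst.
have bk := bmf_kr a e.
rewrite [X in `|_ - X|](_ : c = c * sint (kr a e) a (a + e)); last first.
  by rewrite sint_kr1// mulr1.
rewrite -sintZ; last exact: bmf_lint.
rewrite -sintB; try (apply: bmf_lint; apply: bmfM => //; exact: bmf_cst).
have -> : (fun y => kr a e y * q y - c * kr a e y) = (fun y => kr a e y * (q y - c)).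
  by apply/funext => y; ring.
apply: (le_trans (le_normr_sint _ _ _ _ ae)); first exact/bmf_lint/bmfM.
rewrite -sintZ; last exact/bmf_lint/bmf_norm.
apply: le_sint => //.
- exact/bmf_lint/bmf_norm/bmfM.
- by apply/bmf_lint/bmfM; [exact: bmf_cst|exact: bmf_norm].
- move=> y _; rewrite normrM ler_wpM2r// ger0_norm ?kr_ge0//; exact: kr_le.
Qed.

Lemma sint_kr_diff a e (D : R) q q' : 0 < e -> bmf q -> bmf q' ->
  (forall y, `|q y - q' y| <= D) ->
  `|sint (fun y => kr a e y * q y) a (a + e) - sint (fun y => kr a e y * q' y) a (a + e)| <= D.
Proof.
move=> w0 bq bq' qD; have cw : a <= a + e by rewrite lerDl ltW.
have bk := bmf_kr a e.
rewrite -sintB; [|exact/bmf_lint/bmfM..].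
have -> : (fun y => kr a e y * q y - kr a e y * q' y) = (fun y => kr a e y * (q y - q' y)).
  by apply/funext => y; ring.
have bqq := bmfB _ _ bq bq'.
apply: (le_trans (le_normr_sint _ _ _ (bmf_lint _ (bmfM _ _ bk bqq)) cw)).
apply: (@le_trans _ _ (sint (fun y => D * kr a e y) a (a + e))).
  apply: le_sint => //; first exact/bmf_lint/bmf_norm/bmfM.
    by apply/bmf_lint/bmfM => //; exact: bmf_cst.
  by move=> y _; rewrite normrM (ger0_norm (kr_ge0 a e y w0)) mulrC ler_wpM2r ?kr_ge0.
by rewrite sintZ ?sint_kr1 ?mulr1//; exact: bmf_lint.
Qed.

Lemma C1_st_fst a e : C1 (fun z : R * R => st a e z.1) (fun z => kr a e z.1) (fun=> 0).
Proof.
have := C1_smooth_step (- a / e) e^-1 0; congr C1; apply/funext => z; rewrite /st /kr ?mulr0//.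
  by congr smooth_step; ring.
by congr (hat _ / _); ring.
Qed.

Lemma C1_st_snd a e : C1 (fun z : R * R => st a e z.2) (fun=> 0) (fun z => kr a e z.2).
Proof.
have := C1_smooth_step (- a / e) 0 e^-1; congr C1; apply/funext => z; rewrite /st /kr ?mulr0//.
  by congr smooth_step; ring.
by congr (hat _ / _); ring.
Qed.

(* [lpt q x]: x is a right Lebesgue point of q. *)
Definition lpt q x := forall eps, 0 < eps -> exists2 d, 0 < d &
  forall e, 0 < e -> e < d -> sint (fun y => `|q y - q x|) x (x + e) <= eps * e.

Lemma ae_lpt q : bmf q -> {ae (@lebesgue_measure R), forall x, lpt q x}.
Proof.
move=> bq; have lq : locally_integrable setT q.
  split; [exact: bq.1|exact: openT|].
  move=> K _ cK; have mK : measurable K by exact: compact_measurable.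
  by have /integrableP[] := bmf_integrable lebesgue_measure q K mK (compact_finite_measure cK) bq.
apply: ae_imp (lebesgue_differentiation lq) => x xq eps eps0.
(* The ball of radius 2e about x contains [x, x + e] and has length 4e; hence [eps / 4] here and
   [d / 2] as the range of [e]. *)
have /fine_cvgP[_ /cvgrPdist_le/(_ (eps / 4))] := xq.
rewrite divr_gt0// => /(_ isT) [d /= d0 H]; exists (d / 2); first by rewrite divr_gt0.
move=> e e0 ed; have e20 : 0 < 2 * e by rewrite mulr_gt0.
have := H (2 * e); rewrite /= sub0r normrN (gtr0_norm e20) => /(_ _ e20).
have -> : 2 * e < d by lra.
move=> /(_ isT); rewrite sub0r normrN.
have bqx : bmf (fun y => `|q y - q x|) by apply/bmf_norm/bmfB => //; exact: bmf_cst.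
have mB : measurable (ball x (2 * e)) by exact: measurable_ball.
have Boo : (lebesgue_measure (ball x (2 * e)) < +oo)%E.
  by rewrite lebesgue_measure_ball ?ltry// ltW.
have iB := bmf_integrable lebesgue_measure _ _ mB Boo bqx.
have -> : davg q x (2 * e) = ((2 * e *+ 2)^-1 *
    Rintegral lebesgue_measure (ball x (2 * e)) (fun y => `|q y - q x|))%:E.
  rewrite /davg /iavg lebesgue_measure_ball ?(ltW e20)// inver mulrn_eq0/= gt_eqF//.
  rewrite EFinM; congr (_ * _)%E; rewrite /Rintegral fineK//.
  exact: integrable_fin_num.
rewrite /= normrM normfV (gtr0_norm (x := 2 * e *+ 2)) ?mulrn_wgt0//.
rewrite (ger0_norm (x := Rintegral _ _ _)); last exact: Rintegral_ge0.
rewrite ler_pdivrMl ?mulrn_wgt0// => h.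
rewrite sintE; last by lra.
apply: (@le_trans _ _ (Rintegral lebesgue_measure (ball x (2 * e)) (fun y => `|q y - q x|))).
  apply: fine_le.
  - apply: integrable_fin_num => //; exact: (bmf_lint _ bqx).
  - exact: integrable_fin_num.
  - apply: ge0_subset_integral => //.
    + by apply/measurable_EFinP; exact: measurable_funTS bqx.1.
    + move=> y /=; rewrite in_itv/= /ball/= ltr_norml => /andP[? ?].
      by apply/andP; split; lra.
by apply: (le_trans h); rewrite -mulr_natr; lra.
Qed.

End kernels.

#[global] Opaque st kr.

(** * Linear inequalities for the weak formulation *)

Section linear_estimates.
Context {R : realType}.
Implicit Types X Y S T K L : R.

Lemma dist_diff X Y S T K : `|X - (S + T)| <= K -> `|Y - T| <= K -> `|X - Y - S| <= 2 * K.
Proof.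
by rewrite !ler_norml => /andP[? ?] /andP[? ?]; apply/andP; split; lra.
Qed.

Lemma dist_flux X S T K : `|X - T| <= K -> `|S - (S + T - X)| <= K.
Proof. by rewrite (_ : S - (S + T - X) = X - T)//; ring. Qed.

Lemma entropy_le X Y S T : 0 <= - X * S - Y + (X * S - T) -> Y + T <= 0.
Proof. by move=> ?; lra. Qed.

Lemma entropy_ge X Y S T : 0 <= Y - - - X * S + (X * S + T) -> 0 <= Y + T.
Proof. by move=> ?; lra. Qed.

Lemma dist_weak X1 X2 X3 X4 Y0 Y2 Y3 Y4 K L : - Y2 + Y3 - Y4 + Y0 = 0 ->
  `|Y2 - X2| <= K -> `|Y3 - X3| <= L -> `|Y4 - X4| <= L -> `|Y0 - X1| <= K ->
  `|X1 - X2 + X3 - X4| <= 2 * K + 2 * L.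
Proof.
rewrite !ler_norml => ? /andP[? ?] /andP[? ?] /andP[? ?] /andP[? ?].
by apply/andP; split; lra.
Qed.

End linear_estimates.

(** * The conservation law from the entropy inequalities *)

Section weak_form.
Context {R : realType}.
Variables (f v : R -> R) (g : R * R -> R) (M Mf : R).
Hypotheses (cf : continuous f) (sol : bounded_entropy_solution f v g)
  (gM : forall z, `|g z| <= M) (vM : forall x, `|v x| <= M)
  (fM : forall z, `|f (g z)| <= Mf).

Let bg : bmf g. Proof. by case: sol. Qed.
Let bv : bmf v. Proof. by case: sol. Qed.
Let bfg : bmf (fun z => f (g z)). Proof. exact: bmf_cont. Qed.
Let M0 : 0 <= M. Proof. exact: le_trans (normr_ge0 _) (vM 0). Qed.

Definition flux_int y t := sint (fun s => f (g (y, s))) 0 t.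

(** At a level above the range of [g] the Kruzhkov entropy is affine in [g], so the inequality
    becomes linear in [g] and [f(g)]; a level below the range gives the opposite sign. *)
Lemma entropy_integrand_top phix phit z :
  entropy_integrand f g phix phit M z =
  M * phit z + f M * phix z - (g z * phit z + f (g z) * phix z).
Proof.
have := gM z; rewrite ler_norml /entropy_integrand => /andP[_].
(* Where [g] reaches the level, the sign is 0, but the flux difference vanishes too. *)
rewrite le_eqVlt => /predU1P[->|gl]; first by rewrite !subrr normr0; ring.
rewrite ltr0_norm ?subr_lt0// ltr0_sg ?subr_lt0//; ring.
Qed.

Lemma entropy_integrand_bot phix phit z :
  entropy_integrand f g phix phit (- M) z =
  (g z * phit z + f (g z) * phix z) - (- M * phit z + f (- M) * phix z).
Proof.
have := gM z; rewrite ler_norml /entropy_integrand => /andP[+ _].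
rewrite le_eqVlt => /predU1P[<-|gl]; first by rewrite !subrr normr0; ring.
by rewrite gtr0_norm ?subr_gt0// gtr0_sg ?subr_gt0//; ring.
Qed.

Let sint_prod (q h : R -> R) (a b c d : R) : bmf q -> bmf h ->
  sint (fun y => sint (fun s => q y * h s) a b) c d = sint q c d * sint h a b.
Proof.
move=> bq bh; rewrite mulrC -sintZ; last exact: bmf_lint.
congr sint; apply/funext => y; rewrite sintZ; last exact: bmf_lint.
by rewrite mulrC.
Qed.

(* Kruzhkov's inequality with k = M and k = -M gives the conservation law, here tested
   against a smoothed indicator of [a, b] x [0, t]. *)
Lemma weak_kernel a b e d t : a <= b -> 0 < e -> 0 < d -> 0 <= t ->
 `| sint v a b - sint (fun s => kr t d s * sint (fun y => g (y, s)) a b) t (t + d)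
    + sint (fun y => kr a e y * flux_int y t) a (a + e)
    - sint (fun y => kr b e y * flux_int y t) b (b + e) | <= 4 * M * e + 2 * Mf * d.
Proof.
move=> ab e0 d0 t0; set r := `|a| + `|b| + e + t + d + 1.
have [ra rb] : - r <= a /\ b + e <= r.
  have := ler_norm (- a); rewrite normrN; have := ler_norm b.
  by have := normr_ge0 a; have := normr_ge0 b; rewrite /r; lra.
have [rb' ra'] : - r <= b /\ a + e <= r by lra.
have [r1 rtd] : 1 <= r /\ t + d <= r.
  by have := normr_ge0 a; have := normr_ge0 b; rewrite /r; lra.
have r0 : 0 <= r by lra.
have rr : - r <= r by lra.
pose al y := st a e y - st b e y; pose al' y := kr a e y - kr b e y.
(* The cutoff is switched on during [-1, 0], so it equals 1 at time 0 and its derivative for s >= 0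
   is only [- kr t d]. *)
pose be s := st (-1) 1 s - st t d s; pose be' s := kr (-1) 1 s - kr t d s.
have bal : bmf al by apply: bmfB; exact: bmf_st.
have bal' : bmf al' by apply: bmfB; exact: bmf_kr.
have bbe : bmf be by apply: bmfB; exact: bmf_st.
have bbe' : bmf be' by apply: bmfB; exact: bmf_kr.
have al_ge0 y : 0 <= al y by rewrite subr_ge0 st_anti.
have be_ge0 s : 0 <= be s.
  rewrite subr_ge0; have [s0|s0] := leP s 0.
    by rewrite st0 ?st_ge0// (le_trans s0).
  by rewrite (st1 (-1)) ?st_le1 ?addNr// ltW.
have be'E s : 0 <= s -> be' s = - kr t d s.
  by move=> s0; rewrite /be' kr_out ?sub0r//; right; rewrite addNr.
have beE s : 0 <= s -> be s = 1 - st t d s.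
  by move=> s0; rewrite /be st1 ?addNr.
pose phi (z : R * R) := al z.1 * be z.2.
pose phix (z : R * R) := al' z.1 * be z.2.
pose phit (z : R * R) := al z.1 * be' z.2.
have C1phi : C1 phi phix phit.
  have Cal := C1D _ _ _ _ _ _ (C1_st_fst a e) (C1Z (-1) _ _ _ (C1_st_fst b e)).
  have Cbe := C1D _ _ _ _ _ _ (C1_st_snd (-1) 1) (C1Z (-1) _ _ _ (C1_st_snd t d)).
  have := C1M _ _ _ _ _ _ Cal Cbe; rewrite /phi /phix /phit /al /al' /be /be'.
  by congr C1; apply/funext => z; ring.
have out z : ~ in_box r z -> [/\ phi z = 0, phix z = 0 & phit z = 0].
  move=> zr; have [zl|zl] := ltP r `|z.1|.
    have [h1 h2] : al z.1 = 0 /\ al' z.1 = 0.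
      rewrite /al /al'; have [z0|z0] := leP 0 z.1.
        rewrite (ger0_norm z0) in zl.
        have [h1 h2] : a + e <= z.1 /\ b + e <= z.1 by lra.
        by rewrite !st1// !kr_out ?subrr//; right.
      rewrite (ltr0_norm z0) in zl; have [h1 h2] : z.1 <= a /\ z.1 <= b by lra.
      by rewrite !st0// !kr_out ?subrr//; left.
    by rewrite /phi /phix /phit h1 h2 !mul0r.
  have {zr}zl : r < `|z.2| by rewrite ltNge; apply/negP => h; apply: zr.
  have [h1 h2] : be z.2 = 0 /\ be' z.2 = 0.
    rewrite /be /be'; have [z0|z0] := leP 0 z.2.
      rewrite (ger0_norm z0) in zl.
      have [h1 h2] : -1 + 1 <= z.2 /\ t + d <= z.2 by lra.
      by rewrite !st1// !kr_out ?subrr//; right.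
    rewrite (ltr0_norm z0) in zl; have [h1 h2] : z.2 <= -1 /\ z.2 <= t by lra.
    by rewrite !st0// !kr_out ?subrr//; left.
  by rewrite /phi /phix /phit h1 h2 !mulr0.
have phi_ge0 z : 0 <= phi z by rewrite mulr_ge0.
have [_ _ ent] := sol.
have e1 := ent M r phi phix phit C1phi r0 out phi_ge0.
have e2 := ent (- M) r phi phix phit C1phi r0 out phi_ge0.
have bx : bmf phix.
  apply: bmfM; [apply: (@bmf_comp _ _ _ _ _ al' fst)|apply: (@bmf_comp _ _ _ _ _ be snd)] => //.
have bt : bmf phit.
  apply: bmfM; [apply: (@bmf_comp _ _ _ _ _ al fst)|apply: (@bmf_comp _ _ _ _ _ be' snd)] => //.
pose W z := g z * phit z + f (g z) * phix z.
have bW : bmf W by apply: bmfD; exact: bmfM.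
have Ialr : sint al' (- r) r = 0.
  rewrite (sintB (kr a e) (kr b e)); [|exact/bmf_lint/bmf_kr..].
  rewrite (sint_kr a e _ _ e0 rr) (sint_kr b e _ _ e0 rr).
  rewrite (st1 a e r e0 ra') (st1 b e r e0 rb) (st0 a e _ e0 ra) (st0 b e _ e0 rb').
  by rewrite subrr.
have Ibe : sint be' 0 r = -1.
  rewrite (sintB (kr (-1) 1) (kr t d)); [|exact/bmf_lint/bmf_kr..].
  rewrite (sint_kr (-1) 1 _ _ ltr01 r0) (sint_kr t d _ _ d0 r0).
  have h1 : -1 + 1 <= (0 : R) by rewrite addNr.
  rewrite (st1 (-1) 1 0 ltr01 h1) (st1 (-1) 1 r ltr01 (le_trans h1 r0)).
  by rewrite (st1 t d r d0 rtd) (st0 t d 0 d0 t0); ring.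
(* Constants contribute no flux term because [al'] has integral 0, and a single time term because
   [be'] has integral -1 over [0, r]; it cancels against the constant part of the initial term. *)
have cst_part (c1 c2 : R) : sint (fun y => sint (fun s => c1 * phit (y, s) + c2 * phix (y, s)) 0 r) (- r) r
    = - c1 * sint al (- r) r.
  have -> : (fun y => sint (fun s => c1 * phit (y, s) + c2 * phix (y, s)) 0 r) =
    (fun y => c1 * sint (fun s => al y * be' s) 0 r + c2 * sint (fun s => al' y * be s) 0 r).
    apply/funext => y; have p1 := bmf_lint _ (bmf_slice2 _ y bt).
    have p2 := bmf_lint _ (bmf_slice2 _ y bx).
    rewrite (sintD (fun s => c1 * phit (y, s)) (fun s => c2 * phix (y, s))); [|exact: lintZ..].
    by rewrite (sintZ c1 (fun s => phit (y, s)))// (sintZ c2 (fun s => phix (y, s))).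
  have l1 := bmf_sint2 _ 0 r bt; have l2 := bmf_sint2 _ 0 r bx.
  rewrite sintD; try (apply: bmf_lint; apply: bmfM => //; exact: bmf_cst).
  rewrite !sintZ; try exact: bmf_lint.
  by rewrite !sint_prod// Ialr Ibe; ring.
have phi0 x : phi (x, 0) = al x by rewrite /phi /= (beE 0)// (st0 t d 0 d0 t0) subr0 mulr1.
have Wv : sint (fun y => sint (fun s => W (y, s)) 0 r) (- r) r + sint (fun y => v y * al y) (- r) r = 0.
  have lW := bmf_sint2 _ 0 r bW.
  have bva : bmf (fun y => v y * al y) by exact: bmfM.
  have bc (c1 c2 : R) : bmf (fun z => c1 * phit z + c2 * phix z).
    by apply: bmfD; apply: bmfM => //; exact: bmf_cst.
  apply/eqP; rewrite eq_le; apply/andP; split.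
  - move: e1.
    have -> : (fun y => sint (fun s => entropy_integrand f g phix phit M (y, s)) 0 r) =
      (fun y => sint (fun s => M * phit (y, s) + f M * phix (y, s)) 0 r - sint (fun s => W (y, s)) 0 r).
      apply/funext => y; rewrite -sintB.
      + by congr sint; apply/funext => s; rewrite entropy_integrand_top.
      + exact/bmf_lint/(bmf_slice2 _ y (bc M (f M))).
      + exact/bmf_lint/(bmf_slice2 _ y bW).
    rewrite sintB; [|exact/bmf_lint/(bmf_sint2 _ 0 r (bc M (f M)))|exact: bmf_lint].
    rewrite cst_part.
    have -> : (fun x => `|v x - M| * phi (x, 0)) = (fun x => M * al x - v x * al x).
      apply/funext => x; rewrite phi0 ler0_norm; first by ring.
      by rewrite subr_le0; have := vM x; rewrite ler_norml => /andP[].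
    rewrite (sintB (fun x => M * al x) (fun x => v x * al x)); [|exact/lintZ/bmf_lint|exact: bmf_lint].
    by rewrite (sintZ M al); [exact: entropy_le|exact: bmf_lint].
  - move: e2.
    have -> : (fun y => sint (fun s => entropy_integrand f g phix phit (- M) (y, s)) 0 r) =
      (fun y => sint (fun s => W (y, s)) 0 r - sint (fun s => - M * phit (y, s) + f (- M) * phix (y, s)) 0 r).
      apply/funext => y; rewrite -sintB.
      + by congr sint; apply/funext => s; rewrite entropy_integrand_bot.
      + exact/bmf_lint/(bmf_slice2 _ y bW).
      + exact/bmf_lint/(bmf_slice2 _ y (bc (- M) (f (- M)))).
    rewrite sintB; [|exact: bmf_lint|exact/bmf_lint/(bmf_sint2 _ 0 r (bc (- M) (f (- M))))].
    rewrite cst_part.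
    have -> : (fun x => `|v x - - M| * phi (x, 0)) = (fun x => M * al x + v x * al x).
      apply/funext => x; rewrite phi0 ger0_norm; first by ring.
      by rewrite opprK; have := vM x; rewrite ler_norml => /andP[]; lra.
    rewrite (sintD (fun x => M * al x) (fun x => v x * al x)); [|exact/lintZ/bmf_lint|exact: bmf_lint].
    by rewrite (sintZ M al); [exact: entropy_ge|exact: bmf_lint].
have bm := bmf_sint1 _ a b bg.
have bgal : bmf (fun z => g z * al z.1).
  by apply: bmfM => //; apply: (@bmf_comp _ _ _ _ _ al fst).
have bgal1 s : bmf (fun y => g (y, s) * al y) by exact: (bmf_slice1 _ s bgal).
pose ma s := sint (fun y => g (y, s) * al y) (- r) r.
have bma : bmf ma := bmf_sint1 _ (- r) r bgal.
have maE s : `|ma s - sint (fun y => g (y, s)) a b| <= 2 * M * e.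
  have bgs : bmf (fun y => g (y, s)) by exact: bmf_slice1.
  rewrite /ma (_ : (fun y => g (y, s) * al y) = (fun y => g (y, s) * st a e y - g (y, s) * st b e y));
    last by apply/funext => y; rewrite /al; ring.
  rewrite sintB; [|apply: bmf_lint; apply: bmfM => //; exact: bmf_st..].
  have h1 := sint_st_approx _ a e (- r) r M bgs (fun y => gM (y, s)) e0 ra ra'.
  have h2 := sint_st_approx _ b e (- r) r M bgs (fun y => gM (y, s)) e0 rb' rb.
  rewrite -(sintD_itv _ a b r (bmf_lint _ bgs)) in h1.
  by rewrite -[2 * M * e]mulrA; exact: (dist_diff _ _ _ _ _ h1 h2).
have vE : `|sint (fun y => v y * al y) (- r) r - sint v a b| <= 2 * M * e.
  rewrite (_ : (fun y => v y * al y) = (fun y => v y * st a e y - v y * st b e y));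
    last by apply/funext => y; rewrite /al; ring.
  rewrite sintB; [|apply: bmf_lint; apply: bmfM => //; exact: bmf_st..].
  have h1 := sint_st_approx _ a e (- r) r M bv vM e0 ra ra'.
  have h2 := sint_st_approx _ b e (- r) r M bv vM e0 rb' rb.
  rewrite -(sintD_itv _ a b r (bmf_lint _ bv)) in h1.
  by rewrite -[2 * M * e]mulrA; exact: (dist_diff _ _ _ _ _ h1 h2).
pose Jb y := sint (fun s => f (g (y, s)) * be s) 0 r.
have bfbe : bmf (fun z => f (g z) * be z.2).
  by apply: bmfM => //; apply: (@bmf_comp _ _ _ _ _ be snd).
have bJb : bmf Jb := bmf_sint2 _ 0 r bfbe.
have bJ : bmf (fun y => flux_int y t) by exact: (bmf_sint2 _ 0 t bfg).
have JbE y : `|Jb y - flux_int y t| <= Mf * d.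
  have bfy : bmf (fun s => f (g (y, s))) by exact: (bmf_slice2 _ y bfg).
  have h1 := sint_st_approx _ t d 0 r Mf bfy (fun s => fM (y, s)) d0 t0 rtd.
  rewrite /Jb (@eq_sint _ _ (fun s => f (g (y, s)) - f (g (y, s)) * st t d s) _ _ r0); last first.
    by move=> s /andP[s0 _]; rewrite beE//; ring.
  rewrite sintB; [|exact: bmf_lint|apply: bmf_lint; apply: bmfM => //; exact: bmf_st].
  rewrite /flux_int -(sintD_itv _ 0 t r (bmf_lint _ bfy)).
  rewrite distrC; exact: dist_flux h1.
have WE : sint (fun y => sint (fun s => W (y, s)) 0 r) (- r) r =
    - sint (fun s => kr t d s * ma s) t (t + d) + sint (fun y => kr a e y * Jb y) a (a + e)
    - sint (fun y => kr b e y * Jb y) b (b + e).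
  have bgt : bmf (fun z => g z * phit z) by exact: bmfM.
  have bfx : bmf (fun z => f (g z) * phix z) by exact: bmfM.
  have -> : (fun y => sint (fun s => W (y, s)) 0 r) =
    (fun y => sint (fun s => g (y, s) * phit (y, s)) 0 r + al' y * Jb y).
    apply/funext => y; rewrite /W sintD; [|exact/bmf_lint/(bmf_slice2 _ y bgt)|
      exact/bmf_lint/(bmf_slice2 _ y bfx)].
    rewrite /Jb -sintZ; last exact/bmf_lint/(bmf_slice2 _ y bfbe).
    by congr (_ + sint _ _ _); apply/funext => s; rewrite /phix /=; ring.
  rewrite sintD; [|exact/bmf_lint/(bmf_sint2 _ 0 r bgt)|exact/bmf_lint/bmfM].
  rewrite -[RHS]addrA; congr (_ + _).
    transitivity (sint (fun s => sint (fun y => g (y, s) * phit (y, s)) (- r) r) 0 r).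
      by symmetry; exact: (sint_swap _ (- r) r 0 r bgt).
    rewrite -(sint_kr_local _ t d 0 r)//.
    rewrite -sintN; last by apply/bmf_lint/bmfM => //; exact: bmf_kr.
    apply: eq_sint => // s /andP[s0 _]; rewrite /ma -mulNr -be'E// -sintZ; last exact: bmf_lint.
    by congr sint; apply/funext => y; rewrite /phit /=; ring.
  rewrite -(sint_kr_local _ a e (- r) r)// -(sint_kr_local _ b e (- r) r)//.
  rewrite -sintB; [|apply/bmf_lint/bmfM => //; exact: bmf_kr..].
  by congr sint; apply/funext => y; rewrite /al'; ring.
have k1 := sint_kr_diff t d _ _ _ d0 bma bm maE.
have k2 := sint_kr_diff a e _ _ _ e0 bJb bJ JbE.
have k3 := sint_kr_diff b e _ _ _ e0 bJb bJ JbE.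
rewrite WE in Wv; rewrite (_ : 4 * M * e = 2 * (2 * M * e)); last by ring.
rewrite -[2 * Mf * d]mulrA; exact: (dist_weak _ _ _ _ _ _ _ _ _ _ Wv k1 k2 k3 vE).
Qed.

End weak_form.

(** * The potential of an entropy solution *)

Section lipschitz_extension.
Context {R : realType}.
Implicit Types (S : set R) (h : R -> R) (x y : R).

Lemma ae_dense (P : R -> Prop) : {ae (@lebesgue_measure R), forall x, P x} ->
  forall x e, 0 < e -> exists y, [/\ x < y, y < x + e & P y].
Proof.
move=> [A [mA A0 PA]] x e e0; apply: contrapT => H.
have : (lebesgue_measure (`]x, (x + e)%R[ : set R) <= lebesgue_measure A)%E.
  apply: le_measure; rewrite ?inE//.
  move=> y; rewrite /= in_itv/= => /andP[xy ye]; apply: PA => Py; apply: H.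
  by exists y.
rewrite A0 lebesgue_measure_itv/= lte_fin ltrDl e0 -EFinB lee_fin.
by rewrite addrAC subrr add0r leNgt e0.
Qed.

Variables (S : set R) (M : R).
Hypothesis S0 : S !=set0.

Definition lip_ext h x := sup [set h y - M * `|x - y| | y in S].

Let S_lip h := forall x y, S x -> S y -> `|h x - h y| <= M * `|x - y|.

Let M_tri x y z : 0 <= M -> M * `|x - z| <= M * `|x - y| + M * `|y - z|.
Proof. by move=> M0; rewrite -mulrDr ler_wpM2l// ler_distD. Qed.

Lemma lip_ext_ub h x y : 0 <= M -> S_lip h -> S y -> h y - M * `|x - y| <= lip_ext h x.
Proof.
move=> M0 hM Sy; apply: ub_le_sup; last by exists y.
have [y0 Sy0] := S0; exists (h y0 + M * `|x - y0|) => _ [w Sw <-].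
have := hM w y0 Sw Sy0; rewrite ler_norml => /andP[_].
have := M_tri w x y0 M0; rewrite (distrC w x); lra.
Qed.

Lemma lip_ext_le h x (c : R) : (forall y, S y -> h y - M * `|x - y| <= c) -> lip_ext h x <= c.
Proof.
move=> H; apply: ge_sup; first by have [y0 Sy0] := S0; exists (h y0 - M * `|x - y0|), y0.
by move=> _ [y Sy <-]; exact: H.
Qed.

Lemma lip_ext_eq h x : 0 <= M -> S_lip h -> S x -> lip_ext h x = h x.
Proof.
move=> M0 hM Sx; apply/eqP; rewrite eq_le; apply/andP; split.
  apply: lip_ext_le => y Sy; have := hM y x Sy Sx.
  by rewrite ler_norml (distrC y x) => /andP[_]; lra.
by have := lip_ext_ub h x x M0 hM Sx; rewrite subrr normr0 mulr0 subr0.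
Qed.

Lemma lip_ext_lip h : 0 <= M -> S_lip h -> lip1 M (lip_ext h).
Proof.
move=> M0 hM; have H x y : lip_ext h x - lip_ext h y <= M * `|x - y|.
  rewrite lerBlDr; apply: lip_ext_le => w Sw.
  have := lip_ext_ub h y w M0 hM Sw; have := M_tri y x w M0.
  by rewrite (distrC y x); lra.
move=> x y; rewrite ler_norml; apply/andP; split; last exact: H.
by have := H y x; rewrite (distrC y x); lra.
Qed.

(** The extension is nonexpansive in [h]; applied to two times, this makes the potential Lipschitz
    in t. *)
Lemma lip_ext_dist h h' x (c : R) : 0 <= M -> S_lip h -> S_lip h' ->
  (forall y, S y -> `|h y - h' y| <= c) -> `|lip_ext h x - lip_ext h' x| <= c.
Proof.
move=> M0 hM hM' hh; rewrite ler_norml; apply/andP; split.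
  rewrite lerBrDl -lerBrDr opprK; apply: lip_ext_le => y Sy.
  have := lip_ext_ub h x y M0 hM Sy; have := hh y Sy.
  by rewrite ler_norml => /andP[]; lra.
rewrite lerBlDr; apply: lip_ext_le => y Sy.
have := lip_ext_ub h' x y M0 hM' Sy; have := hh y Sy.
by rewrite ler_norml => /andP[]; lra.
Qed.

End lipschitz_extension.

(** * Construction of the potential and its increments *)

Section potential.
Context {R : realType}.
Variables (f v : R -> R) (g : R * R -> R) (M Mf : R).
Hypotheses (cf : continuous f) (sol : bounded_entropy_solution f v g)
  (gM : forall z, `|g z| <= M) (vM : forall x, `|v x| <= M)
  (fM : forall z, `|f (g z)| <= Mf).

Let bg : bmf g. Proof. by case: sol. Qed.
Let bv : bmf v. Proof. by case: sol. Qed.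
Let bfg : bmf (fun z => f (g z)). Proof. exact: bmf_cont. Qed.
Let M0 : 0 <= M. Proof. exact: le_trans (normr_ge0 _) (vM 0). Qed.
Let Mf0 : 0 <= Mf. Proof. exact: le_trans (normr_ge0 _) (fM (0, 0)). Qed.

Notation J := (flux_int f g).

Let bfy y : bmf (fun s => f (g (y, s))). Proof. exact: (bmf_slice2 _ y bfg). Qed.
Let bJ t : bmf (J ^~ t). Proof. exact: (bmf_sint2 _ 0 t bfg). Qed.

Let lipJ y : lip1 Mf (J y).
Proof.
move=> s t; apply: (lipschitz_sint _ _ _ (bmf_lint _ (bfy y))) => x; exact: fM.
Qed.

Definition good x := forall t, lpt (J ^~ t) x.

Let lpt_close x t q eps : lpt (J ^~ q) x -> 0 < eps -> 2 * (Mf * `|t - q|) <= eps / 2 ->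
  exists2 d, 0 < d & forall e, 0 < e -> e < d ->
  sint (fun y => `|J y t - J x t|) x (x + e) <= eps * e.
Proof.
move=> lq eps0 tq; have eps20 : 0 < eps / 2 by rewrite divr_gt0.
have [d d0 H] := lq _ eps20; exists d => // e e0 ed.
have bJx s : bmf (fun y => `|J y s - J x s|) by apply/bmf_norm/bmfB => //; exact: bmf_cst.
apply: (@le_trans _ _ (sint (fun y => `|J y q - J x q| + eps / 2) x (x + e))).
  apply: le_sint; [exact: bmf_lint| |by rewrite lerDl ltW|].
    by apply/bmf_lint/bmfD => //; exact: bmf_cst.
  move=> y _; rewrite (_ : J y t - J x t = (J y q - J x q) +
     ((J y t - J y q) - (J x t - J x q))); last by ring.
  rewrite (le_trans (ler_normD _ _))// lerD2l (le_trans (ler_normB _ _))//.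
  by have := lipJ y t q; have := lipJ x t q; lra.
rewrite sintD; [|exact: bmf_lint|exact: lint_cst].
rewrite sint_cst [x + e - x]addrAC subrr add0r; have := H e e0 ed.
by rewrite mulrC; lra.
Qed.

(** For rational times this is a countable intersection. As the flux integral is [Mf]-Lipschitz in t
    uniformly in x, a rational time close to t, within [eps / (4 * (Mf + 1))], transfers the
    Lebesgue property to t. *)
Lemma ae_good : {ae (@lebesgue_measure R), forall x, good x}.
Proof.
have : {ae (@lebesgue_measure R), forall x n,
    if unpickle n is Some q then lpt (J ^~ (ratr (q : rat))) x else True}.
  apply/ae_foralln => n; case: (unpickle n) => [q|]; last by apply: aeW.
  exact: ae_lpt.
apply: ae_imp => x H t eps eps0.
pose D := eps / (4 * (Mf + 1)).
have D0 : 0 < D by rewrite divr_gt0// mulr_gt0// ltr_wpDl.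
have [q] : exists q : rat, ratr q \in `]t, t + D[.
  by apply: rat_in_itvoo; rewrite ltrDl.
rewrite in_itv/= => /andP[tq qt].
have := H (pickle q); rewrite pickleK => lq.
apply: (lpt_close x t (ratr q)) => //.
rewrite distrC ger0_norm; last by rewrite subr_ge0 ltW.
have : (ratr q - t) * (4 * (Mf + 1)) <= eps.
  by rewrite -ler_pdivlMr ?mulr_gt0 ?ltr_wpDl// -/D; lra.
have q0 : 0 <= ratr q - t by lra.
by move: (ratr q - t) q0 => r r0; have := mulr_ge0 Mf0 r0; lra.
Qed.

Let kernel_limit x t eps : good x -> 0 < eps -> exists2 d, 0 < d &
  forall e, 0 < e -> e < d -> `|sint (fun y => kr x e y * J y t) x (x + e) - J x t| <= eps.
Proof.
move=> gx eps0; have eps20 : 0 < eps / 2 by rewrite divr_gt0.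
have [d d0 H] := gx t _ eps20; exists d => // e e0 ed.
rewrite (le_trans (sint_kr_dist _ _ _ _ (bJ t) e0))//.
have h := H e e0 ed; rewrite mulrAC ler_pdivrMr//; lra.
Qed.

Let m a b s := sint (fun y => g (y, s)) a b.
Let bm a b : bmf (m a b). Proof. exact: bmf_sint1. Qed.
Let m_bound a b s : a <= b -> `|m a b s| <= M * (b - a).
Proof.
move=> ab; rewrite -(ger0_norm (x := b - a)) ?subr_ge0//; apply: sint_bound => //.
exact/bmf_lint/(bmf_slice1 _ s bg).
Qed.

Let limit_estimate (X1 X2 X3 X4 Y3 Y4 e1 e2 : R) :
  `|X1 - X2 + X3 - X4| <= e1 -> `|X3 - Y3| <= e2 -> `|X4 - Y4| <= e2 ->
  `|X1 + Y3 - Y4 - X2| <= e1 + 2 * e2.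
Proof.
by rewrite !ler_norml => /andP[? ?] /andP[? ?] /andP[? ?]; apply/andP; split; lra.
Qed.

(** Both smoothing widths go to 0 together: the flux averages converge at the good points a and b,
    while the time average of the mass is kept, since t need not be a Lebesgue point of it. *)
Lemma weak_limit a b t eps : good a -> good b -> a <= b -> 0 <= t -> 0 < eps ->
  exists2 d, 0 < d & forall e, 0 < e -> e < d ->
  `|sint v a b + J a t - J b t - sint (fun s => kr t e s * m a b s) t (t + e)| <= eps.
Proof.
move=> ga gb ab t0 eps0; have e40 : 0 < eps / 4 by rewrite divr_gt0.
have [d1 d10 H1] := kernel_limit a t _ ga e40.
have [d2 d20 H2] := kernel_limit b t _ gb e40.
pose K := 4 * M + 2 * Mf + 1.
have K0 : 0 < K by rewrite /K; have := M0; have := Mf0; lra.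
exists (Num.min (Num.min d1 d2) (eps / (2 * K))).
  by rewrite !lt_min d10 d20 divr_gt0// mulr_gt0.
move=> e e0; rewrite !lt_min => /andP[/andP[ed1 ed2] edK].
have h := weak_kernel f v g M Mf cf sol gM vM fM a b e e t ab e0 e0 t0.
apply: (le_trans (limit_estimate _ _ _ _ _ _ _ _ h (H1 e e0 ed1) (H2 e e0 ed2))).
move: edK; rewrite ltr_pdivlMr ?mulr_gt0// /K; lra.
Qed.

(** A time average of the mass over [a, b] is at most [M * (b - a)] whatever t is; so this bound
    holds at every t, whereas the equality in [good_eq] requires a Lebesgue time. *)
Lemma good_lip a b t : good a -> good b -> a <= b -> 0 <= t ->
  `|sint v a b + J a t - J b t| <= M * (b - a).
Proof.
move=> ga gb ab t0; apply/ler_addgt0Pr => eps eps0.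
have [d d0 H] := weak_limit a b t eps ga gb ab t0 eps0.
have d20 : 0 < d / 2 by rewrite divr_gt0.
have d2d : d / 2 < d by lra.
have := H _ d20 d2d; set X := sint _ t (t + d / 2) => h.
have hX : `|X| <= M * (b - a).
  have h1 : forall s, `|m a b s - 0| <= M * (b - a) by move=> s; rewrite subr0; exact: m_bound.
  have := sint_kr_diff t (d / 2) (M * (b - a)) (m a b) (fun=> 0) d20 (bm a b) (bmf_cst 0) h1.
  rewrite -/X (_ : (fun y => kr t (d / 2) y * 0) = (fun=> 0)); last first.
    by apply/funext => y; rewrite mulr0.
  by rewrite (sint_cst 0) mulr0 subr0.
rewrite -[X in `|X|](subrK X) (le_trans (ler_normD _ _))// addrC lerD//.
Qed.

Lemma good_eq a b t : good a -> good b -> a <= b -> 0 <= t -> lpt (m a b) t ->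
  sint v a b + J a t - J b t = m a b t.
Proof.
move=> ga gb ab t0 lt; apply/eqP; rewrite -subr_eq0 -normr_le0.
apply/ler_addgt0Pr => eps eps0; rewrite add0r.
have e20 : 0 < eps / 2 by rewrite divr_gt0.
have e40 : 0 < eps / 2 / 2 by rewrite divr_gt0.
have [d d0 H] := weak_limit a b t _ ga gb ab t0 e20.
have [d' d'0 H'] := lt _ e40.
pose e := Num.min d d' / 2.
have mdd : 0 < Num.min d d' by rewrite lt_min d0.
have e0 : 0 < e by rewrite divr_gt0.
have ee : e < Num.min d d' by rewrite /e; lra.
move: (ee); rewrite lt_min => /andP[ed ed'].
have h := H e e0 ed; have h' := sint_kr_dist (m a b) t e (m a b t) (bm a b) e0.
have := H' e e0 ed'; move: h'; set I := sint (fun y => `|m a b y - m a b t|) _ _.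
set X := sint _ t (t + e) in h * => h' h''.
have hI : 2 / e * I <= eps / 2.
  by rewrite mulrAC ler_pdivrMr//; lra.
rewrite (_ : _ - m a b t = (sint v a b + J a t - J b t - X) + (X - m a b t)); last by ring.
by rewrite (le_trans (ler_normD _ _))//; lra.
Qed.

(* On the set [good], of full measure, the primitive U with U_x = g, U_t = - f(g) is
   [M]-Lipschitz in x for every t at once; the McShane extension defines it everywhere. *)
Definition potential z := lip_ext good M (fun y => sint v 0 y - J y (pos z.2)) z.1.

Let good0 : good !=set0.
Proof. by have [y [_ _ gy]] := ae_dense _ ae_good 0 1 ltr01; exists y. Qed.

Let Ut_lip t x y : 0 <= t -> good x -> good y ->
  `|(sint v 0 x - J x t) - (sint v 0 y - J y t)| <= M * `|x - y|.
Proof.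
move=> t0 gx gy; wlog yx : x y gx gy / y <= x => [H|].
  by case: (leP y x) => [|/ltW] h; [exact: H|rewrite distrC (distrC x); exact: H].
rewrite (ger0_norm (x := x - y)) ?subr_ge0//; have := good_lip y x t gy gx yx t0.
rewrite -(sintD_itv v 0 y x (bmf_lint _ bv)); congr (`|_| <= _); ring.
Qed.

(** The positive part in the definition freezes the potential at its initial values for t < 0, so
    the bound holds on the whole plane and box averages are defined everywhere. *)
Lemma potential_lip : lip2 (M + Mf) potential.
Proof.
move=> [x t] [y s] /=; rewrite /potential /=.
have Hp r : 0 <= pos r := pos_ge0 r.
set h1 := fun y => sint v 0 y - J y (pos t); set h2 := fun y => sint v 0 y - J y (pos s).
have l1 a b : good a -> good b -> `|h1 a - h1 b| <= M * `|a - b| by exact: Ut_lip.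
have l2 a b : good a -> good b -> `|h2 a - h2 b| <= M * `|a - b| by exact: Ut_lip.
have d12 : `|lip_ext good M h1 y - lip_ext good M h2 y| <= Mf * `|t - s|.
  apply: lip_ext_dist => // w _; rewrite /h1 /h2 (_ : _ - _ = - (J w (pos t) - J w (pos s))); last by ring.
  rewrite normrN (le_trans (lipJ w _ _))// ler_wpM2l//.
  exact: pos_lip.
have dxy := lip_ext_lip good M good0 h1 M0 l1 x y.
apply: (le_trans (ler_distD (lip_ext good M h1 y) _ _)); apply: (le_trans (lerD dxy d12)).
by rewrite mulrDl !mulrDr lerD// ?lerDl ?lerDr mulr_ge0.
Qed.

Lemma potential_good x t : good x -> 0 <= t -> potential (x, t) = sint v 0 x - J x t.
Proof.
move=> gx t0; rewrite /potential /= lip_ext_eq//.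
  by rewrite /pos (max_idPl t0).
by move=> a b ga gb; apply: Ut_lip => //; exact: pos_ge0.
Qed.

Let Mpos : 0 <= M + Mf. Proof. exact: addr_ge0. Qed.

(** At good points the flux integral over an empty time interval vanishes; these points accumulate
    at every x, and both sides are Lipschitz. *)
Lemma potential0 x : potential (x, 0) = sint v 0 x.
Proof.
apply/eqP; rewrite -subr_eq0 -normr_le0; apply/ler_addgt0Pr => eps eps0; rewrite add0r.
have K0 : 0 < 2 * M + Mf + 1 by have := M0; have := Mf0; lra.
have d0 : 0 < eps / (2 * M + Mf + 1) by rewrite divr_gt0.
have [y [xy ye gy]] := ae_dense _ ae_good x _ d0.
have h1 := potential_lip (x, 0) (y, 0); rewrite /= subrr normr0 addr0 in h1.
have h2 := lipschitz_sint v 0 M (bmf_lint _ bv) vM y x.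
rewrite (potential_good y 0 gy (lexx _)) /flux_int sintxx subr0 in h1.
have E : `|y - x| = y - x by rewrite ger0_norm// subr_ge0 ltW.
rewrite (distrC x y) E in h1; rewrite E in h2.
rewrite -[X in `|X|](subrK (sint v 0 y)) (_ : _ - _ - _ + _ =
 (potential (x, 0) - sint v 0 y) + (sint v 0 y - sint v 0 x)); last by ring.
rewrite (le_trans (ler_normD _ _))//; have := lerD h1 h2; rewrite -mulrDl => /le_trans; apply.
have : (y - x) * (2 * M + Mf + 1) <= eps by rewrite -ler_pdivlMr//; lra.
have : 0 <= y - x by lra.
by nra.
Qed.

Lemma potential_t a b t k : a <= b -> 0 <= t -> 0 <= k ->
  sint (fun y => potential (y, t + k) - potential (y, t)) a b =
  - sint (fun y => sint (fun s => f (g (y, s))) t (t + k)) a b.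
Proof.
move=> ab t0 k0; have tk0 : 0 <= t + k by exact: addr_ge0.
have bF := bmf_sint2 _ t (t + k) bfg.
rewrite -sintN; last exact: bmf_lint.
apply: eq_sint_ae => //.
- have cU s : continuous (fun y => potential (y, s)).
    exact: lip1_continuous (lip2_slice1 _ _ s potential_lip).
  by apply: measurable_funB; exact: continuous_measurable_fun.
- exact: (bmfN _ bF).1.
- apply: ae_imp ae_good => y gy _; rewrite !potential_good//.
  rewrite /flux_int -(sintD_itv _ 0 t (t + k) (bmf_lint _ (bfy y))); ring.
Qed.

Let potential_x_good a b t k : good a -> good b -> a <= b -> 0 <= t -> 0 <= k ->
  sint (fun s => potential (b, s) - potential (a, s)) t (t + k) =
  sint (fun s => sint (fun y => g (y, s)) a b) t (t + k).
Proof.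
move=> ga gb ab t0 k0; have tk : t <= t + k by rewrite lerDl.
apply: eq_sint_ae => //.
- have cU y : continuous (fun s => potential (y, s)).
    exact: lip1_continuous (lip2_slice2 _ _ y potential_lip).
  by apply: measurable_funB; exact: continuous_measurable_fun.
- exact: (bm a b).1.
- apply: ae_imp (ae_lpt _ (bm a b)) => s ls /andP[ts _].
  have s0 : 0 <= s by exact: le_trans ts.
  rewrite !potential_good// -/(m a b s) -(good_eq a b s ga gb ab s0 ls).
  by rewrite -(sintD_itv v 0 a b (bmf_lint _ bv)); ring.
Qed.

Let x_estimate (X1 X2 Y1 Y2 K e : R) : X2 = Y2 -> `|X1 - X2| <= K * e -> `|Y1 - Y2| <= K * e ->
  `|X1 - Y1| <= 2 * K * e.
Proof.
move=> -> ; rewrite !ler_norml => /andP[? ?] /andP[? ?]; apply/andP; split; lra.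
Qed.

(** For good endpoints the identity holds at almost every time, by [good_eq]. General endpoints are
    approached from the right by good ones, and both sides depend on them in a Lipschitz way. *)
Lemma potential_x a b t k : a < b -> 0 <= t -> 0 <= k ->
  sint (fun s => potential (b, s) - potential (a, s)) t (t + k) =
  sint (fun s => sint (fun y => g (y, s)) a b) t (t + k).
Proof.
move=> ab t0 k0; apply/eqP; rewrite -subr_eq0 -normr_le0.
apply/ler_addgt0Pr => eps eps0; rewrite add0r.
pose K := 2 * (M + Mf) * k + 1; have K0 : 0 < K.
  by rewrite ltr_wpDl// !mulr_ge0//; have := Mpos; lra.
(* The bound by [b - a] keeps the good point a' to the left of b'; the other bound absorbs two
   errors of size [K * D]. *)
pose D := Num.min (b - a) (eps / (2 * K)).
have D0 : 0 < D by rewrite lt_min subr_gt0 ab divr_gt0// mulr_gt0.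
have [a' [aa a'D ga]] := ae_dense _ ae_good a _ D0.
have [b' [bb b'D gb]] := ae_dense _ ae_good b _ D0.
have [Dab DK] : D <= b - a /\ D <= eps / (2 * K) by rewrite /D !ge_min !lexx orbT.
have ab' : a' <= b' by lra.
have E := potential_x_good a' b' t k ga gb ab' t0 k0.
have lU y : lint (fun s => potential (y, s)).
  exact: lip1_lint (lip2_slice2 _ _ y potential_lip).
have tk : `|t + k - t| = k by rewrite addrAC subrr add0r ger0_norm.
have dx y y' s : y < y' -> y' < y + D -> `|potential (y, s) - potential (y', s)| <= (M + Mf) * D.
  move=> yy yD; rewrite (le_trans (lip2_slice1 _ _ s potential_lip y y'))// ler_wpM2l//.
  by rewrite distrC ger0_norm; lra.
have dg y y' s : y < y' -> y' < y + D -> `|sint (fun x => g (x, s)) y y'| <= (M + Mf) * D.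
  move=> yy yD; apply: (@le_trans _ _ (M * `|y' - y|)).
    by apply: sint_bound => //; exact/bmf_lint/(bmf_slice1 _ s bg).
  rewrite ger0_norm; last by rewrite subr_ge0 ltW.
  by apply: ler_pM => //; [rewrite subr_ge0 ltW|rewrite lerDl|rewrite lerBlDl ltW].
have h1 : `|sint (fun s => potential (b, s) - potential (a, s)) t (t + k) -
    sint (fun s => potential (b', s) - potential (a', s)) t (t + k)| <= K * D.
  rewrite -sintB; [|exact: lintB..].
  apply: (le_trans (sint_bound _ _ _ (2 * (M + Mf) * D) _ _)).
  - by apply: lintB; exact: lintB.
  - move=> s _; rewrite (_ : _ - _ = (potential (b, s) - potential (b', s)) -
      (potential (a, s) - potential (a', s))); last by ring.
    rewrite (le_trans (ler_normB _ _))//.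
    by have := dx b b' s bb b'D; have := dx a a' s aa a'D; lra.
  - by rewrite tk /K [leRHS](_ : _ = 2 * (M + Mf) * D * k + D); [rewrite lerDl ltW|ring].
have h2 : `|sint (m a b) t (t + k) - sint (m a' b') t (t + k)| <= K * D.
  rewrite -sintB; [|exact: bmf_lint..].
  apply: (le_trans (sint_bound _ _ _ (2 * (M + Mf) * D) _ _)).
  - by apply: lintB; exact: bmf_lint.
  - move=> s _; have lg := bmf_lint _ (bmf_slice1 _ s bg).
    have e1 := sintD_itv _ a a' b' lg; have e2 := sintD_itv _ a b b' lg.
    rewrite (_ : m a b s - m a' b' s = sint (fun x => g (x, s)) a a' -
       sint (fun x => g (x, s)) b b'); last by rewrite /m; lra.
    rewrite (le_trans (ler_normB _ _))//.
    by have := dg b b' s bb b'D; have := dg a a' s aa a'D; lra.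
  - by rewrite tk /K [leRHS](_ : _ = 2 * (M + Mf) * D * k + D); [rewrite lerDl ltW|ring].
apply: (le_trans (x_estimate _ _ _ _ _ _ E h1 h2)).
by rewrite mulrC -ler_pdivlMr// mulr_gt0.
Qed.

End potential.

(** * Convergence of averages in L^1 *)

Section average_convergence.
Context {R : realType}.
Notation mu := (@lebesgue_measure R).
Implicit Types (g : R * R -> R) (q : R -> R).

Definition tends0 (u : nat -> R) := forall eps, 0 < eps -> exists N, forall n, (N <= n)%N ->
  `|u n| <= eps.

Lemma tends0_inv (d : R) : 0 < d -> exists N, forall n, (N <= n)%N -> n.+1%:R^-1 < d.
Proof.
move=> d0; exists (Num.truncn d^-1) => n Nn.
rewrite -[ltRHS]invrK ltf_pV2 ?posrE ?invr_gt0//.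
by apply: (lt_le_trans (truncnS_gt _)); rewrite ler_nat.
Qed.

Lemma sint_dominated (q : nat -> R -> R) (M a b : R) : a <= b ->
  (forall n, measurable_fun setT (q n)) ->
  (forall n x, a <= x <= b -> `|q n x| <= M) ->
  {ae mu, forall x, a <= x <= b -> tends0 (fun n => q n x)} ->
  tends0 (fun n => sint (q n) a b).
Proof.
move=> ab mq qM q0.
have mqE n : measurable_fun `[a, b] (EFin \o q n).
  by apply/measurable_EFinP; exact: measurable_funTS.
have m0 : measurable_fun (`[a, b] : set R) (fun _ : R => 0%E : \bar R) by exact: measurable_cst.
have c0 : {ae mu, forall x, `[a, b]%classic x -> (EFin \o q n) x @[n --> \oo] --> (0%E : \bar R)}.
  apply: ae_imp q0 => x H; rewrite /= in_itv/= => /H {}H.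
  apply: cvg_EFin; first by apply: nearW.
  apply/cvgrPdist_le => e /H[N HN]; exists N => // n Nn.
  by rewrite /= sub0r normrN; exact: HN.
have iM : mu.-integrable `[a, b] (EFin \o (fun _ : R => M)).
  exact: (lint_cst M).
have dom : {ae mu, forall x n, `[a, b]%classic x -> (`|(EFin \o q n) x| <= (EFin \o (fun _ : R => M)) x)%E}.
  by apply: aeW => x n; rewrite /= in_itv/= lee_fin; exact: qM.
have [_ _ L] := @dominated_convergence _ _ R mu `[a, b]%classic (measurable_itv `[a, b])
  (fun n => EFin \o q n) (fun=> 0%E) (EFin \o (fun=> M)) mqE m0 c0 iM dom.
rewrite integral0 in L; move/fine_cvgP : L => [_ /cvgrPdist_le H] eps /H[N _ HN].
exists N => n Nn; have := HN n Nn.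
by rewrite /= sub0r normrN sintE.
Qed.

Lemma sint_indic q a b c d : a <= c -> c <= d -> d <= b ->
  sint (fun y => q y * (if (c <= y) && (y <= d) then 1 else 0)) a b = sint q c d.
Proof.
move=> ac cd db; rewrite !sintE//; last by rewrite (le_trans ac)// (le_trans cd).
rewrite [LHS]Rintegral_indic [RHS]Rintegral_indic; congr Rintegral; apply/funext => y.
rewrite !indicE !mem_setE /= !in_itv/=.
case: (leP c y) => cy; case: (leP y d) => yd; rewrite /= ?mulr0 ?mul0r ?mulr1//.
by rewrite (le_trans ac cy) (le_trans yd db).
Qed.

Section one_variable.
Variables (x1 x2 t1 t2 : R).
Hypotheses (x12 : x1 <= x2) (t12 : t1 <= t2).

(** The moving average in x, written as an integral over a fixed interval with a cutoff so that its
    measurability in (x, t) is an instance of measurability of parameter integrals. The margin 1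
    accommodates widths up to 1. *)
Definition window g (h : R) (z : R * R) := h^-1 *
  sint (fun y => g (y, z.2) * (if (z.1 <= y) && (y <= z.1 + h) then 1 else 0)) x1 (x2 + 1).

Lemma windowE g h x t : x1 <= x <= x2 -> 0 < h <= 1 ->
  window g h (x, t) = h^-1 * sint (fun y => g (y, t)) x (x + h).
Proof.
move=> /andP[? ?] /andP[? ?]; rewrite /window /= (sint_indic (fun y => g (y, t)))//; lra.
Qed.

Lemma bmf_window g h : bmf g -> bmf (window g h).
Proof.
move=> bg; apply: bmfM; first exact: bmf_cst.
apply: (@bmf_sint _ _ _ (fun w : R * (R * R) =>
  g (w.1, w.2.2) * (if (w.2.1 <= w.1) && (w.1 <= w.2.1 + h) then 1 else 0))).
have m1 : measurable_fun setT (fun w : R * (R * R) => w.1).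
  exact: measurable_fst.
have m21 : measurable_fun setT (fun w : R * (R * R) => w.2.1).
  exact: (measurableT_comp measurable_fst measurable_snd).
have m22 : measurable_fun setT (fun w : R * (R * R) => w.2.2).
  exact: (measurableT_comp measurable_snd measurable_snd).
apply: bmfM.
  apply: (@bmf_comp _ _ _ _ _ g (fun w : R * (R * R) => (w.1, w.2.2))) => //.
  exact: measurable_fun_pair.
split.
  apply: measurable_fun_ifT; [|exact: measurable_cst|exact: measurable_cst].
  apply: measurable_and; apply: measurable_fun_ler => //.
  by apply: measurable_funD => //; exact: measurable_cst.
by exists 1 => w; case: ifP => _; rewrite ?normr1 ?normr0.
Qed.

Lemma lpt_avg q x : bmf q -> lpt q x ->
  tends0 (fun n => n.+1%:R^-1^-1 * sint q x (x + n.+1%:R^-1) - q x).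
Proof.
move=> bq lq eps eps0; have [d d0 H] := lq eps eps0.
have [N HN] := tends0_inv d d0; exists N => n Nn.
set h := n.+1%:R^-1; have h0 : 0 < h by rewrite invr_gt0.
have := H h h0 (HN n Nn) => h1.
rewrite -[X in _ - X](mulKf (x := h)) ?gt_eqF// -mulrBr normrM normfV (gtr0_norm h0).
rewrite ler_pdivrMl// (mulrC h eps); apply: le_trans h1.
have E : h * q x = sint (fun=> q x) x (x + h) by rewrite sint_cst [x + h - x]addrAC subrr add0r.
rewrite E -sintB; [|exact: bmf_lint|exact: lint_cst].
apply: le_normr_sint; last by rewrite lerDl ltW.
by apply: lintB; [exact: bmf_lint|exact: lint_cst].
Qed.

(** For each t almost every x is a Lebesgue point of the slice; dominated convergence is applied in
    x and then in t. *)
Lemma window_L1 g : bmf g -> tends0 (fun n => sint (fun t => sint (fun x =>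
  `|window g n.+1%:R^-1 (x, t) - g (x, t)|) x1 x2) t1 t2).
Proof.
move=> bg; have [_ [M gM]] := bg.
have M0 : 0 <= M := le_trans (normr_ge0 _) (gM (0, 0)).
have bD n : bmf (fun z => `|window g n.+1%:R^-1 z - g z|).
  by apply/bmf_norm/bmfB => //; exact: bmf_window.
have h01 n : 0 < (n.+1%:R^-1 : R) <= 1.
  by rewrite invr_gt0 ltr0n /= invf_le1 ?ltr0n// ler1n.
have bound n x t : x1 <= x <= x2 -> `|window g n.+1%:R^-1 (x, t) - g (x, t)| <= 2 * M.
  move=> xx; rewrite windowE//; have /andP[h0 _] := h01 n.
  set h := n.+1%:R^-1 in h0 *.
  have : `|h^-1 * sint (fun y => g (y, t)) x (x + h)| <= M.
    rewrite normrM normfV (gtr0_norm h0) ler_pdivrMl//.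
    apply: (le_trans (sint_bound _ _ _ M _ _)) => //.
      exact/bmf_lint/(bmf_slice1 _ t bg).
    by rewrite addrAC subrr add0r (gtr0_norm h0) mulrC.
  by have := ler_normB (h^-1 * sint (fun y => g (y, t)) x (x + h)) (g (x, t)); have := gM (x, t); lra.
apply: (sint_dominated _ (2 * M * (x2 - x1))) => //.
- by move=> n; exact: (bmf_sint1 _ x1 x2 (bD n)).1.
- move=> n t _; apply: (@le_trans _ _ (sint (fun=> 2 * M) x1 x2)).
    have l1 := bmf_lint _ (bmf_slice1 _ t (bD n)).
    rewrite ger0_norm; last by rewrite sintE//; exact: Rintegral_ge0.
    by apply: le_sint => //; [exact: lint_cst|move=> x; exact: bound].
  by rewrite sint_cst mulrC.
- apply: aeW => t _.
  apply: (sint_dominated _ (2 * M)) => //.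
  + by move=> n; exact: (bmf_slice1 _ t (bD n)).1.
  + by move=> n x xx; rewrite normr_id; exact: bound.
  + apply: ae_imp (ae_lpt _ (bmf_slice1 _ t bg)) => x lx xx eps eps0.
    have [N HN] := lpt_avg _ x (bmf_slice1 _ t bg) lx eps eps0.
    exists N => n Nn; rewrite normr_id windowE//; exact: HN.
Qed.

End one_variable.

Definition avg (h k : R) g (z : R * R) :=
  (h * k)^-1 * sint (fun s => sint (fun y => g (y, s)) z.1 (z.1 + h)) z.2 (z.2 + k).

Let avg_split g x1 x2 t1 t2 n m h k G : x1 <= x2 -> t1 <= t2 -> bmf g ->
  h = n.+1%:R^-1 -> k = m.+1%:R^-1 -> G = window x1 x2 g h ->
  sint (fun x => sint (fun t => `|avg h k g (x, t) - g (x, t)|) t1 t2) x1 x2 <=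
  sint (fun x => sint (fun t =>
    `|window t1 t2 (fun z => G (z.2, z.1)) k (t, x) - G (x, t)|) t1 t2) x1 x2 +
  sint (fun t => sint (fun x => `|G (x, t) - g (x, t)|) x1 x2) t1 t2.
Proof.
move=> x12 t12 bg hE kE GE.
have h01 i : 0 < (i.+1%:R^-1 : R) <= 1.
  by rewrite invr_gt0 ltr0n /= invf_le1 ?ltr0n// ler1n.
have bG : bmf G by rewrite GE; exact: bmf_window.
have bG' : bmf (fun z => G (z.2, z.1)) by exact: (bmf_swap _ bG).
have bW : bmf (fun z => window t1 t2 (fun z => G (z.2, z.1)) k (z.2, z.1)).
  exact: (bmf_swap _ (bmf_window _ _ _ _ bG')).
have b1 : bmf (fun z => `|window t1 t2 (fun z => G (z.2, z.1)) k (z.2, z.1) - G z|).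
  exact/bmf_norm/bmfB.
have b2 : bmf (fun z => `|G z - g z|) by exact/bmf_norm/bmfB.
have avgE x t : x1 <= x <= x2 -> t1 <= t <= t2 ->
    avg h k g (x, t) = window t1 t2 (fun z => G (z.2, z.1)) k (t, x).
  move=> xx tt; rewrite windowE ?kE// -kE /avg /= invfM mulrAC mulrC; congr (_ * _).
  rewrite -sintZ; last exact/bmf_lint/bmf_sint1.
  by congr sint; apply/funext => s; rewrite GE windowE// hE.
rewrite (sint_swap (fun z => `|G z - g z|)) => //.
have s1 := bmf_lint _ (bmf_sint2 _ t1 t2 b1); have s2 := bmf_lint _ (bmf_sint2 _ t1 t2 b2).
rewrite -sintD//.
rewrite (@eq_sint _ _ (fun x => sint (fun t => `|window t1 t2 (fun z => G (z.2, z.1)) k (t, x) - g (x, t)|) t1 t2) x1 x2 x12); last first.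
  by move=> x xx; apply: eq_sint => // t tt; rewrite avgE.
have b3 : bmf (fun z => `|window t1 t2 (fun z => G (z.2, z.1)) k (z.2, z.1) - g z|).
  exact/bmf_norm/bmfB.
apply: le_sint => //; [exact: bmf_lint _ (bmf_sint2 _ t1 t2 b3)|exact: lintD|].
move=> x xx.
have l1 := bmf_lint _ (bmf_slice2 _ x b1); have l2 := bmf_lint _ (bmf_slice2 _ x b2).
rewrite -sintD//; apply: le_sint => //; [exact: bmf_lint _ (bmf_slice2 _ x b3)|exact: lintD|].
by move=> t tt; rewrite ler_distD.
Qed.

(** The width in x is fixed before the width in t, as the function averaged in t depends on it. Two
    functions share one box, because the x- and t-derivatives of a single box average must
    approximate [g] and [- f(g)] together. *)
Lemma avg_L1 g1 g2 x1 x2 t1 t2 (eps d : R) : x1 <= x2 -> t1 <= t2 -> bmf g1 -> bmf g2 ->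
  0 < eps -> 0 < d -> exists h k, [/\ 0 < h < d, 0 < k < d,
  sint (fun x => sint (fun t => `|avg h k g1 (x, t) - g1 (x, t)|) t1 t2) x1 x2 <= eps &
  sint (fun x => sint (fun t => `|avg h k g2 (x, t) - g2 (x, t)|) t1 t2) x1 x2 <= eps].
Proof.
move=> x12 t12 bg1 bg2 eps0 d0; have e20 : 0 < eps / 2 by rewrite divr_gt0.
have [N1 H1] := window_L1 x1 x2 t1 t2 x12 t12 g1 bg1 _ e20.
have [N2 H2] := window_L1 x1 x2 t1 t2 x12 t12 g2 bg2 _ e20.
have [N3 H3] := tends0_inv d d0.
pose n := maxn N1 (maxn N2 N3).
pose G1 := window x1 x2 g1 n.+1%:R^-1; pose G2 := window x1 x2 g2 n.+1%:R^-1.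
have bG1 : bmf (fun z => G1 (z.2, z.1)) by apply: bmf_swap; exact: bmf_window.
have bG2 : bmf (fun z => G2 (z.2, z.1)) by apply: bmf_swap; exact: bmf_window.
have [m1 K1] := window_L1 t1 t2 x1 x2 t12 x12 _ bG1 _ e20.
have [m2 K2] := window_L1 t1 t2 x1 x2 t12 x12 _ bG2 _ e20.
pose m := maxn m1 (maxn m2 N3).
have pos_inv i : 0 < (i.+1%:R^-1 : R) by rewrite invr_gt0.
exists n.+1%:R^-1, m.+1%:R^-1; split.
- by rewrite pos_inv H3// /n !leq_max leqnn !orbT.
- by rewrite pos_inv H3// /m !leq_max leqnn !orbT.
- apply: (le_trans (avg_split g1 x1 x2 t1 t2 n m _ _ _ x12 t12 bg1 erefl erefl erefl)).
  have h1 := H1 n _; have k1 := K1 m _.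
  have {}h1 := le_trans (ler_norm _) (h1 (leq_maxl _ _)).
  have {}k1 := le_trans (ler_norm _) (k1 (leq_maxl _ _)).
  by rewrite (splitr eps); exact: lerD k1 h1.
- apply: (le_trans (avg_split g2 x1 x2 t1 t2 n m _ _ _ x12 t12 bg2 erefl erefl erefl)).
  have h1 := H2 n _; have k1 := K2 m _.
  have {}h1 : _ <= eps / 2 := le_trans (ler_norm _) (h1 _).
  have {}k1 : _ <= eps / 2 := le_trans (ler_norm _) (k1 _).
  rewrite (splitr eps); apply: lerD.
    by apply: k1; rewrite /m !leq_max leqnn !orbT.
  by apply: h1; rewrite /n !leq_max leqnn !orbT.
Qed.

End average_convergence.

(** * The viscosity inequality and comparison *)

Section double_integral.
Context {R : realType}.
Implicit Types (F G : R * R -> R) (a b c d : R).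

Definition sint2 F a b c d := sint (fun y => sint (fun s => F (y, s)) c d) a b.

Lemma le_sint2 F G a b c d : bmf F -> bmf G -> a <= b -> c <= d ->
  (forall y s, a <= y <= b -> c <= s <= d -> F (y, s) <= G (y, s)) ->
  sint2 F a b c d <= sint2 G a b c d.
Proof.
move=> bF bG ab cd FG; apply: le_sint => //.
- exact: bmf_lint _ (bmf_sint2 _ c d bF).
- exact: bmf_lint _ (bmf_sint2 _ c d bG).
move=> y yab; apply: le_sint => //.
- exact: bmf_lint _ (bmf_slice2 _ y bF).
- exact: bmf_lint _ (bmf_slice2 _ y bG).
by move=> s scd; exact: FG.
Qed.

Lemma eq_sint2 F G a b c d : a <= b -> c <= d ->
  (forall y s, a <= y <= b -> c <= s <= d -> F (y, s) = G (y, s)) ->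
  sint2 F a b c d = sint2 G a b c d.
Proof.
move=> ab cd FG; apply: eq_sint => // y yab; apply: eq_sint => // s scd; exact: FG.
Qed.

Lemma sint2D F G a b c d : bmf F -> bmf G ->
  sint2 (fun z => F z + G z) a b c d = sint2 F a b c d + sint2 G a b c d.
Proof.
move=> bF bG; rewrite /sint2 -sintD.
- congr sint; apply/funext => y; rewrite sintD//.
    exact: bmf_lint _ (bmf_slice2 _ y bF).
  exact: bmf_lint _ (bmf_slice2 _ y bG).
- exact: bmf_lint _ (bmf_sint2 _ c d bF).
- exact: bmf_lint _ (bmf_sint2 _ c d bG).
Qed.

Lemma sint2Z (k : R) F a b c d : bmf F ->
  sint2 (fun z => k * F z) a b c d = k * sint2 F a b c d.
Proof.
move=> bF; rewrite /sint2 -sintZ; last exact: bmf_lint _ (bmf_sint2 _ c d bF).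
congr sint; apply/funext => y; rewrite sintZ//.
exact: bmf_lint _ (bmf_slice2 _ y bF).
Qed.

Lemma sint_ge_sub (q : R -> R) a b c d : lint q -> a <= c -> c <= d -> d <= b ->
  (forall x, 0 <= q x) -> sint q c d <= sint q a b.
Proof.
move=> lq ac cd db q0; rewrite -(sintD_itv q a c b lq) -(sintD_itv q c d b lq).
have h x y : x <= y -> 0 <= sint q x y.
  by move=> xy; rewrite sintE//; apply: Rintegral_ge0.
by rewrite addrCA lerDl addr_ge0// h.
Qed.

Lemma sint2_ge F a b c d (a' b' c' d' e : R) : bmf F -> (forall z, 0 <= F z) ->
  a <= a' -> a' <= b' -> b' <= b -> c <= c' -> c' <= d' -> d' <= d ->
  (forall y s, a' <= y <= b' -> c' <= s <= d' -> e <= F (y, s)) ->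
  e * (d' - c') * (b' - a') <= sint2 F a b c d.
Proof.
move=> bF F0 aa ab bb cc cd dd Fe.
have lF y : lint (fun s => F (y, s)) := bmf_lint _ (bmf_slice2 _ y bF).
have lS := bmf_lint _ (bmf_sint2 _ c d bF).
have cd' : c <= d by rewrite (le_trans cc)// (le_trans cd).
apply: (@le_trans _ _ (sint (fun y => sint (fun s => F (y, s)) c d) a' b')); last first.
  by apply: sint_ge_sub => // y; rewrite sintE//; apply: Rintegral_ge0.
rewrite [leLHS]mulrC -sint_cst; apply: le_sint => //; first exact: lint_cst.
move=> y yab; apply: (@le_trans _ _ (sint (fun s => F (y, s)) c' d')); last first.
  exact: sint_ge_sub.
rewrite [leLHS]mulrC -sint_cst; apply: le_sint => //; first exact: lint_cst.
by move=> s scd; exact: Fe.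
Qed.

End double_integral.

(** * Potentials are viscosity supersolutions *)

Section viscosity.
Context {R : realType}.

Lemma nbhs_box (z0 : R * R) (P : R * R -> Prop) : (\forall z \near z0, P z) ->
  exists2 r, 0 < r & forall z, `|z.1 - z0.1| <= r -> `|z.2 - z0.2| <= r -> P z.
Proof.
move=> /nbhs_ballP[r /= r0 H]; exists (r / 2); first by rewrite divr_gt0.
move=> z z1 z2; apply: H; split; rewrite /ball/= distrC; lra.
Qed.

Lemma sg_norm (x : R) : Num.sg x * x = `|x|.
Proof.
case: (ltgtP x 0) => [x0|x0|->]; last by rewrite normr0 mulr0.
  by rewrite ltr0_sg// ltr0_norm// mulN1r.
by rewrite gtr0_sg// gtr0_norm// mul1r.
Qed.

(** With q = phi_t, p = phi_x, F = -V_t and A = V_x, replacing F by f(u) and A by u leaves the terms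
    |u - k| (f(u) - f(k)) and sg(u - k) (f(u) - f(k)) (u - k), which cancel. What remains is q +
    f(k), strictly negative, the small slope p - k, and the averaging errors. *)
Lemma test_inequality (u k p q A F fu fk w eta eta' s K B : R) :
  0 <= w -> 0 <= K -> q + fk <= - eta' -> `|p - k| <= s -> eta + K * s <= eta' ->
  `|fu - fk| <= K * `|u - k| -> `|u - k| <= 2 * B ->
  `|u - k| * (2 * w * (q + F)) + Num.sg (u - k) * (fu - fk) * (2 * w * (p - A)) <=
  2 * w * (- eta * `|u - k| + 2 * B * (`|F - fu| + K * `|A - u|)).
Proof.
move=> w0 K0 qk ps es fK uB.
have -> : `|u - k| * (2 * w * (q + F)) + Num.sg (u - k) * (fu - fk) * (2 * w * (p - A)) =
  2 * w * (`|u - k| * (q + fk) + Num.sg (u - k) * (fu - fk) * (p - k) +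
    (`|u - k| * (fu - fk) - Num.sg (u - k) * (u - k) * (fu - fk)) +
    `|u - k| * (F - fu) - Num.sg (u - k) * (fu - fk) * (A - u)) by ring.
rewrite sg_norm subrr addr0; apply: ler_wpM2l; first by rewrite mulr_ge0.
have sg1 : `|Num.sg (u - k)| <= 1 by rewrite normr_sg; case: (_ == _).
have D0 := normr_ge0 (u - k); have s0 : 0 <= s := le_trans (normr_ge0 _) ps.
have sf : `|Num.sg (u - k) * (fu - fk)| <= K * `|u - k|.
  by rewrite normrM -[leRHS]mul1r ler_pM.
have t1 : `|u - k| * (q + fk) <= `|u - k| * (- eta') by rewrite ler_wpM2l.
have t2 : Num.sg (u - k) * (fu - fk) * (p - k) <= K * `|u - k| * s.
  by apply: (le_trans (ler_norm _)); rewrite normrM ler_pM.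
have t3 : `|u - k| * (F - fu) <= 2 * B * `|F - fu|.
  by apply: (le_trans (ler_norm _)); rewrite normrM normr_id ler_wpM2r.
have t4 : - (Num.sg (u - k) * (fu - fk) * (A - u)) <= 2 * B * K * `|A - u|.
  apply: (le_trans (ler_norm _)); rewrite normrN normrM ler_wpM2r//.
  by apply: (le_trans sf); rewrite mulrC ler_wpM2r.
have t5 : `|u - k| * (eta + K * s) <= `|u - k| * eta' by rewrite ler_wpM2l.
move: t1 t2 t3 t4 t5; clear.
move: (`|u - k|) (Num.sg _ * _ * (p - k)) (Num.sg _ * _ * (A - u)) (`|F - fu|) (`|A - u|).
by move=> D X Y P Q *; lra.
Qed.

Lemma test_sum (u a s e1 e2 w eta B K d : R) : 0 <= w -> w <= 2 * d -> 0 <= eta -> 0 <= s -> 0 <= e1 -> 0 <= e2 ->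
  0 <= B -> 0 <= K -> 0 <= d ->
  2 * w * (- eta * `|u - a| + 2 * B * (e1 + K * e2)) +
  2 * w * (- eta * `|u - (a + s)| + 2 * B * (e1 + K * e2)) <=
  - (2 * eta * s) * w + 16 * d * B * (1 + K) * (e1 + e2).
Proof.
move=> w0 wd eta0 s0 e10 e20 B0 K0 d0.
have t1 : s <= `|u - a| + `|u - (a + s)|.
  have := ler_norm (u - a); have := ler_norm (- (u - (a + s))); rewrite normrN; lra.
have t2 : eta * s * w <= eta * (`|u - a| + `|u - (a + s)|) * w.
  by rewrite ler_wpM2r// ler_wpM2l.
(* Two error terms with factor [2 * w * (2 * B)] each, and [w <= 2 * d]: this is the 16 of the
   conclusion. *)
have t3 : w * (B * (e1 + K * e2)) <= 2 * d * (B * ((1 + K) * (e1 + e2))).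
  apply: ler_pM => //; first by rewrite mulr_ge0// addr_ge0// mulr_ge0.
  rewrite ler_wpM2l//; have := mulr_ge0 K0 e10; lra.
move: (`|u - a|) (`|u - (a + s)|) t2 => P Q t2; lra.
Qed.

Lemma sq_sum_lt (p q rho : R) : 0 <= rho -> 0 < rho ^+ 2 - (p ^+ 2 + q ^+ 2) ->
  `|p| <= rho /\ `|q| <= rho.
Proof.
move=> rho0 h; have [q1 q2] := (sqr_ge0 p, sqr_ge0 q).
by split; rewrite -(@ler_pXn2r _ 2)// ?nnegrE ?real_normK ?num_real//; lra.
Qed.

Lemma small_step (C x d : R) : 0 <= x -> x * (8 * (C + 1)) = d -> C * (2 * x) <= d / 4.
Proof. by move=> x0 <-; lra. Qed.

Lemma touching_bound (U0 p0 U p V d q : R) : 0 <= d -> U0 - p0 + q <= U - p -> `|V - U| <= d / 4 ->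
  U0 - p0 + d + p - V <= 2 * d - q.
Proof. by move=> d0 h; rewrite ler_norml => /andP[? ?]; lra. Qed.

Lemma touching_low (m D d p U V : R) : D = U - p -> `|m - D| <= d / 4 -> `|V - U| <= d / 4 ->
  d / 2 <= m + d + p - V.
Proof. by move=> ->; rewrite !ler_norml => /andP[? ?] /andP[? ?]; lra. Qed.

Lemma test_slope (q0 q fa fc X Y eta : R) : q0 + fa = - (2 * eta) -> `|q0 - q| <= eta / 4 ->
  X <= Y -> Y <= eta / 4 -> `|fc - fa| <= X -> q + fc <= - (3 / 2 * eta).
Proof. by rewrite !ler_norml => ? /andP[? ?] ? ? /andP[? ?]; lra. Qed.

Lemma slope_margin (K s eta : R) : K * s <= eta / 4 -> eta + K * (2 * s) <= 3 / 2 * eta.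
Proof. by move=> ?; lra. Qed.

Lemma corner_bounds (x t r rho : R) : 0 < t -> 0 < r -> r <= rho -> rho <= t / 2 ->
  [/\ - (`|x| + t + rho) <= x - r, x + r <= `|x| + t + rho, 0 <= t - r &
      t + r <= `|x| + t + rho].
Proof.
have := ler_norm x; have := ler_norm (- x); rewrite normrN; have := normr_ge0 x.
by move=> *; split; lra.
Qed.

(** With X = e s d r^2, the negative term has size at least 4 X while the two errors add up to at
    most 2 X. *)
Lemma test_contradiction (e s d r L I1 I2 W : R) : 0 <= L -> 0 < e * s * d * r ^+ 2 ->
  I1 <= e * s * d * r ^+ 2 / (L + 1) -> I2 <= e * s * d * r ^+ 2 / (L + 1) ->
  0 < e * s -> d / 2 * (2 * r) * (2 * r) <= W -> 0 <= - (2 * e * s) * W + L * (I1 + I2) -> False.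
Proof.
move=> L0; set X := e * s * d * r ^+ 2 => X0; have L1 : 0 < L + 1 by lra.
rewrite !ler_pdivlMr// => h1 h2 es0 hW; rewrite leNgt => /negP; apply.
have t1 : e * s * (d / 2 * (2 * r) * (2 * r)) <= e * s * W by rewrite ler_wpM2l// ltW.
have t2 : e * s * (d / 2 * (2 * r) * (2 * r)) = 2 * X by rewrite /X; field.
have t3 : L * (I1 + I2) <= 2 * X.
  have [I0|I0] := leP 0 (I1 + I2).
    have : (I1 + I2) * (L + 1) <= 2 * X by lra.
    by rewrite mulrDr mulr1 mulrC; lra.
  by apply: (@le_trans _ _ 0); [rewrite mulr_ge0_le0// ltW|rewrite mulr_ge0// ltW].
rewrite t2 in t1; rewrite (_ : - (2 * e * s) * W = - 2 * (e * s * W)); last by ring.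
move: t1 t3 X0; move: (e * s * W) (L * (I1 + I2)) (X); clear => A Y Z *; lra.
Qed.

Definition locally_lipschitz (f : R -> R) := forall B, exists2 K, 0 <= K &
  forall p q, `|p| <= B -> `|q| <= B -> `|f p - f q| <= K * `|p - q|.

Variables (f v : R -> R) (g : R * R -> R) (M Mf : R).
Hypotheses (cf : continuous f) (sol : bounded_entropy_solution f v g)
  (gM : forall z, `|g z| <= M) (vM : forall x, `|v x| <= M)
  (fM : forall z, `|f (g z)| <= Mf) (lf : locally_lipschitz f).

Let bg : bmf g. Proof. by case: sol. Qed.
Let bfg : bmf (fun z => f (g z)). Proof. exact: bmf_cont. Qed.
Let M0 : 0 <= M. Proof. exact: le_trans (normr_ge0 _) (vM 0). Qed.
Let Mf0 : 0 <= Mf. Proof. exact: le_trans (normr_ge0 _) (fM (0, 0)). Qed.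

Notation U := (potential f v g M).
Let C := M + Mf.
Let C0 : 0 <= C. Proof. exact: addr_ge0. Qed.
Let lU : lip2 C U. Proof. exact: potential_lip. Qed.

Lemma potential_avg_x h k y s : 0 < h -> 0 < k -> 0 <= s ->
  box_avg_x U h k (y, s) = avg h k g (y, s).
Proof.
move=> h0 k0 s0; rewrite /box_avg_x /avg /box_int_x /=; congr (_ * _).
by rewrite (potential_x f v g M Mf)// ?ltrDl// ltW.
Qed.

Lemma potential_avg_t h k y s : 0 < h -> 0 < k -> 0 <= s ->
  box_avg_t U h k (y, s) = - avg h k (fun z => f (g z)) (y, s).
Proof.
move=> h0 k0 s0; rewrite /box_avg_t /avg /box_int_t /= -mulrN; congr (_ * _).
have yh : y <= y + h by rewrite lerDl ltW.
rewrite (potential_t f v g M Mf cf sol gM vM fM y (y + h) s k yh s0 (ltW k0)).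
by rewrite (sint_swap (fun z => f (g z)) y (y + h) s (s + k) bfg).
Qed.

(* Let V be a box average of U. If phi_t + f(phi_x) < 0 at z0, test the entropy inequality
   with ((phi - V + m + d)_+)^2, supported near z0, for two close values k = a, a + s:
   each integrand is at most - 2 eta w |g - k| up to a small error, and |g - a| + |g - a - s| >= s
   is a contradiction. *)
Theorem viscosity_inequality phi phix phit z0 : C1 phi phix phit -> 0 < z0.2 ->
  (forall z, U z0 - phi z0 + ((z.1 - z0.1) ^+ 2 + (z.2 - z0.2) ^+ 2) <= U z - phi z) ->
  0 <= phit z0 + f (phix z0).
Proof.
move=> C1phi t00 Hmin; rewrite leNgt; apply/negP => neg.
set a := phix z0 in neg *; set eta := - (phit z0 + f a) / 2.
have eta0 : 0 < eta by rewrite divr_gt0// oppr_gt0.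
(* A common bound for [g], [a] and [a + s], since s <= 1. *)
pose B := M + `|a| + 1; have [K K0 fK] := lf B.
have B0 : 0 <= B by rewrite !addr_ge0.
have K10 : 0 < K + 1 by rewrite ltr_wpDl.
(* Moving the level from [a] to [a + s] then changes its flux by at most [eta / 4]. *)
pose s := Num.min 1 (eta / (4 * (K + 1))).
have s0 : 0 < s by rewrite lt_min ltr01 divr_gt0// mulr_gt0.
have [s1 sK] : s <= 1 /\ K * s <= eta / 4.
  split; first by rewrite ge_min lexx.
  have : s <= eta / (4 * (K + 1)) by rewrite ge_min lexx orbT.
  by rewrite ler_pdivlMr ?mulr_gt0//; lra.
have [_ cx ct] := C1phi.
have cphi := C1_continuous _ _ _ C1phi; have cU := lip2_continuous _ _ lU.
have [rho0 rho00 Hnear] : exists2 r, 0 < r & forall z, `|z.1 - z0.1| <= r -> `|z.2 - z0.2| <= r ->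
    `|a - phix z| <= s /\ `|phit z0 - phit z| <= eta / 4.
  have e40 : 0 < eta / 4 by rewrite divr_gt0.
  apply: nbhs_box; apply: filterI.
    exact: (@cvgr_dist_le _ _ _ _ _ _ _ (cx z0) _ s0).
  exact: (@cvgr_dist_le _ _ _ _ _ _ _ (ct z0) _ e40).
pose rho := Num.min rho0 (z0.2 / 2).
have rho_gt0 : 0 < rho by rewrite lt_min rho00 divr_gt0.
have [rho_le rho_t] : rho <= rho0 /\ rho <= z0.2 / 2 by split; rewrite ge_min lexx ?orbT.
(* Since [H z] will be at most [2 * d] minus the squared distance to [z0], the equality
   [2 * d = rho ^+ 2] confines its positive part to distance [rho]. *)
pose d := rho ^+ 2 / 2; have d0 : 0 < d by rewrite divr_gt0// exprn_gt0.
pose m := U z0 - phi z0.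
have [r1' r1'0 Hlow] : exists2 r, 0 < r & forall z, `|z.1 - z0.1| <= r -> `|z.2 - z0.2| <= r ->
    `|m - (U z - phi z)| <= d / 4.
  have d40 : 0 < d / 4 by rewrite divr_gt0.
  apply: nbhs_box.
  exact: (@cvgr_dist_le _ _ _ _ _ _ _ (cvgB (cU z0) (cphi z0)) _ d40).
pose r1 := Num.min r1' rho.
have r10 : 0 < r1 by rewrite lt_min r1'0.
have [r1_le r1_rho] : r1 <= r1' /\ r1 <= rho by split; rewrite ge_min lexx ?orbT.
pose r := `|z0.1| + z0.2 + rho.
pose L := 16 * d * B * (1 + K).
have L0 : 0 <= L by rewrite /L !mulr_ge0// ?addr_ge0// ltW.
(* The L^1 error allowed for the averages: small against the negative term collected on the box of
   radius [r1], where [H] is at least [d / 2]. *)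
pose eps := eta * s * d * r1 ^+ 2 / (L + 1).
have L10 : 0 < L + 1 by rewrite ltr_wpDl.
have eps0 : 0 < eps by apply: divr_gt0 => //; do 3 (apply: mulr_gt0 => //); exact: exprn_gt0.
pose dh := d / (8 * (C + 1)).
have C10 : 0 < C + 1 by rewrite ltr_wpDl.
have dh0 : 0 < dh by rewrite divr_gt0// mulr_gt0.
have r0 : 0 <= r by rewrite /r !addr_ge0// ltW.
have rr : - r <= r by rewrite (le_trans _ r0)// oppr_le0.
have [h [k [/andP[h0 hd] /andP[k0 kd] I1 I2]]] :=
  avg_L1 g (fun z => f (g z)) (- r) r 0 r eps dh rr r0 bg bfg eps0 dh0.
have VU z : `|box_avg U h k z - U z| <= d / 4.
  apply: (le_trans (box_avg_approx U C h k C0 h0 k0 lU z)).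
  apply: (@le_trans _ _ (C * (2 * dh))); first by rewrite ler_wpM2l// mulr2n mulrDl mul1r lerD// ltW.
  by apply: small_step; [exact: ltW|rewrite /dh divfK// gt_eqF// mulr_gt0].
(* The constant [m + d] is written as an affine function so that the C^1 rules apply. *)
pose H z := (m + d) + z.1 * 0 + z.2 * 0 + (phi z + (-1) * box_avg U h k z).
have C1H : C1 H (fun z => 0 + (phix z + (-1) * box_avg_x U h k z))
    (fun z => 0 + (phit z + (-1) * box_avg_t U h k z)).
  exact: C1D (C1_affine _ _ _) (C1D _ _ _ _ _ _ C1phi (C1Z _ _ _ _ (box_avg_C1 U C h k C0 h0 k0 lU))).
have HE z : H z = m + d + phi z - box_avg U h k z by rewrite /H; ring.
have Hup z : H z <= 2 * d - ((z.1 - z0.1) ^+ 2 + (z.2 - z0.2) ^+ 2).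
  by rewrite HE; exact: touching_bound (ltW d0) (Hmin z) (VU z).
have Hpos z : 0 < pos (H z) -> `|z.1 - z0.1| <= rho /\ `|z.2 - z0.2| <= rho.
  rewrite /pos lt_max ltxx orbF => Hz.
  have := lt_le_trans Hz (Hup z); rewrite /d mulrC divfK// => h2.
  exact: sq_sum_lt (ltW rho_gt0) h2.
have H2d z : pos (H z) <= 2 * d.
  rewrite /pos ge_max; apply/andP; split; last by rewrite mulr_ge0// ltW.
  apply: (le_trans (Hup z)); rewrite gerBl addr_ge0 ?sqr_ge0//.
have Hout z : ~ in_box r z -> pos (H z) = 0.
  move=> zr; apply/eqP; rewrite eq_le pos_ge0 andbT leNgt; apply/negP => /Hpos[h1 h2].
  apply: zr; split.
    apply: (@le_trans _ _ (`|z0.1| + rho)); last by rewrite /r lerD2r lerDl ltW.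
    by rewrite -lerBlDl (le_trans (lerB_dist _ _)).
  apply: (@le_trans _ _ (`|z0.2| + rho)).
    by rewrite -lerBlDl (le_trans (lerB_dist _ _)).
  by rewrite (gtr0_norm t00) /r -addrA lerDr.
have C1chi := C1_pos_sq _ _ _ C1H.
have chi0 z : ~ in_box r z -> [/\ pos (H z) ^+ 2 = 0,
    2 * pos (H z) * (0 + (phix z + (-1) * box_avg_x U h k z)) = 0 &
    2 * pos (H z) * (0 + (phit z + (-1) * box_avg_t U h k z)) = 0].
  by move=> /Hout ->; rewrite !(mulr0, mul0r, expr0n).
have chi_ge0 z : 0 <= pos (H z) ^+ 2 by rewrite sqr_ge0.
have [_ _ ent] := sol.
have E1 := ent a r _ _ _ C1chi r0 chi0 chi_ge0.
have E2 := ent (a + s) r _ _ _ C1chi r0 chi0 chi_ge0.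
(* As [rho] is at most half the time of [z0], the support stays away from t = 0 and the initial term
   drops out. *)
have chi_init x : pos (H (x, 0)) = 0.
  apply/eqP; rewrite eq_le pos_ge0 andbT leNgt; apply/negP => /Hpos[_].
  rewrite /= sub0r normrN (gtr0_norm t00) leNgt => /negP; apply.
  by apply: (le_lt_trans rho_t); rewrite ltr_pdivrMr// ltr_pMr// ltr1n.
have init0 c : sint (fun x => `|v x - c| * pos (H (x, 0)) ^+ 2) (- r) r = 0.
  have -> : (fun x => `|v x - c| * pos (H (x, 0)) ^+ 2) = (fun=> 0).
    by apply/funext => x; rewrite chi_init expr0n /= mulr0.
  by rewrite sint_cst mulr0.
rewrite init0 addr0 in E1; rewrite init0 addr0 in E2.
set chix := fun z => 2 * pos (H z) * (0 + (phix z + (-1) * box_avg_x U h k z)) in E1 E2 C1chi chi0.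
set chit := fun z => 2 * pos (H z) * (0 + (phit z + (-1) * box_avg_t U h k z)) in E1 E2 C1chi chi0.
have [_ cchix cchit] := C1chi.
have bchix : bmf chix by apply: (cont_box_bmf r) => // z /chi0[].
have bchit : bmf chit by apply: (cont_box_bmf r) => // z /chi0[].
have bE c := bmf_entropy_integrand f g chix chit c cf bg bchix bchit.
have bw : bmf (fun z => pos (H z)).
  apply: (cont_box_bmf r) => // z; apply: (cvg_comp H pos); last exact: pos_continuous.
  exact: C1_continuous C1H z.
have [_ cVx cVt] := box_avg_C1 U C h k C0 h0 k0 lU.
pose Ft z := - box_avg_t U h k z.
pose e1 z := `|Ft z - f (g z)|; pose e2 z := `|box_avg_x U h k z - g z|.
have be1 : bmf e1.
  apply/bmf_norm/bmfB => //; apply: bmfN; split; first exact: continuous_measurable2.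
  by exists C; exact: (box_avg_t_bound U C h k h0 k0 lU).
have be2 : bmf e2.
  apply/bmf_norm/bmfB => //; split; first exact: continuous_measurable2.
  by exists C; exact: (box_avg_x_bound U C h k h0 k0 lU).
have aB : `|a| <= B by rewrite /B addrAC lerDr addr_ge0.
have gB z : `|g z| <= B.
  by apply: (le_trans (gM z)); rewrite /B -addrA lerDl addr_ge0.
have pointwise c z : `|c - a| <= s -> `|c| <= B -> entropy_integrand f g chix chit c z <=
    2 * pos (H z) * (- eta * `|g z - c| + 2 * B * (e1 z + K * e2 z)).
  move=> ca cB; rewrite /entropy_integrand /chix /chit.
  have [w0|w0] := eqVneq (pos (H z)) 0; first by rewrite w0 !(mulr0, mul0r) addr0.
  have [z1 z2] : `|z.1 - z0.1| <= rho /\ `|z.2 - z0.2| <= rho.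
    by apply: Hpos; rewrite lt_def w0 pos_ge0.
  have [nx nt] := Hnear z (le_trans z1 rho_le) (le_trans z2 rho_le).
  have -> : 0 + (phit z + (-1) * box_avg_t U h k z) = phit z + Ft z by rewrite /Ft; ring.
  have -> : 0 + (phix z + (-1) * box_avg_x U h k z) = phix z - box_avg_x U h k z by ring.
  (* Near [z0], phi_t + f(c) is at most -2 eta + eta/4 + eta/4 = -(3/2) eta, and the slope phi_x is
     within 2 s of c: s from continuity and s from the choice of c. *)
  apply: (@test_inequality _ _ _ _ _ _ _ _ _ eta (3 / 2 * eta) (2 * s)) => //.
  - exact: pos_ge0.
  - have e0 : phit z0 + f a = - (2 * eta) by rewrite /eta; field.
    exact: test_slope e0 nt (ler_wpM2l K0 ca) sK (fK c a cB aB).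
  - have -> : phix z - c = - (a - phix z) - (c - a) by ring.
    by apply: (le_trans (ler_normB _ _)); rewrite normrN mulr2n mulrDl mul1r; exact: lerD.
  - exact: slope_margin.
  - exact: fK.
  - by apply: (le_trans (ler_normB _ _)); rewrite mulr2n mulrDl mul1r; exact: lerD.
have asB : `|a + s| <= B.
  by apply: (le_trans (ler_normD _ _)); rewrite (gtr0_norm s0) /B lerD// lerDr.
have as_a : `|a + s - a| <= s by rewrite addrAC subrr add0r gtr0_norm.
have aa : `|a - a| <= s by rewrite subrr normr0 ltW.
have sum_le z : entropy_integrand f g chix chit a z + entropy_integrand f g chix chit (a + s) z <=
    - (2 * eta * s) * pos (H z) + L * (e1 z + e2 z).
  apply: (le_trans (lerD (pointwise a z aa aB) (pointwise (a + s) z as_a asB))).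
  by apply: test_sum => //; first [exact: pos_ge0|exact: ltW|exact: normr_ge0].
have be12 : bmf (fun z => e1 z + e2 z) by exact: bmfD.
have bsum : bmf (fun z => - (2 * eta * s) * pos (H z) + L * (e1 z + e2 z)).
  by apply: bmfD; apply: bmfM => //; exact: bmf_cst.
have total : 0 <= - (2 * eta * s) * sint2 (fun z => pos (H z)) (- r) r 0 r +
    L * (sint2 e1 (- r) r 0 r + sint2 e2 (- r) r 0 r).
  rewrite -sint2D// -!sint2Z// -sint2D; try (by apply: bmfM => //; exact: bmf_cst).
  apply: (le_trans (addr_ge0 E1 E2)).
  rewrite -/(sint2 (entropy_integrand f g chix chit a) (- r) r 0 r).
  rewrite -/(sint2 (entropy_integrand f g chix chit (a + s)) (- r) r 0 r).
  rewrite -sint2D; [|exact: bE..].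
  by apply: le_sint2 => //; apply: bmfD; exact: bE.
have I1' : sint2 e1 (- r) r 0 r <= eps.
  rewrite (eq_sint2 _ (fun z => `|avg h k (fun z => f (g z)) z - f (g z)|) _ _ _ _ rr r0).
    exact: I2.
  move=> y t _ /andP[t0 _].
  by rewrite /e1 /Ft (potential_avg_t h k y t h0 k0 t0) opprK.
have I2' : sint2 e2 (- r) r 0 r <= eps.
  rewrite (eq_sint2 _ (fun z => `|avg h k g z - g z|) _ _ _ _ rr r0); first exact: I1.
  move=> y t _ /andP[t0 _].
  by rewrite /e2 (potential_avg_x h k y t h0 k0 t0).
have W_low : d / 2 * (2 * r1) * (2 * r1) <= sint2 (fun z => pos (H z)) (- r) r 0 r.
  have e y : y + r1 - (y - r1) = 2 * r1 by ring.
  have [b1 b2 b3 b4] := corner_bounds z0.1 z0.2 r1 rho t00 r10 r1_rho rho_t.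
  rewrite -{1}(e z0.2) -(e z0.1); apply: sint2_ge => //.
  - by move=> z; exact: pos_ge0.
  - by rewrite lerD2l (le_trans _ (ltW r10))// oppr_le0 ltW.
  - by rewrite lerD2l (le_trans _ (ltW r10))// oppr_le0 ltW.
  - move=> y t /andP[y1 y2] /andP[t1 t2].
    have n1 : `|y - z0.1| <= r1 by rewrite ler_distl y1 y2.
    have n2 : `|t - z0.2| <= r1 by rewrite ler_distl t1 t2.
    have hl := Hlow (y, t) (le_trans n1 r1_le) (le_trans n2 r1_le).
    rewrite /pos le_max HE; apply/orP; left.
    exact: touching_low erefl hl (VU (y, t)).
apply: (test_contradiction eta s d r1 L _ _ _ L0 _ I1' I2' _ W_low total).
- by do 3 (apply: mulr_gt0 => //); exact: exprn_gt0.
- exact: mulr_gt0.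
Qed.

End viscosity.

(** * Comparison of C^1 subsolutions with a potential *)

Section comparison.
Context {R : realType}.

Lemma C1_sqrt : C1 (fun w : R * R => Num.sqrt (1 + w.1 ^+ 2))
  (fun z => z.1 / Num.sqrt (1 + z.1 ^+ 2)) (fun=> 0).
Proof.
have s0 (z : R * R) : Num.sqrt (1 + z.1 ^+ 2) != 0.
  by rewrite gt_eqF// sqrtr_gt0 ltr_wpDr// sqr_ge0.
split; first exact: qdiff_sqrt; last by move=> z; exact: cvg_cst.
move=> z; apply: cvgM; first exact: cvg_fst.
have [dF _ _] := qdiff_differentiable _ _ _ _ (qdiff_sqrt z).
by apply: cvgV => //; exact: (differentiable_continuous dF).
Qed.

Lemma sqrt1_ge (x : R) : `|x| <= Num.sqrt (1 + x ^+ 2).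
Proof. by rewrite -sqrtr_sqr ler_wsqrtr// lerDr. Qed.

Lemma sqrt1_slope (x : R) : `|x / Num.sqrt (1 + x ^+ 2)| <= 1.
Proof.
have s0 : 0 < Num.sqrt (1 + x ^+ 2) by rewrite sqrtr_gt0 ltr_wpDr// sqr_ge0.
by rewrite normrM normfV (gtr0_norm s0) ler_pdivrMr// mul1r sqrt1_ge.
Qed.

Lemma sqrt1_lip (x y : R) : Num.sqrt (1 + x ^+ 2) - Num.sqrt (1 + y ^+ 2) <= `|x - y|.
Proof.
have sx : 0 < Num.sqrt (1 + x ^+ 2) by rewrite sqrtr_gt0 ltr_wpDr// sqr_ge0.
have sy : 0 < Num.sqrt (1 + y ^+ 2) by rewrite sqrtr_gt0 ltr_wpDr// sqr_ge0.
have ex : Num.sqrt (1 + x ^+ 2) ^+ 2 = 1 + x ^+ 2 by rewrite sqr_sqrtr// addr_ge0// sqr_ge0.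
have ey : Num.sqrt (1 + y ^+ 2) ^+ 2 = 1 + y ^+ 2 by rewrite sqr_sqrtr// addr_ge0// sqr_ge0.
have hx := sqrt1_ge x; have hy := sqrt1_ge y.
move: (Num.sqrt (1 + x ^+ 2)) (Num.sqrt (1 + y ^+ 2)) sx sy ex ey hx hy => a b a0 b0 ea eb ha hb.
have e : (a - b) * (a + b) = (x - y) * (x + y) by rewrite -!subr_sqr ea eb; ring.
rewrite -(@ler_pM2r _ (a + b)) ?addr_gt0// e.
apply: (le_trans (ler_norm _)); rewrite normrM ler_wpM2l//.
by apply: (le_trans (ler_normD _ _)); exact: lerD.
Qed.

Lemma growth_bound (b t : R) : 0 <= b -> 0 <= t -> t ^+ 2 <= b * (1 + t) -> t <= b + 1.
Proof.
move=> b0 t0 h; rewrite leNgt; apply/negP => tb.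
have : (b + 1) * t <= t ^+ 2 by rewrite expr2 ler_wpM2r// ltW.
by nra.
Qed.

Lemma far_bound (d1 d2 rho : R) : 0 < rho -> rho < `|d1| \/ rho < `|d2| ->
  rho ^+ 2 <= d1 ^+ 2 + d2 ^+ 2 /\ (`|d1| + `|d2|) * rho <= 2 * (d1 ^+ 2 + d2 ^+ 2).
Proof.
move=> r0; rewrite -(real_normK (num_real d1)) -(real_normK (num_real d2)).
have := normr_ge0 d1; have := normr_ge0 d2; move: (`|d1|) (`|d2|) => p q q0 p0 h.
have h2 : rho ^+ 2 <= p ^+ 2 + q ^+ 2 by case: h => h; nra.
split=> //; have : p * rho <= p ^+ 2 + q ^+ 2.
  by case: (leP p rho) => pr; nra.
have : q * rho <= p ^+ 2 + q ^+ 2.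
  by case: (leP q rho) => pr; nra.
by lra.
Qed.

(** The term [D / rho ^+ 2] of [L] absorbs the constant, since q >= rho^2, and [2 * E / rho] absorbs
    the linear growth, since p rho <= 2 q. *)
Lemma penalty_choice (q p D E rho L : R) : 0 < rho -> 0 <= D -> 0 <= E ->
  rho ^+ 2 <= q -> p * rho <= 2 * q -> L = 1 + D / rho ^+ 2 + 2 * E / rho ->
  D + E * p <= (L - 1) * q.
Proof.
move=> r0 D0 E0 h1 h2 ->.
have t1 : D <= D / rho ^+ 2 * q.
  by rewrite mulrAC ler_pdivlMr ?exprn_gt0// ler_wpM2l.
have t2 : E * p <= 2 * E / rho * q.
  rewrite mulrAC ler_pdivlMr// -mulrA (_ : 2 * E * q = E * (2 * q)); last by ring.
  by rewrite ler_wpM2l.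
by rewrite (_ : (1 + D / rho ^+ 2 + 2 * E / rho - 1) * q =
  D / rho ^+ 2 * q + 2 * E / rho * q); [exact: lerD|ring].
Qed.

(** At the touching point [a] and [fb] are phi_t and f(phi_x), and [fx] is the flux at the penalised
    slope: the time slope k (2 t + K + 1) of the penalty outweighs the flux change, at most K k. *)
Lemma strict_decrease (t a b fb fx k K K1 : R) : 0 < k -> 0 < t -> K1 = K + 1 ->
  a + fb <= 0 -> fx - fb <= K * k -> 0 <= a + (- k * (2 * t + K1)) + fx -> False.
Proof. by move=> k0 t0 -> h1 h2 h3; have := mulr_gt0 k0 t0; lra. Qed.

Lemma penalty_diff (a a0 u u0 p p0 k C D e1 e2 K1 t0 : R) : 0 <= k ->
  a - a0 <= D * (1 + (e1 + e2)) -> u0 - u <= C * (e1 + e2) -> p0 - p <= e1 + (2 * t0 + K1) * e2 ->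
  0 <= e1 -> 0 <= e2 -> 0 <= t0 -> 0 <= K1 ->
  (a - u - k * p) - (a0 - u0 - k * p0) <= D + (D + C + k * (1 + 2 * t0 + K1)) * (e1 + e2).
Proof.
move=> k0 h1 h2 h3 e10 e20 t00 K10.
have : k * (p0 - p) <= k * (e1 + (2 * t0 + K1) * e2) by rewrite ler_wpM2l.
have : 0 <= k * e2 by rewrite mulr_ge0.
have : 0 <= k * ((2 * t0 + K1) * e1) by rewrite !mulr_ge0// addr_ge0// mulr_ge0.
by lra.
Qed.

Variables (f v : R -> R) (g : R * R -> R) (M Mf : R).
Hypotheses (cf : continuous f) (sol : bounded_entropy_solution f v g)
  (gM : forall z, `|g z| <= M) (vM : forall x, `|v x| <= M)
  (fM : forall z, `|f (g z)| <= Mf) (lf : locally_lipschitz f).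

Let M0 : 0 <= M. Proof. exact: le_trans (normr_ge0 _) (vM 0). Qed.
Let Mf0 : 0 <= Mf. Proof. exact: le_trans (normr_ge0 _) (fM (0, 0)). Qed.

Notation U := (potential f v g M).
Let C := M + Mf.
Let C0 : 0 <= C. Proof. exact: addr_ge0. Qed.
Let lU : lip2 C U. Proof. exact: potential_lip. Qed.

(* Otherwise phi - U - k pen has a positive maximum at some z0 in the interior of K, and
   subtracting a large multiple of |z - z0|^2 gives a function that touches U from below. *)
Theorem comparison phi phix phit (K : set (R * R)) (Bx B D : R) :
  C1 phi phix phit -> closed K -> (forall z, K z -> 0 <= z.2) ->
  (forall z, K z -> phi z <= U z \/ 0 < z.2 /\ nbhs z K) ->
  (forall z, 0 < z.2 -> phit z + f (phix z) <= 0) ->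
  (forall z, `|phix z| <= Bx) ->
  0 <= D -> (forall z w, phi z - phi w <= D * (1 + (`|z.1 - w.1| + `|z.2 - w.2|))) ->
  0 <= B -> (forall z, K z -> phi z - U z <= B * (1 + z.2)) ->
  forall z, K z -> phi z <= U z.
Proof.
move=> C1phi cK K0 bdry sub phixB D0 phiD B0 growth zs Kzs.
rewrite leNgt; apply/negP => neg.
have [L L0 fL] := lf (Bx + 1).
(* The penalised slope stays in [-Bx - 1, Bx + 1], where [L] is a Lipschitz constant of [f], and
   differs from phi_x by at most k; a time slope above [L] makes the penalised function a strict
   subsolution. The quadratic term in t serves to beat the linear growth of phi - U. *)
pose K1 := L + 1; have K10 : 0 <= K1 by rewrite addr_ge0.
pose pen (z : R * R) := Num.sqrt (1 + z.1 ^+ 2) + (z.2 ^+ 2 + K1 * z.2).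
have pen_ge z : 0 <= z.2 -> `|z.1| + z.2 ^+ 2 <= pen z.
  by move=> z2; rewrite /pen lerD ?sqrt1_ge// lerDl mulr_ge0.
have pen_ge0 z : 0 <= z.2 -> 0 <= pen z.
  by move=> z2; rewrite (le_trans _ (pen_ge z z2))// addr_ge0// sqr_ge0.
pose mu := (phi zs - U zs) / 2; have mu0 : 0 < mu by rewrite divr_gt0// subr_gt0.
have p10 : 0 < pen zs + 1 by rewrite ltr_wpDl// pen_ge0// K0.
(* The penalty costs at most half of the gap at [zs], so [Psi] remains positive there. *)
pose k := Num.min 1 (mu / (pen zs + 1)).
have k0 : 0 < k by rewrite lt_min ltr01 divr_gt0.
have [k1 kmu] : k <= 1 /\ k * pen zs <= mu.
  split; first by rewrite ge_min lexx.
  have : k <= mu / (pen zs + 1) by rewrite ge_min lexx orbT.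
  rewrite ler_pdivlMr// mulrDr mulr1; apply: le_trans.
  by rewrite lerDl ltW.
pose Psi z := phi z - U z - k * pen z.
have Psi_s : 0 < Psi zs.
  rewrite /Psi subr_gt0 (le_lt_trans kmu)// /mu ltr_pdivrMr// ltr_pMr ?subr_gt0//.
  by rewrite ltr1n.
have C1pen : C1 pen (fun z => z.1 / Num.sqrt (1 + z.1 ^+ 2) + 0)
    (fun z => 0 + (2 * z.2 + K1)).
  have C2 : C1 (fun z : R * R => z.2) (fun=> 0) (fun=> 1).
    have := C1_affine (0 : R) 0 1; congr C1; apply/funext => z; ring.
  have := C1D _ _ _ _ _ _ C1_sqrt (C1D _ _ _ _ _ _ (C1M _ _ _ _ _ _ C2 C2) (C1Z K1 _ _ _ C2)).
  by congr C1; apply/funext => z; rewrite /pen ?expr2; ring.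
have cPsi : continuous Psi.
  move=> z; apply: cvgB; first apply: cvgB.
  - exact: C1_continuous C1phi z.
  - exact: lip2_continuous lU z.
  - by apply: cvgMr; exact: C1_continuous C1pen z.
(* If Psi >= 0 then |x| + t^2 <= b (1 + t), whence t <= b + 1 and |x| <= b (b + 2): the maximum is
   sought in a compact set. *)
pose b := B / k; have b0 : 0 <= b by rewrite divr_ge0// ltW.
pose r := (b + 1) + b * (b + 2).
have in_r z : K z -> 0 <= Psi z -> in_box r z.
  move=> Kz; rewrite /Psi subr_ge0 => h; have z20 := K0 z Kz.
  have h2 : `|z.1| + z.2 ^+ 2 <= b * (1 + z.2).
    rewrite /b mulrAC ler_pdivlMr// mulrC.
    apply: le_trans (growth z Kz); apply: le_trans h.
    by rewrite ler_wpM2l ?pen_ge// ltW.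
  have zt : z.2 <= b + 1.
    apply: growth_bound => //; apply: le_trans h2; by rewrite lerDr.
  have bb : 0 <= b * (b + 2) by rewrite mulr_ge0// addr_ge0.
  split; last by rewrite ger0_norm// /r (le_trans zt)// lerDl.
  apply: (@le_trans _ _ (b * (1 + z.2))).
    by apply: le_trans h2; rewrite lerDl sqr_ge0.
  apply: (@le_trans _ _ (b * (b + 2))); last by rewrite /r lerDr addr_ge0.
  by rewrite ler_wpM2l//; move: zt; lra.
have cS : compact (K `&` [set z | in_box r z]).
  by rewrite setIC; apply: compact_closedI => //; exact: box_compact.
have Szs : (K `&` [set z | in_box r z]) zs by split=> //; apply: in_r => //; exact: ltW.
have [z0] := compact_EVT_max (ex_intro _ zs Szs) cS (continuous_subspaceT cPsi).
rewrite inE => -[Kz0 _] Hmax.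
have Psi0 : 0 < Psi z0 by apply: (lt_le_trans Psi_s); apply: Hmax; rewrite inE.
have PsiK z : K z -> Psi z <= Psi z0.
  move=> Kz; have [|neg_z] := leP 0 (Psi z); last by rewrite (le_trans (ltW neg_z)) ?ltW.
  by move=> pz; apply: Hmax; rewrite inE; split => //; exact: in_r.
have t0_ge := K0 _ Kz0.
have [phiU|[t0 nK]] := bdry z0 Kz0.
  move: Psi0; rewrite /Psi ltNge => /negP; apply.
  by rewrite subr_le0 (le_trans _ (mulr_ge0 (ltW k0) (pen_ge0 _ t0_ge)))// subr_le0.
have [rho rho0 rhoK] := nbhs_box z0 K nK.
pose E := D + C + k * (1 + 2 * z0.2 + K1).
have E0 : 0 <= E by rewrite !addr_ge0// mulr_ge0 ?(ltW k0)// !addr_ge0// mulr_ge0.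
(* The viscosity inequality needs touching on the whole plane, whereas maximality is known only in
   [K]. Beyond distance [rho] the crude growth of [Psi] is absorbed by [(La - 1) * q]; the remaining
   unit of [q] makes the minimum strict. *)
pose La := 1 + D / rho ^+ 2 + 2 * E / rho.
have La1 : 1 <= La.
  by rewrite /La -addrA lerDl addr_ge0// divr_ge0 ?exprn_ge0 ?mulr_ge0// ltW.
pose q (z : R * R) := (z.1 - z0.1) ^+ 2 + (z.2 - z0.2) ^+ 2.
have q_ge0 z : 0 <= q z by rewrite addr_ge0// sqr_ge0.
have key z : Psi z - Psi z0 <= (La - 1) * q z.
  have [/andP[z1 z2]|far] := boolP ((`|z.1 - z0.1| <= rho) && (`|z.2 - z0.2| <= rho)).
    apply: (@le_trans _ _ 0); first by rewrite subr_le0; apply: PsiK; exact: rhoK.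
    by rewrite mulr_ge0 ?subr_ge0.
  have {}far : rho < `|z.1 - z0.1| \/ rho < `|z.2 - z0.2|.
    by move: far; rewrite negb_and -!ltNge => /orP.
  have [f1 f2] := far_bound _ _ _ rho0 far.
  apply: (le_trans _ (penalty_choice _ _ _ _ _ _ rho0 D0 E0 f1 f2 erefl)).
  apply: penalty_diff => //; first exact: ltW.
  - have := lU z0 z; rewrite ler_norml => /andP[_].
    by rewrite (distrC z0.1) (distrC z0.2).
  - have -> : pen z0 - pen z = (Num.sqrt (1 + z0.1 ^+ 2) - Num.sqrt (1 + z.1 ^+ 2)) +
      ((z0.2 ^+ 2 - z.2 ^+ 2) + K1 * (z0.2 - z.2)) by rewrite /pen; ring.
    rewrite (distrC z.1) (distrC z.2); apply: lerD; first exact: sqrt1_lip.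
    rewrite [leRHS]mulrDl; apply: lerD; last by rewrite ler_wpM2l// ler_norm.
    apply: (@le_trans _ _ (2 * z0.2 * (z0.2 - z.2))).
      by have := sqr_ge0 (z0.2 - z.2); move: (z0.2) (z.2) => p p'; nra.
    by rewrite ler_wpM2l ?mulr_ge0// ler_norm.
pose phi2 z := phi z + ((- k) * pen z + (- La) * q z).
have C1q : C1 q (fun z => 2 * (z.1 - z0.1)) (fun z => 2 * (z.2 - z0.2)).
  have Ca : C1 (fun z : R * R => z.1 - z0.1) (fun=> 1) (fun=> 0).
    have := C1_affine (- z0.1) 1 0; congr C1; apply/funext => z; ring.
  have Cb : C1 (fun z : R * R => z.2 - z0.2) (fun=> 0) (fun=> 1).
    have := C1_affine (- z0.2) 0 1; congr C1; apply/funext => z; ring.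
  have := C1D _ _ _ _ _ _ (C1M _ _ _ _ _ _ Ca Ca) (C1M _ _ _ _ _ _ Cb Cb).
  by congr C1; apply/funext => z; rewrite /q ?expr2; ring.
have C1phi2 := C1D _ _ _ _ _ _ C1phi (C1D _ _ _ _ _ _ (C1Z (- k) _ _ _ C1pen) (C1Z (- La) _ _ _ C1q)).
have touch z : U z0 - phi2 z0 + q z <= U z - phi2 z.
  have q0 : q z0 = 0 by rewrite /q !subrr expr0n /= addr0.
  have := key z; rewrite /Psi /phi2 q0.
  by move: (U z) (U z0) (phi z) (phi z0) (pen z) (pen z0) (q z) => x1 x2 x3 x4 x5 x6 x7; lra.
have := viscosity_inequality f v g M Mf cf sol gM vM fM lf _ _ _ z0 C1phi2 t0 touch.
rewrite !subrr !mulr0 !addr0 !add0r.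
apply: (strict_decrease z0.2 (phit z0) (phix z0) (f (phix z0)) _ k L K1) => //; first exact: sub.
have bx : `|phix z0| <= Bx + 1 by rewrite (le_trans (phixB z0))// lerDl.
have sl := sqrt1_slope z0.1.
have by_ : `|phix z0 + - k * (z0.1 / Num.sqrt (1 + z0.1 ^+ 2))| <= Bx + 1.
  apply: (le_trans (ler_normD _ _)); apply: lerD => //.
  rewrite normrM normrN (gtr0_norm k0); by rewrite -[leRHS]mulr1 ler_pM// ltW.
apply: (le_trans (ler_norm _)); apply: (le_trans (fL _ _ by_ bx)).
rewrite addrAC subrr add0r normrM normrN (gtr0_norm k0) ler_wpM2l//.
by rewrite -[leRHS]mulr1 ler_wpM2l// ltW.
Qed.

End comparison.

(** * Convex fluxes and affine bounds *)

Section convex_flux.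
Context {R : realType}.
Implicit Types F : R -> R.

Lemma eq_le (x y : R) : x = y -> x <= y.
Proof. by move=> ->. Qed.

Lemma derivable_continuous F : (forall v, derivable F v 1) -> continuous F.
Proof. by move=> dF v; apply: differentiable_continuous; apply/derivable1_diffP. Qed.

Lemma mean_value F a b : (forall v, derivable F v 1) -> a <= b ->
  exists c, [/\ a <= c, c <= b & F b - F a = (derive1 F) c * (b - a)].
Proof.
move=> dF ab.
have [c] := @MVT_segment R F (derive1 F) a b ab
  (fun x _ => @DeriveDef _ _ _ _ _ _ _ (dF x) (esym (derive1E F x)))
  (continuous_subspaceT (derivable_continuous F dF)).
by rewrite in_itv /= => /andP[ac cb] e; exists c.
Qed.

Lemma derive_pos_increasing F : (forall v, derivable F v 1) ->
  (forall v, 0 < (derive1 F) v) -> {homo F : x y / x < y}.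
Proof.
move=> dF pF x y xy; have [c [_ _ e]] := mean_value F x y dF (ltW xy).
by rewrite -subr_gt0 e mulr_gt0// subr_gt0.
Qed.

Variable f : R -> R.
Hypotheses (df : forall v, derivable f v 1) (incr : {homo (derive1 f) : x y / x < y}).

Let mono : {homo (derive1 f) : x y / x <= y}.
Proof. by move=> x y; rewrite le_eqVlt => /predU1P[->//|/incr/ltW]. Qed.

Lemma tangent_le a b : f a + (derive1 f) a * (b - a) <= f b.
Proof.
rewrite -lerBrDl; have [ab|/ltW ba] := leP a b.
  have [c [ac cb ->]] := mean_value f a b df ab.
  by rewrite ler_wpM2r ?subr_ge0// mono.
have [c [ac cb e]] := mean_value f b a df ba.
rewrite -[leRHS]opprB e -mulrN opprB -subr_ge0 -mulrBl mulr_le0// subr_le0//.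
by rewrite mono.
Qed.

(** The derivative is monotone, so on [-B, B] it lies between its values at the endpoints. *)
Lemma convex_locally_lipschitz : locally_lipschitz f.
Proof.
move=> B; exists (`|(derive1 f) B| + `|(derive1 f) (- B)|) => [|p q]; first by rewrite addr_ge0.
wlog pq : p q / p <= q => [h hp hq|].
  have [|/ltW] := leP p q; first by move=> pq; exact: h.
  by move=> qp; rewrite distrC (distrC p); exact: h.
move=> hp hq; have /andP[p1 p2] : - B <= p <= B by rewrite -ler_norml.
have /andP[q1 q2] : - B <= q <= B by rewrite -ler_norml.
have [c [pc cq e]] := mean_value f p q df pq.
rewrite distrC e normrM (distrC p) ler_wpM2r//.
have := mono c B (le_trans cq q2); have := mono _ c (le_trans p1 pc).
move=> h1 h2; rewrite ler_norml; have := ler_norm ((derive1 f) B); have := normr_ge0 ((derive1 f) (- B)).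
have := ler_norm (- (derive1 f) (- B)); rewrite normrN; have := normr_ge0 ((derive1 f) B).
by move: h1 h2; move: ((derive1 f) c) ((derive1 f) B) ((derive1 f) (- B)) (`|(derive1 f) B|) (`|(derive1 f) (- B)|)
  => x1 x2 x3 x4 x5; lra.
Qed.

Lemma inverse_funK a : inverse_fun (derive1 f) ((derive1 f) a) = a.
Proof.
rewrite /inverse_fun; case: pselect => [h|[]]; last by exists a.
case: cid => b /= e; case: (ltgtP a b) => // /incr; rewrite e ltxx//.
Qed.

Lemma derive_intermediate a b y : (forall v, derivable (derive1 f) v 1) -> a <= b ->
  (derive1 f) a <= y <= (derive1 f) b -> exists c, [/\ a <= c, c <= b & (derive1 f) c = y].
Proof.
move=> ddf ab /andP[ay yb].
have [|c] := @IVT R (derive1 f) a b y ab (continuous_subspaceT (derivable_continuous _ ddf)).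
  by rewrite ge_min ay le_max yb orbT.
by rewrite in_itv /= => /andP[ac cb] e; exists c.
Qed.

End convex_flux.

(** * Half-planes and derivatives along rays *)

Section plane_functions.
Context {R : realType}.
Implicit Types F : R * R -> R.

Lemma half_plane_continuous (a b : R) : continuous (fun z : R * R => a * z.1 + b * z.2).
Proof.
have := C1_continuous _ _ _ (C1_affine (0 : R) a b).
by rewrite (_ : (fun z => _) = (fun z : R * R => a * z.1 + b * z.2))//; apply/funext => z; ring.
Qed.

Lemma open_half_plane (a b : R) : open [set z : R * R | 0 < a * z.1 + b * z.2].
Proof. exact: open_comp (fun z _ => half_plane_continuous a b z) (@open_gt R 0). Qed.

Lemma closed_half_plane (a b : R) : closed [set z : R * R | 0 <= a * z.1 + b * z.2].
Proof. exact: closed_comp (fun z _ => half_plane_continuous a b z) (@closed_ge R 0). Qed.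

Lemma lip2_time F C x t : lip2 C F -> 0 <= t -> F (x, 0) - F (x, t) <= C * t.
Proof.
move=> lF t0; have := lF (x, 0) (x, t).
by rewrite /= subrr normr0 add0r sub0r normrN (ger0_norm t0) ler_norml => /andP[].
Qed.

Lemma qdiff_derive_ray F c t a b : qdiff F (c * t, t) a b ->
  is_derive t 1 (fun s => F (c * s, s)) (c * a + b).
Proof.
move=> qF; have [dF dx dt] := qdiff_differentiable _ _ _ _ qF.
have E : 'D_(c, 1) F (c * t, t) = c * a + b.
  rewrite -{1}dx -{1}dt !deriveE// (_ : (c, 1) = c *: (1, 0) + (0, 1) :> R * R).
    by rewrite linearD linearZ.
  by rewrite [RHS]surjective_pairing /=; congr pair; rewrite /GRing.scale /=; ring.
have eqf : (fun q : R => q^-1 *: (F (c * (q *: 1 + t), q *: 1 + t) - F (c * t, t))) =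
    (fun q : R => q^-1 *: (F (q *: ((c, 1) : R * R) + (c * t, t)) - F (c * t, t))).
  apply/funext => q; congr (_ *: (F _ - _)); rewrite [RHS]surjective_pairing /=.
  by congr pair; rewrite /GRing.scale /=; ring.
have := @diff_derivable _ _ _ _ _ ((c, 1) : R * R) dF.
rewrite /derivable -eqf => df; apply: DeriveDef => //.
by rewrite -E /derive -eqf.
Qed.

End plane_functions.

(** * Jensen's inequality and affine bounds for potentials *)

Section affine_bounds.
Context {R : realType}.
Variables (f v : R -> R) (g : R * R -> R) (M Mf : R).
Hypotheses (df : forall v, derivable f v 1) (incr : {homo (derive1 f) : x y / x < y})
  (sol : bounded_entropy_solution f v g)
  (gM : forall z, `|g z| <= M) (vM : forall x, `|v x| <= M)
  (fM : forall z, `|f (g z)| <= Mf).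

Let cf : continuous f. Proof. exact: derivable_continuous. Qed.
Let bg : bmf g. Proof. by case: sol. Qed.
Let bfg : bmf (fun z => f (g z)). Proof. exact: bmf_cont cf bg. Qed.
Let M0 : 0 <= M. Proof. exact: le_trans (normr_ge0 _) (vM 0). Qed.
Let Mf0 : 0 <= Mf. Proof. exact: le_trans (normr_ge0 _) (fM (0, 0)). Qed.
Let C := M + Mf.
Let C0 : 0 <= C. Proof. exact: addr_ge0. Qed.

Notation U := (potential f v g M).
Let lU : lip2 C U. Proof. exact: potential_lip. Qed.

(** Affine inequalities survive averaging; convexity is used only through tangents, so this is all
    that Jensen's inequality requires. *)
Lemma avg_affine (g1 g2 : R * R -> R) (h k c1 c2 : R) z : bmf g1 -> bmf g2 ->
  0 < h -> 0 < k -> (forall w, c1 + c2 * g1 w <= g2 w) ->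
  c1 + c2 * avg h k g1 z <= avg h k g2 z.
Proof.
move=> b1 b2 h0 k0 le12.
have hk0 : 0 < h * k by rewrite mulr_gt0.
have lz : z.1 <= z.1 + h by rewrite lerDl ltW.
have lt' : z.2 <= z.2 + k by rewrite lerDl ltW.
have l1 s := bmf_lint _ (bmf_slice1 g1 s b1).
have l2 s := bmf_lint _ (bmf_slice1 g2 s b2).
have L1 := bmf_lint _ (bmf_sint1 g1 z.1 (z.1 + h) b1).
have L2 := bmf_lint _ (bmf_sint1 g2 z.1 (z.1 + h) b2).
rewrite /avg [leRHS]mulrC ler_pdivlMr// mulrDl -(mulrA c2) (mulrC (_^-1)) divfK ?gt_eqF//.
have inner s : h * c1 + c2 * sint (fun y => g1 (y, s)) z.1 (z.1 + h) <=
    sint (fun y => g2 (y, s)) z.1 (z.1 + h).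
  rewrite -(sintZ c2 (fun y => g1 (y, s)))// (_ : h * c1 = sint (fun=> c1) z.1 (z.1 + h)).
    rewrite -(sintD (fun=> c1) (fun y => c2 * g1 (y, s)))//; last exact: lintZ.
      by apply: le_sint => //; apply: lintD; [exact: lint_cst|exact: lintZ].
    exact: lint_cst.
  by rewrite sint_cst addrAC subrr add0r.
apply: (@le_trans _ _ (sint (fun s => h * c1 + c2 * sint (fun y => g1 (y, s)) z.1 (z.1 + h)) z.2 (z.2 + k))).
  rewrite (sintD (fun=> h * c1) (fun s => c2 * sint (fun y => g1 (y, s)) z.1 (z.1 + h))).
  - rewrite sint_cst (sintZ c2 (fun s => sint (fun y => g1 (y, s)) z.1 (z.1 + h)))//.
    by rewrite addrAC subrr add0r; apply: eq_le; ring.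
  - exact: lint_cst.
  - exact: lintZ.
by apply: le_sint => //; apply: lintD; [exact: lint_cst|exact: lintZ].
Qed.

(* Jensen's inequality against the tangent of [f] at [a]. *)
Lemma box_avg_tangent (h k a : R) z : 0 < h -> 0 < k -> 0 <= z.2 ->
  box_avg_t U h k z + (f a + (derive1 f) a * (box_avg_x U h k z - a)) <= 0.
Proof.
move=> h0 k0; case: z => y s /= s0.
rewrite (potential_avg_x f v g M Mf)// (potential_avg_t f v g M Mf)//.
rewrite addrC subr_le0.
have := avg_affine g (fun z => f (g z)) h k (f a - (derive1 f) a * a) ((derive1 f) a) (y, s) bg bfg h0 k0.
have tg w : f a - (derive1 f) a * a + (derive1 f) a * g w <= f (g w).
  by apply: le_trans (tangent_le f df incr a (g w)); rewrite mulrBr; apply: eq_le; ring.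
by move=> /(_ tg); apply: le_trans; apply: eq_le; ring.
Qed.

Lemma box_avg_subsolution (h k : R) z : 0 < h -> 0 < k -> 0 <= z.2 ->
  box_avg_t U h k z + f (box_avg_x U h k z) <= 0.
Proof.
(* The tangent is taken at the very slope of the average, where its linear term vanishes. *)
move=> h0 k0 z0; have := box_avg_tangent h k (box_avg_x U h k z) z h0 k0 z0.
by rewrite subrr mulr0 addr0.
Qed.

Lemma ray_slope (vt vx c a fa : R) :
  vt + (fa + c * (vx - a)) <= 0 -> c * vx + vt <= c * a - fa.
Proof. by rewrite mulrBr; lra. Qed.

Lemma ray_final (x0 x1 w b e c a fa t S : R) : b + b <= e -> 0 <= t -> S <= c * a - fa ->
  - b <= x1 - w -> x0 - 0 <= b -> x1 - x0 = S * t -> w <= a * (c * t) - fa * t + e.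
Proof.
move=> be t0 Sc h1 h2 h3; have : S * t <= (c * a - fa) * t by rewrite ler_wpM2r.
rewrite mulrBl (_ : a * (c * t) = c * a * t); last by ring.
by move: (c * a * t) (fa * t) (S * t) h3 => *; lra.
Qed.

(** The affine function solves the equation exactly. As [U] falls below its initial values at rate
    at most [C], the excess over [U] grows at most like (|f(a)| + C) t, as comparison on the
    half-plane demands. *)
Lemma affine_le a : (forall y, a * y <= U (y, 0)) ->
  forall z, 0 <= z.2 -> a * z.1 - f a * z.2 <= U z.
Proof.
move=> U0 z z0.
have C1a : C1 (fun z : R * R => a * z.1 - f a * z.2) (fun=> a) (fun=> - f a).
  have := C1_affine (0 : R) a (- f a); congr C1; apply/funext => w; ring.
have cK : closed [set z : R * R | 0 <= z.2].
  by have := closed_half_plane (0 : R) 1; congr closed; apply/seteqP; split => w /=; rewrite mul0r add0r mul1r.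
apply: (comparison f v g M Mf cf sol gM vM fM (convex_locally_lipschitz f df incr)
  _ _ _ [set z : R * R | 0 <= z.2] `|a| (`|f a| + C) (`|a| + `|f a|) C1a cK) => //=.
- move=> [x t] /=; rewrite le_eqVlt => /predU1P[<-|t0].
    by left; rewrite mulr0 subr0.
  right; split=> //; have := open_nbhs_nbhs (conj (open_half_plane (0 : R) 1) _) => /(_ (x, t)).
  rewrite /= mul0r add0r mul1r => /(_ t0); apply: filterS => w /=.
  by rewrite mul0r add0r mul1r => /ltW.
- by move=> w _; rewrite addrC subrr.
- move=> w w'; apply: le_trans (ler_norm _) _.
  rewrite (_ : _ - _ = a * (w.1 - w'.1) - f a * (w.2 - w'.2)); last by ring.
  apply: (le_trans (ler_normB _ _)); rewrite !normrM.
  move: (normr_ge0 a) (normr_ge0 (f a)) (normr_ge0 (w.1 - w'.1)) (normr_ge0 (w.2 - w'.2)).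
  by move: (`|a|) (`|f a|) (`|w.1 - _|) (`|w.2 - _|) => *; nra.
- by rewrite addr_ge0.
- move=> [x t] t0; have := lip2_time _ _ x t lU t0; have := U0 x; have := C0.
  have : - f a * t <= `|f a| * t by rewrite ler_wpM2r// -normrN ler_norm.
  have : 0 <= `|f a| by []; rewrite /=.
  by move: t0 C (U (x, t)) (U (x, 0)) (`|f a|) (a * x) (f a) => /= t0 *; lra.
Qed.

(* By Jensen's inequality a box average V of U satisfies V_t + c V_x <= a c - f(a) with
   c = f'(a), so it grows at most at this rate along the ray x = c t. *)
Lemma ray_le a t : 0 <= t -> U (0, 0) = 0 ->
  U ((derive1 f) a * t, t) <= a * ((derive1 f) a * t) - f a * t.
Proof.
move=> t0 U0; apply/ler_addgt0Pr => e e0.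
set c := (derive1 f) a.
(* On a square of side [d] the average is off by at most [2 * C * d]; the error enters at both ends
   of the ray segment. *)
pose d := e / (4 * C + 1).
have D0 : 0 < 4 * C + 1 by rewrite ltr_wpDl// mulr_ge0.
have d0 : 0 < d by rewrite divr_gt0.
have dC : 4 * C * d <= e.
  by rewrite /d mulrA ler_pdivrMr// mulrC ler_wpM2l ?(ltW e0)// lerDl.
have ap z := box_avg_approx U C d d C0 d0 d0 lU z.
have := ap (c * t, t); have := ap (c * 0, 0); rewrite mulr0 U0 !ler_norml => /andP[_ h1] /andP[h2 _].
have [qV _ _] := box_avg_C1 U C d d C0 d0 d0 lU.
have der s := qdiff_derive_ray _ c s _ _ (qV (c * s, s)).
have [|s] := @MVT_segment R (fun s => box_avg U d d (c * s, s)) _ 0 t t0 (fun x _ => der x).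
  apply: continuous_subspaceT => x; apply: differentiable_continuous; apply/derivable1_diffP.
  by have [] := der x.
rewrite in_itv /= => /andP[s0 _]; rewrite mulr0 subr0 => e1.
have := box_avg_tangent d d a (c * s, s) d0 d0 s0; rewrite -/c => tg.
apply: (ray_final _ _ _ (C * (d + d)) _ _ _ _ _ _ _ _ _ h2 h1 e1) => //.
- by rewrite (_ : C * (d + d) + C * (d + d) = 4 * C * d)//; ring.
- exact: ray_slope.
Qed.

End affine_bounds.

(** * Agreement of two potentials on a closed set *)

Section agreement.
Context {R : realType}.
Variables (f : R -> R).
Hypotheses (df : forall v, derivable f v 1) (incr : {homo (derive1 f) : x y / x < y}).

Let cf : continuous f. Proof. exact: derivable_continuous. Qed.

Lemma shifted_le (V U W b e : R) : `|V - U| <= b -> V - b <= W -> 2 * b <= e -> U <= W + e.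
Proof. by rewrite ler_norml => /andP[h1 h2] h3 h4; lra. Qed.

Lemma shifted_growth (V V' U U' C b s : R) : `|V - U| <= b -> `|V' - U'| <= b ->
  `|U - U'| <= C * s -> 2 * b <= 4 * C -> 0 <= C -> 0 <= s ->
  V - b - (V' - b) <= 4 * C * (1 + s).
Proof.
rewrite !ler_norml => /andP[h1 h2] /andP[h3 h4] /andP[h5 h6] h7 h8 h9.
by have := mulr_ge0 h8 h9; lra.
Qed.

Lemma shifted_diff (V U U' b : R) : `|V - U| <= b -> V - b - U' <= U - U'.
Proof. by rewrite ler_norml => /andP[h1 h2]; lra. Qed.

(* The box averages of one potential are C^1 subsolutions, to be compared with the other. *)
Lemma potential_le (v1 v2 : R -> R) (g1 g2 : R * R -> R) (M1 Mf1 M2 Mf2 : R)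
    (K : set (R * R)) (B : R) :
  bounded_entropy_solution f v1 g1 -> (forall z, `|g1 z| <= M1) ->
  (forall x, `|v1 x| <= M1) -> (forall z, `|f (g1 z)| <= Mf1) ->
  bounded_entropy_solution f v2 g2 -> (forall z, `|g2 z| <= M2) ->
  (forall x, `|v2 x| <= M2) -> (forall z, `|f (g2 z)| <= Mf2) ->
  closed K -> (forall z, K z -> 0 <= z.2) -> 0 <= B ->
  (forall z, K z -> potential f v1 g1 M1 z - potential f v2 g2 M2 z <= B * z.2) ->
  (forall z, K z -> potential f v1 g1 M1 z <= potential f v2 g2 M2 z \/ 0 < z.2 /\ nbhs z K) ->
  forall z, K z -> potential f v1 g1 M1 z <= potential f v2 g2 M2 z.
Proof.
move=> sol1 gM1 vM1 fM1 sol2 gM2 vM2 fM2 cK K0 B0 growth bdry z0 Kz0.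
have lU := potential_lip f v1 g1 M1 Mf1 cf sol1 gM1 vM1 fM1.
have lf := convex_locally_lipschitz f df incr.
have sub h k z h0 k0 z20 :=
  box_avg_subsolution f v1 g1 M1 Mf1 df incr sol1 gM1 vM1 fM1 h k z h0 k0 z20.
have C0 : 0 <= M1 + Mf1.
  by rewrite addr_ge0// ?(le_trans _ (vM1 0))// (le_trans _ (fM1 (0, 0))).
have cmp phi phix phit Bx D := comparison f v2 g2 M2 Mf2 cf sol2 gM2 vM2 fM2 lf
  phi phix phit K Bx B D.
move: (potential f v1 g1 M1) (M1 + Mf1) (potential f v2 g2 M2) C0 lU growth bdry sub cmp =>
  U C W C0 lU growth bdry sub cmp.
apply/ler_addgt0Pr => e e0.
pose d := Num.min 1 (e / (4 * C + 1)).
have D0 : 0 < 4 * C + 1 by rewrite ltr_wpDl// mulr_ge0.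
have d0 : 0 < d by rewrite lt_min ltr01 divr_gt0.
have dC : 2 * (C * (d + d)) <= e.
  have : d <= e / (4 * C + 1) by rewrite ge_min lexx orbT.
  rewrite ler_pdivlMr// mulrDr mulr1 => h.
  rewrite (_ : 2 * (C * (d + d)) = d * (4 * C)); last by ring.
  by apply: le_trans h; rewrite lerDl ltW.
have dC1 : 2 * (C * (d + d)) <= 4 * C.
  rewrite (_ : 2 * (C * (d + d)) = 4 * C * d); last by ring.
  by rewrite ler_piMr ?mulr_ge0// ge_min lexx.
have ap z := box_avg_approx U C d d C0 d0 d0 lU z.
(* Lowered by its approximation error, the average lies below [U] and inherits the boundary and
   growth bounds assumed for [U]; adding a constant keeps it a subsolution. *)
have C1V : C1 (fun z => box_avg U d d z - C * (d + d)) (box_avg_x U d d) (box_avg_t U d d).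
  have := C1D _ _ _ _ _ _ (box_avg_C1 U C d d C0 d0 d0 lU) (C1_affine (- (C * (d + d))) 0 0).
  by congr C1; apply/funext => z; ring.
apply: (shifted_le _ _ _ _ _ (ap z0) _ dC).
apply: (cmp _ _ _ C (4 * C) C1V cK K0 _ _ _ _ _ B0 _ z0 Kz0).
- move=> z Kz; case: (bdry z Kz) => [h|]; [left|by right].
  by apply: (le_trans _ h); rewrite -subr_le0 (le_trans (shifted_diff _ _ _ _ (ap z)))// subrr.
- by move=> z z20; apply: sub => //; exact: ltW.
- by move=> z; exact: box_avg_x_bound.
- by rewrite mulr_ge0.
- by move=> z w; apply: shifted_growth (ap z) (ap w) (lU z w) dC1 C0 _; rewrite addr_ge0.
- move=> z Kz; apply: (le_trans (shifted_diff _ _ _ _ (ap z))).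
  by apply: (le_trans (growth z Kz)); rewrite ler_wpM2l// lerDr.
Qed.

Lemma close_potentials (U U' C C' B d t : R) (w w' : R) : 0 <= C -> 0 <= C' -> w = w' ->
  `|U - w| <= C * d -> `|U' - w'| <= C' * d -> d <= B * t -> U - U' <= (C + C') * B * t.
Proof.
move=> C0 C0' <-; rewrite !ler_norml => /andP[h1 h2] /andP[h3 h4] h.
have : C * d <= C * (B * t) by rewrite ler_wpM2l.
have : C' * d <= C' * (B * t) by rewrite ler_wpM2l.
by rewrite mulrDl mulrDl -!mulrA; move: (C * (B * t)) (C' * (B * t)) (C * d) (C' * d) h1 h2 h3 h4 => *; lra.
Qed.

(** Each point of [K] has within distance [B] t a point where the potentials coincide; being
    Lipschitz, they differ by O(t), which is the growth bound needed on an unbounded set. *)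
Lemma potential_agree (v1 v2 : R -> R) (g1 g2 : R * R -> R) (M1 Mf1 M2 Mf2 : R)
    (K : set (R * R)) (B : R) :
  bounded_entropy_solution f v1 g1 -> (forall z, `|g1 z| <= M1) ->
  (forall x, `|v1 x| <= M1) -> (forall z, `|f (g1 z)| <= Mf1) ->
  bounded_entropy_solution f v2 g2 -> (forall z, `|g2 z| <= M2) ->
  (forall x, `|v2 x| <= M2) -> (forall z, `|f (g2 z)| <= Mf2) ->
  closed K -> (forall z, K z -> 0 <= z.2) -> 0 <= B ->
  (forall z, K z -> exists2 w : R * R, potential f v1 g1 M1 w = potential f v2 g2 M2 w &
    `|z.1 - w.1| + `|z.2 - w.2| <= B * z.2) ->
  (forall z, K z -> potential f v1 g1 M1 z = potential f v2 g2 M2 z \/ 0 < z.2 /\ nbhs z K) ->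
  forall z, K z -> potential f v1 g1 M1 z = potential f v2 g2 M2 z.
Proof.
move=> sol1 gM1 vM1 fM1 sol2 gM2 vM2 fM2 cK K0 B0 growth bdry z Kz.
have lU1 := potential_lip f v1 g1 M1 Mf1 cf sol1 gM1 vM1 fM1.
have lU2 := potential_lip f v2 g2 M2 Mf2 cf sol2 gM2 vM2 fM2.
have C1_ge0 : 0 <= M1 + Mf1.
  by rewrite addr_ge0// ?(le_trans _ (vM1 0))// (le_trans _ (fM1 (0, 0))).
have C2_ge0 : 0 <= M2 + Mf2.
  by rewrite addr_ge0// ?(le_trans _ (vM2 0))// (le_trans _ (fM2 (0, 0))).
have le12 := potential_le v1 v2 g1 g2 M1 Mf1 M2 Mf2 K _ sol1 gM1 vM1 fM1 sol2 gM2 vM2 fM2 cK K0.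
have le21 := potential_le v2 v1 g2 g1 M2 Mf2 M1 Mf1 K _ sol2 gM2 vM2 fM2 sol1 gM1 vM1 fM1 cK K0.
move: (potential f v1 g1 M1) (potential f v2 g2 M2) lU1 lU2 growth bdry le12 le21 =>
  U1 U2 lU1 lU2 growth bdry le12 le21.
apply/le_anti/andP; split.
- apply: (le12 (((M1 + Mf1) + (M2 + Mf2)) * B)) => //.
  + by rewrite mulr_ge0// addr_ge0.
  + move=> y Ky; have [w e h] := growth y Ky.
    exact: close_potentials C1_ge0 C2_ge0 e (lU1 y w) (lU2 y w) h.
  + by move=> y Ky; case: (bdry y Ky) => [->|]; [left|right].
- apply: (le21 (((M2 + Mf2) + (M1 + Mf1)) * B)) => //.
  + by rewrite mulr_ge0// addr_ge0.
  + move=> y Ky; have [w e h] := growth y Ky.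
    exact: close_potentials C2_ge0 C1_ge0 (esym e) (lU2 y w) (lU1 y w) h.
  + by move=> y Ky; case: (bdry y Ky) => [->|]; [left|right].
Qed.

End agreement.

(** * Almost everywhere identification *)

Section almost_everywhere.
Context {R : realType}.
Notation mu2 := ((@lebesgue_measure R) \x (@lebesgue_measure R))%E.
Implicit Types (q : R * R -> R) (D : set (R * R)).

Lemma ae_countable (T : countType) (P : T -> R * R -> Prop) :
  (forall i, {ae mu2, forall z, P i z}) -> {ae mu2, forall z, forall i, P i z}.
Proof.
move=> H; have : {ae mu2, forall z, forall n, if unpickle n is Some i then P i z else True}.
  apply: ae_foralln => n; case: unpickle => [i|]; first exact: H.
  exact: nearW.
by apply: ae_imp => z Hz i; have := Hz (pickle i); rewrite pickleK.
Qed.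

(** Countably many boxes with rational centre and radius cover [D]. The doubled boxes lie in [D] as
    well, which leaves room for averages whose windows start in the smaller box. *)
Lemma ae_open D (P : R * R -> Prop) : open D ->
  (forall a b r, 0 < r -> (forall w, `|w.1 - a| <= 2 * r -> `|w.2 - b| <= 2 * r -> D w) ->
    {ae mu2, forall z, `|z.1 - a| <= r -> `|z.2 - b| <= r -> P z}) ->
  {ae mu2, forall z, D z -> P z}.
Proof.
move=> oD H.
pose Q (i : rat * rat * rat) (z : R * R) := 0 < ratr i.2 :> R ->
  (forall w : R * R, `|w.1 - ratr i.1.1| <= 2 * ratr i.2 -> `|w.2 - ratr i.1.2| <= 2 * ratr i.2 -> D w) ->
  `|z.1 - ratr i.1.1| <= ratr i.2 -> `|z.2 - ratr i.1.2| <= ratr i.2 -> P z.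
have : {ae mu2, forall z, forall i, Q i z}.
  apply: ae_countable => i; have [h|h] := pselect (0 < ratr i.2 :> R /\ forall w : R * R,
      `|w.1 - ratr i.1.1| <= 2 * ratr i.2 -> `|w.2 - ratr i.1.2| <= 2 * ratr i.2 -> D w).
    by apply: ae_imp (H _ _ _ h.1 h.2) => z h1 _ _.
  by apply: nearW => z h1 h2; case: h.
apply: ae_imp => z QP Dz.
have [rho rho0 rhoD] := nbhs_box z D (open_nbhs_nbhs (conj oD Dz)).
have r3 : 0 < rho / 3 by rewrite divr_gt0.
have [r] := rat_in_itvoo r3; rewrite in_itv /= => /andP[r0 r1].
have near_rat (x : R) : exists c : rat, `|x - ratr c| <= ratr r /\
    forall y, `|y - ratr c| <= 2 * ratr r -> `|y - x| <= rho.
  have xr : x < x + ratr r by rewrite ltrDl.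
  have [c] := rat_in_itvoo xr; rewrite in_itv /= => /andP[c0 c1].
  exists c; split=> [|y]; first by rewrite ltr0_norm ?subr_lt0// opprB lerBlDl ltW.
  move: r1; rewrite ltr_pdivlMr// => r1.
  by rewrite !ler_norml => /andP[h1 h2]; move: (ratr c : R) (ratr r : R) r0 r1 c0 c1 h1 h2 => *; lra.
have [a [a1 a2]] := near_rat z.1; have [b [b1 b2]] := near_rat z.2.
by apply: (QP ((a, b), r)) => //= w w1 w2; apply: rhoD; [exact: a2|exact: b2].
Qed.

Lemma sint_shift_lip (p : R -> R) (M h x y : R) : lint p -> (forall s, `|p s| <= M) ->
  `|sint p x (x + h) - sint p y (y + h)| <= 2 * M * `|x - y|.
Proof.
move=> lp pM; have e s : sint p s (s + h) = sint p 0 (s + h) - sint p 0 s.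
  by rewrite -(sintD_itv p 0 s (s + h) lp) addrAC subrr add0r.
have h1 := lipschitz_sint p 0 M lp pM (x + h) (y + h).
have h2 := lipschitz_sint p 0 M lp pM x y.
rewrite !e (_ : _ - _ = (sint p 0 (x + h) - sint p 0 (y + h)) - (sint p 0 x - sint p 0 y)); last by ring.
apply: (le_trans (ler_normB _ _)); rewrite (_ : 2 * M * _ = M * `|x - y| + M * `|x - y|); last by ring.
apply: lerD => //.
by move: h1; rewrite (_ : x + h - (y + h) = x - y)//; ring.
Qed.

Lemma bmf_avg q h k : bmf q -> bmf (avg h k q).
Proof.
move=> bq; have [mq [M qM]] := bq; rewrite /avg; apply: bmfM; first exact: bmf_cst.
have M0 : 0 <= M by exact: le_trans (normr_ge0 _) (qM (0, 0)).
have l1 s := bmf_lint _ (bmf_slice1 q s bq).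
pose G (x s : R) := sint (fun y => q (y, s)) x (x + h).
have lG x : lint (G x) by exact: bmf_lint (bmf_sint1 q x (x + h) bq).
have Gb x s : `|G x s| <= M * `|h|.
  by apply: (le_trans (sint_bound _ _ _ M (l1 s) _)) => //; rewrite (addrC x) addrK.
split; last first.
  exists (M * `|h| * `|k|) => z.
  apply: (le_trans (sint_bound _ _ _ (M * `|h|) (lG z.1) _)) => [y _|]; first exact: Gb.
  by rewrite (addrC z.2) addrK.
apply: continuous_measurable2.
apply: (@lip2_continuous _ (2 * M * `|k| + 2 * (M * `|h|))) => z w.
pose F x t := sint (G x) t (t + k); change (`|F z.1 z.2 - F w.1 w.2| <=
  (2 * M * `|k| + 2 * (M * `|h|)) * (`|z.1 - w.1| + `|z.2 - w.2|)).
rewrite -(subrK (F w.1 z.2) (F z.1 z.2)) -addrA /F.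
apply: (le_trans (ler_normD _ _)); rewrite mulrDl; apply: lerD.
  rewrite -sintB//; apply: (@le_trans _ _ (2 * M * `|z.1 - w.1| * `|k|)).
    apply: (le_trans (sint_bound _ _ _ (2 * M * `|z.1 - w.1|) _ _)) => [|s _|].
    - exact: lintB.
    - by apply: sint_shift_lip.
    - by rewrite (addrC z.2) addrK.
  by rewrite mulrAC ler_wpM2l ?mulr_ge0// lerDl.
apply: (le_trans (sint_shift_lip _ (M * `|h|) _ _ _ _ _)) => //.
by rewrite ler_wpM2l ?mulr_ge0// lerDr.
Qed.

Lemma pos_avg_le (u a : R) : a <= 0 -> pos u <= `|a - u|.
Proof.
move=> a0; rewrite /pos ge_max normr_ge0 andbT distrC.
by apply: le_trans (ler_norm _); rewrite lerDl oppr_ge0.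
Qed.

(* The L^1 distance between q and its averages controls the positive part of q. *)
Lemma avg_le0_ae q D : bmf q -> open D ->
  (forall z h k, 0 < h -> 0 < k ->
    (forall w, z.1 <= w.1 <= z.1 + h -> z.2 <= w.2 <= z.2 + k -> D w) -> avg h k q z <= 0) ->
  {ae mu2, forall z, D z -> q z <= 0}.
Proof.
move=> bq oD H; apply: ae_open => // a b r r0 boxD.
have itv (c : R) : c - r <= c + r by rewrite lerD2l (le_trans _ (ltW r0))// oppr_le0 ltW.
have bp : bmf (fun z => pos (q z)) by exact: bmf_cont pos_continuous bq.
have I0 : sint2 (fun z => pos (q z)) (a - r) (a + r) (b - r) (b + r) <= 0.
  apply/ler_addgt0Pr => e e0; rewrite add0r.
  have [h [k [/andP[h0 hr] /andP[k0 kr] le_e _]]] :=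
    avg_L1 q q (a - r) (a + r) (b - r) (b + r) e r (itv a) (itv b) bq bq e0 r0.
  apply: le_trans le_e; apply: (le_sint2 _ (fun z => `|avg h k q z - q z|)) => //.
    by apply: bmf_norm; apply: bmfB => //; exact: bmf_avg.
  move=> y s /andP[y1 y2] /andP[s1 s2]; apply: pos_avg_le; apply: H => // w /= /andP[w1 w2] /andP[w3 w4].
  by apply: boxD; rewrite ler_norml; move: r0 hr kr y1 y2 s1 s2 w1 w2 w3 w4 => *; lra.
pose Bx : set (R * R) := `[a - r, a + r] `*` `[b - r, b + r].
have mB : measurable (Bx) by exact: measurableX.
have I1 : \int[mu2]_(z in Bx) pos (q z) = 0.
  apply/le_anti/andP; split; first by rewrite /Bx Rintegral_box.
  by apply: Rintegral_ge0 => z _; exact: pos_ge0.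
have I2 : (\int[mu2]_(z in Bx) `|(pos (q z))%:E| = 0)%E.
  transitivity (\int[mu2]_(z in Bx) (pos (q z))%:E)%E.
    by apply: eq_integral => z _; rewrite gee0_abs// lee_fin pos_ge0.
  rewrite -[LHS]fineK; last exact: integrable_fin_num (bmf_box _ _ _ _ _ bp).
  by rewrite [X in X%:E = _]I1.
have mp : measurable_fun (Bx) (fun z => (pos (q z))%:E).
  by apply/measurable_EFinP; apply: measurable_funTS; case: bp.
have [/(_ I2) + _] := ae_eq_integral_abs mu2 mB mp.
apply: ae_imp => z Hz z1 z2.
have : Bx z.
  by split; rewrite /= in_itv /= -ler_distl.
move/Hz => /= [] e; rewrite -e; rewrite /pos le_max lexx//.
Qed.

End almost_everywhere.

(** * Initial data *)

Section periodic_primitive.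
Context {R : realType}.
Notation mu := (@lebesgue_measure R).
Implicit Types q w : R -> R.

Lemma ae_neq (c : R) : {ae mu, forall x, x <> c}.
Proof.
exists [set c]; split=> //; first exact: lebesgue_measure_set1.
by move=> x /= h; apply: contrapT => xc; apply: h.
Qed.

Definition translation (p x : R) : measurableTypeR R := x + p.

Lemma measurable_translation (p : R) : measurable_fun setT (translation p).
Proof. exact: measurable_funD. Qed.

(** The translated measure agrees with Lebesgue measure on half-open intervals, and uniqueness does
    the rest. *)
Lemma lebesgue_measure_translate (p : R) (A : set R) : measurable A ->
  pushforward mu (translation p) A = mu A.
Proof.
move=> mA; apply/esym/lebesgue_measure_unique => //=; first exact: measurable_translation.
move=> _ _ [[a b]] _ <-.
rewrite /pushforward (_ : _ @^-1` _ = `]a - p, b - p]%classic).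
  by rewrite !lebesgue_measure_itv/= !lte_fin ltrD2r; case: ifP => // _; rewrite -!EFinB; congr EFin; ring.
by apply/seteqP; split => x /=; rewrite !in_itv /= ltrBlDr lerBrDr.
Qed.

Lemma sint_translate q (p a b : R) : bmf q ->
  sint q (a + p) (b + p) = sint (fun x => q (x + p)) a b.
Proof.
move=> bq; wlog ab : a b / a <= b => [H|].
  by case: (leP a b) => [/H//|/ltW /H e]; rewrite sintC e -sintC.
have bqt : bmf (q \o translation p) by apply: bmf_comp bq _; exact: measurable_translation.
rewrite !sintE ?lerD2r//; congr fine.
transitivity (\int[pushforward mu (translation p)]_(y in `[(a + p)%R, (b + p)%R]) (q y)%:E)%E.
  apply: eq_measure_integral; first exact: measurable_translation.
  by move=> mt A mA _; exact/esym/lebesgue_measure_translate.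
have pre : translation p @^-1` `[a + p, b + p] = `[a, b]%classic.
  by apply/seteqP; split => x /=; rewrite !in_itv /= !lerD2r.
rewrite integral_pushforward ?pre//.
- exact: measurable_translation.
- by apply/measurable_EFinP; case: bq.
- exact: bmf_lint _ bqt _ _.
Qed.

Lemma periodic_primitive w (p : R) : bmf w -> (forall x, w (x + p) = w x) ->
  sint w 0 p = 0 -> forall x n, sint w 0 (x + n%:R * p) = sint w 0 x.
Proof.
move=> bw per av x; elim=> [|n IH]; first by rewrite mul0r addr0.
rewrite -natr1 mulrDl mul1r addrA -(sintD_itv w 0 p _ (bmf_lint w bw)) av add0r.
rewrite -[X in sint w X](add0r p) sint_translate// -IH.
by congr sint; apply/funext.
Qed.

Lemma periodic_primitive_ge0 w (p : R) : 0 < p -> bmf w -> (forall x, w (x + p) = w x) ->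
  sint w 0 p = 0 -> (forall x, 0 <= x <= p -> 0 <= sint w 0 x) -> forall x, 0 <= sint w 0 x.
Proof.
move=> p0 bw per av W0 x; have P := periodic_primitive w p bw per av.
have /andP[] := Num.Theory.floor_itv (x / p).
rewrite ler_pdivlMr// ltr_pdivrMr// => h1 h2.
pose y := x - (Num.floor (x / p))%:~R * p.
have /W0 : 0 <= y <= p.
  rewrite /y subr_ge0 h1 /= lerBlDl; apply: ltW; move: h2.
  by rewrite intrD mulrDl mul1r.
suff -> : sint w 0 y = sint w 0 x by [].
rewrite /y; case: (Num.floor (x / p)) => n.
  by rewrite -(P _ n) -pmulrn subrK.
by rewrite NegzE mulrNz mulNr opprK -pmulrn P.
Qed.

End periodic_primitive.

(** * Piecewise constant data with a bounded perturbation *)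

Section initial_data.
Context {R : realType}.
Notation mu := (@lebesgue_measure R).
Notation mu2 := ((@lebesgue_measure R) \x (@lebesgue_measure R))%E.

(** Each horizontal slice meets the line in one point, so all box averages of its indicator vanish.
    This disposes of the two boundary rays of the fan. *)
Lemma ae_off_line (c : R) : {ae mu2, forall z : R * R, z.1 <> c * z.2}.
Proof.
pose q : R * R -> R := \1_[set z : R * R | z.1 - c * z.2 = 0].
have cl : continuous (fun z : R * R => z.1 - c * z.2).
  have := half_plane_continuous (1 : R) (- c).
  by rewrite (_ : (fun z => _) = (fun z : R * R => z.1 - c * z.2))//; apply/funext => z; ring.
have bq : bmf q.
  apply: bmf_indic; have -> : [set z : R * R | z.1 - c * z.2 = 0] =
    (fun z : R * R => z.1 - c * z.2) @^-1` [set 0] by [].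
  by rewrite -[X in measurable X]setTI; apply: continuous_measurable2.
have : {ae mu2, forall z, setT z -> q z <= 0}.
  apply: avg_le0_ae => //; first exact: openT.
  move=> z h k h0 k0 _; rewrite /avg (_ : (fun s => _) = fun=> 0).
    by rewrite sint_cst !mulr0.
  apply/funext => s; transitivity (sint (fun=> 0 : R) z.1 (z.1 + h)); last first.
    by rewrite sint_cst mulr0.
  apply: eq_sint_ae => //; first by rewrite lerDl ltW.
    by have [] := bmf_slice1 q s bq.
  apply: ae_imp (ae_neq (c * s)) => y ne _; rewrite /q indicE memNset//= => /eqP.
  by rewrite subr_eq0 => /eqP.
apply: ae_imp => z /(_ I) + e; rewrite /q indicE mem_set ?ler10//=.
by rewrite e subrr.
Qed.

Definition riemann_step (a b x : R) := if x < 0 then a else b.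

Lemma bmf_riemann_step a b : bmf (riemann_step a b).
Proof.
have -> : riemann_step a b = fun x => b + (a - b) * \1_(`]-oo, (0 : R)[) x.
  apply/funext => x; rewrite /riemann_step indicE; case: ifP => x0.
    by rewrite mem_set/= ?in_itv//= mulr1 addrC subrK.
  by rewrite memNset/= ?in_itv/= ?x0// mulr0 addr0.
by apply: bmfD; [exact: bmf_cst|apply: bmfM; [exact: bmf_cst|exact: bmf_indic]].
Qed.

Lemma sint_riemann_step a b x : sint (riemann_step a b) 0 x = riemann_step a b x * x.
Proof.
have [ms _] := bmf_riemann_step a b.
rewrite [in RHS]/riemann_step; case: ltP => x0.
  rewrite sintC (eq_sint_ae _ (fun=> a) _ _ (ltW x0))// ?sint_cst; first ring.
  apply: ae_imp (ae_neq 0) => y /eqP y0 /andP[_]; rewrite le_eqVlt (negbTE y0) /= /riemann_step.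
  by move=> ->.
rewrite (eq_sint _ (fun=> b))// ?sint_cst ?subr0 1?mulrC// => y /andP[y0 _].
by rewrite /riemann_step ltNge y0.
Qed.

Lemma solution_version (f s w0 w : R -> R) (u : R * R -> R) : continuous f -> bmf s ->
  bmf w -> measurable_fun setT w0 -> {ae mu, forall x, w x = w0 x} ->
  entropy_solution f (fun x => s x + w0 x) u ->
  exists g v M Mf,
  [/\ [/\ bounded_entropy_solution f v g, forall z, `|g z| <= M, forall x, `|v x| <= M &
      forall z, `|f (g z)| <= Mf],
     {ae mu2, forall z, 0 < z.2 -> g z = u z} &
     forall x, potential f v g M (x, 0) = sint s 0 x + sint w 0 x].
Proof.
move=> cf bs bw mw0 ww sol; have [ms [Ms sM]] := bs; have [mw [Mw wM]] := bw.
have [g [v [solg gu vu]]] : exists g v, [/\ bounded_entropy_solution f v g,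
    {ae mu2, forall z, 0 < z.2 -> g z = u z} & {ae mu, forall x, v x = s x + w0 x}].
  apply: (bounded_version f _ u (Ms + Mw)) => //; first exact: measurable_funD.
  apply: ae_imp ww => x <-; apply: (le_trans (ler_normD _ _)); exact: lerD.
have [bg bv _] := solg; have [_ [M1 gM]] := bg; have [mv [M2 vM]] := bv.
have [_ [Mf fM]] := bmf_cont _ _ f g cf bg.
have gM' z : `|g z| <= Num.max M1 M2 by rewrite le_max gM.
have vM' x : `|v x| <= Num.max M1 M2 by rewrite le_max vM orbT.
exists g, v, (Num.max M1 M2), Mf; split => //.
move=> x; rewrite (potential0 f v g _ Mf)//.
rewrite -(sintD s w)//; [|exact: bmf_lint..].
have E a b : a <= b -> sint v a b = sint (fun x => s x + w x) a b.
  move=> ab; apply: eq_sint_ae => //; first exact: measurable_funD.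
  by apply: ae_imp (ae_and _ _ _ _ _ vu ww) => y [-> ->].
by case: (leP 0 x) => [/E//|/ltW/E e]; rewrite sintC e -sintC.
Qed.

End initial_data.

(** * Cones and fans *)

Section cone.
Context {R : realType}.
Notation mu2 := ((@lebesgue_measure R) \x (@lebesgue_measure R))%E.

Lemma avgB (g1 g2 : R * R -> R) h k z : bmf g1 -> bmf g2 ->
  avg h k (fun w => g1 w - g2 w) z = avg h k g1 z - avg h k g2 z.
Proof.
move=> b1 b2; rewrite /avg -mulrBr; congr (_ * _).
rewrite -(sintB (fun s => sint (fun y => g1 (y, s)) z.1 (z.1 + h))).
- by congr sint; apply/funext => s; rewrite (sintB (fun y => g1 (y, s)))//;
    apply: bmf_lint; exact: bmf_slice1.
- exact: bmf_lint (bmf_sint1 g1 _ _ b1).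
- exact: bmf_lint (bmf_sint1 g2 _ _ b2).
Qed.

Lemma avg_cst h k (c : R) z : 0 < h -> 0 < k -> avg h k (fun=> c) z = c.
Proof.
move=> h0 k0; rewrite /avg !sint_cst (addrC z.1) (addrC z.2) !addrK; field.
by rewrite !gt_eqF.
Qed.

Variable f : R -> R.
Hypotheses (df : forall v, derivable f v 1) (incr : {homo (derive1 f) : x y / x < y}).

Let cf : continuous f. Proof. exact: derivable_continuous. Qed.

Lemma open_cone (a b c d : R) :
  open [set z : R * R | [/\ 0 < z.2, 0 < a * z.1 + b * z.2 & 0 < c * z.1 + d * z.2]].
Proof.
have -> : [set z : R * R | [/\ 0 < z.2, 0 < a * z.1 + b * z.2 & 0 < c * z.1 + d * z.2]] =
    [set z : R * R | 0 < 0 * z.1 + 1 * z.2] `&` ([set z : R * R | 0 < a * z.1 + b * z.2] `&`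
     [set z : R * R | 0 < c * z.1 + d * z.2]).
  apply/seteqP; split => z /=; rewrite mul0r add0r mul1r; first by case.
  by case=> ? [].
by apply: openI; [|apply: openI]; exact: open_half_plane.
Qed.

(** The sign of [s] selects the side: [s = 1] is the region left of the ray x = c t, [s = -1] the
    region right of it. *)
Lemma cone_agree (v1 v2 : R -> R) (g1 g2 : R * R -> R) (M1 Mf1 M2 Mf2 s c : R) :
  bounded_entropy_solution f v1 g1 -> (forall z, `|g1 z| <= M1) ->
  (forall x, `|v1 x| <= M1) -> (forall z, `|f (g1 z)| <= Mf1) ->
  bounded_entropy_solution f v2 g2 -> (forall z, `|g2 z| <= M2) ->
  (forall x, `|v2 x| <= M2) -> (forall z, `|f (g2 z)| <= Mf2) ->
  s != 0 ->
  (forall y, s * y <= 0 -> potential f v1 g1 M1 (y, 0) = potential f v2 g2 M2 (y, 0)) ->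
  (forall t, 0 <= t -> potential f v1 g1 M1 (c * t, t) = potential f v2 g2 M2 (c * t, t)) ->
  forall z, 0 <= z.2 -> 0 <= s * (c * z.2 - z.1) ->
  potential f v1 g1 M1 z = potential f v2 g2 M2 z.
Proof.
move=> sol1 gM1 vM1 fM1 sol2 gM2 vM2 fM2 s0 data ray z z20 zc.
pose K := [set z : R * R | 0 <= 0 * z.1 + 1 * z.2] `&` [set z : R * R | 0 <= (- s) * z.1 + (s * c) * z.2].
have KE w : K w <-> 0 <= w.2 /\ 0 <= s * (c * w.2 - w.1).
  rewrite /K /= mul0r add0r mul1r (_ : s * (c * w.2 - w.1) = (- s) * w.1 + (s * c) * w.2)//; ring.
(* Where s x <= 0, the point is compared with its projection to t = 0, at distance t; elsewhere in
   the cone with the origin, at distance |x| + t <= (|c| + 1) t. *)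
apply: (potential_agree f df incr v1 v2 g1 g2 M1 Mf1 M2 Mf2 K (`|c| + 1)) => //.
- by apply: closedI; exact: closed_half_plane.
- by move=> w /KE[].
- move=> [x t] /KE[/= t0 xt]; have [xs|xs] := leP (s * x) 0.
    exists (x, 0); first exact: data.
    by rewrite /= subrr normr0 add0r subr0 (ger0_norm t0) mulrDl mul1r lerDr mulr_ge0.
  exists (0, 0); first by apply: data; rewrite mulr0.
  rewrite /= !subr0 (ger0_norm t0) mulrDl mul1r lerD2r.
  have sn : 0 < `|s| by rewrite normr_gt0.
  rewrite -(ler_pM2l sn) -normrM (gtr0_norm xs).
  apply: (@le_trans _ _ (s * (c * t))); first by move: xt; rewrite mulrBr subr_ge0.
  by apply: (le_trans (ler_norm _)); rewrite !normrM (ger0_norm t0).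
- move=> [x t] /KE[/= t0 xt]; have [xs|xs] := eqVneq (c * t - x) 0.
    by left; rewrite (_ : x = c * t); [exact: ray|move/eqP: xs; rewrite subr_eq0 => /eqP].
  move: t0; rewrite le_eqVlt => /predU1P[t0|t0].
    left; rewrite -t0 in xt *; apply: data; move: xt.
    by rewrite mulr0 sub0r mulrN oppr_ge0.
  right; split => //=.
  have := open_nbhs_nbhs (conj (open_cone (- s) (s * c) (- s) (s * c)) _) => /(_ (x, t)).
  have xt' : 0 < - s * x + s * c * t.
    rewrite (_ : _ + _ = s * (c * t - x)); last by ring.
    by rewrite lt_neqAle xt andbT eq_sym mulf_neq0.
  move=> /(_ (And3 t0 xt' xt')); apply: filterS => w [w1 w2 _].
  by split; rewrite /= ?mul0r ?add0r ?mul1r; exact: ltW.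
- by apply/KE.
Qed.

Lemma avg_increment (v : R -> R) (g : R * R -> R) (M Mf h k y t : R) :
  bounded_entropy_solution f v g -> (forall z, `|g z| <= M) ->
  (forall x, `|v x| <= M) -> (forall z, `|f (g z)| <= Mf) -> 0 < h -> 0 < k -> 0 <= t ->
  avg h k g (y, t) = (h * k)^-1 * sint (fun s => potential f v g M (y + h, s) -
    potential f v g M (y, s)) t (t + k) /\
  lint (fun s => potential f v g M (y + h, s) - potential f v g M (y, s)).
Proof.
move=> sol gM vM fM h0 k0 t0; split.
  by rewrite -(potential_avg_x f v g M Mf cf sol gM vM fM).
have lU := potential_lip f v g M Mf cf sol gM vM fM.
by apply: lintB; exact: lip1_lint (lip2_slice2 _ _ _ lU).
Qed.

Lemma potential_agree_ae (v1 v2 : R -> R) (g1 g2 : R * R -> R) (M1 Mf1 M2 Mf2 : R)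
    (D : set (R * R)) :
  bounded_entropy_solution f v1 g1 -> (forall z, `|g1 z| <= M1) ->
  (forall x, `|v1 x| <= M1) -> (forall z, `|f (g1 z)| <= Mf1) ->
  bounded_entropy_solution f v2 g2 -> (forall z, `|g2 z| <= M2) ->
  (forall x, `|v2 x| <= M2) -> (forall z, `|f (g2 z)| <= Mf2) ->
  open D -> (forall z, D z -> 0 < z.2) ->
  (forall z, D z -> potential f v1 g1 M1 z = potential f v2 g2 M2 z) ->
  {ae mu2, forall z, D z -> g1 z = g2 z}.
Proof.
move=> sol1 gM1 vM1 fM1 sol2 gM2 vM2 fM2 oD D0 UE.
have [bg1 _ _] := sol1; have [bg2 _ _] := sol2.
have E z h k : 0 < h -> 0 < k ->
    (forall w, z.1 <= w.1 <= z.1 + h -> z.2 <= w.2 <= z.2 + k -> D w) ->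
    avg h k g1 z = avg h k g2 z.
  case: z => y t /= h0 k0 H.
  have yy : y <= y <= y + h by rewrite lexx lerDl ltW.
  have yh : y <= y + h <= y + h by rewrite lexx lerDl ltW.
  have tt' : t <= t <= t + k by rewrite lexx lerDl ltW.
  have t0 := ltW (D0 _ (H (y, t) yy tt')).
  have [-> _] := avg_increment v1 g1 M1 Mf1 h k y t sol1 gM1 vM1 fM1 h0 k0 t0.
  have [-> _] := avg_increment v2 g2 M2 Mf2 h k y t sol2 gM2 vM2 fM2 h0 k0 t0.
  congr (_ * _); apply: eq_sint => [|s ts]; first by rewrite lerDl ltW.
  by rewrite (UE _ (H (y + h, s) yh ts)) (UE _ (H (y, s) yy ts)).
have h12 : {ae mu2, forall z, D z -> g1 z - g2 z <= 0}.
  apply: avg_le0_ae => //; first exact: bmfB.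
  by move=> z h k h0 k0 H; rewrite avgB// (E z h k)// subrr.
have h21 : {ae mu2, forall z, D z -> g2 z - g1 z <= 0}.
  apply: avg_le0_ae => //; first exact: bmfB.
  by move=> z h k h0 k0 H; rewrite avgB// (E z h k)// subrr.
apply: ae_imp (ae_and _ _ _ _ _ h12 h21) => z [H1 H2] Dz; apply/le_anti.
by rewrite -subr_le0 H1//= -subr_le0 H2.
Qed.

(** * The rarefaction fan *)

Section fan.
Variables (v : R -> R) (g : R * R -> R) (M Mf al ar : R).
Hypotheses (sol : bounded_entropy_solution f v g) (gM : forall z, `|g z| <= M)
  (vM : forall x, `|v x| <= M) (fM : forall z, `|f (g z)| <= Mf)
  (ddf : forall v, derivable (derive1 f) v 1)
  (low : forall a, al <= a <= ar -> forall z, 0 <= z.2 ->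
    a * z.1 - f a * z.2 <= potential f v g M z)
  (up : forall a t, al <= a <= ar -> 0 <= t ->
    potential f v g M (derive1 f a * t, t) <= a * (derive1 f a * t) - f a * t).

Notation U := (potential f v g M).

Let bg : bmf g. Proof. by case: sol. Qed.

Let fan_speed x t : 0 < t -> derive1 f al * t <= x <= derive1 f ar * t -> al <= ar ->
  exists b, [/\ al <= b, b <= ar & x = derive1 f b * t].
Proof.
move=> t0 xt alr; have [|b [b1 b2 e]] := derive_intermediate f al ar (x / t) ddf alr.
  by rewrite ler_pdivlMr// ler_pdivrMr.
by exists b; rewrite e divfK// gt_eqF.
Qed.

Let incrW a b : derive1 f a <= derive1 f b -> a <= b.
Proof. by rewrite !leNgt; apply: contra => /incr. Qed.

(* The potential is [b x - f(b) t] at a point of speed [f'(b)] and lies above this affine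
   function elsewhere, so its increments in x are at most [b h]. *)
Lemma fan_le a : al <= a <= ar -> {ae mu2, forall z : R * R, 0 < z.2 ->
  derive1 f al * z.2 < z.1 -> z.1 < derive1 f a * z.2 -> g z <= a}.
Proof.
move=> /andP[ala aar].
have := open_cone 1 (- derive1 f al) (- 1) (derive1 f a).
set D := (X in open X) => oD.
have DE z : D z <-> [/\ 0 < z.2, derive1 f al * z.2 < z.1 & z.1 < derive1 f a * z.2].
  by rewrite /D /= !mul1r !mulNr mul1r subr_gt0 addrC subr_gt0.
suff : {ae mu2, forall z, D z -> g z - a <= 0}.
  by apply: ae_imp => z H z0 z1 z2; rewrite -subr_le0; apply: H; apply/DE.
apply: avg_le0_ae => //; first by apply: bmfB => //; exact: bmf_cst.
case=> y t h k h0 k0 /= H; rewrite avgB//; last exact: bmf_cst.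
rewrite avg_cst// subr_le0.
have yy : y <= y <= y + h by rewrite lexx lerDl ltW.
have yh : y <= y + h <= y + h by rewrite lexx lerDl ltW.
have tt' : t <= t <= t + k by rewrite lexx lerDl ltW.
have t0 : 0 <= t by have /DE[/ltW] := H (y, t) yy tt'.
have [-> lI] := avg_increment v g M Mf h k y t sol gM vM fM h0 k0 t0.
rewrite mulrC ler_pdivrMr ?mulr_gt0//.
apply: (@le_trans _ _ (sint (fun=> a * h) t (t + k))); last first.
  by rewrite sint_cst addrAC subrr add0r; apply: eq_le; ring.
apply: le_sint => //; [exact: lint_cst|by rewrite lerDl ltW|move=> s ts].
have /DE[/= s0 s1 s2] := H (y + h, s) yh ts.
have [|b [b1 b2 e]] := fan_speed (y + h) s s0 _ (le_trans ala aar).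
  rewrite (ltW s1)/=; apply: (le_trans (ltW s2)); rewrite ler_wpM2r ?(ltW s0)//.
  by move: aar; rewrite le_eqVlt => /predU1P[->//|/incr/ltW].
have ba : b <= a by apply: incrW; move: s2; rewrite e ltr_pM2r// => /ltW.
have bb : al <= b <= ar by rewrite b1.
have := up b s bb (ltW s0); have := low b bb (y, s) (ltW s0); rewrite -e /= => h1 h2.
apply: (@le_trans _ _ (b * h)); last by rewrite ler_wpM2r// ltW.
by move: h1 h2; rewrite mulrDr; move: (U _) (U _) (b * y) (b * h) (f b * s) => *; lra.
Qed.

(** Here the touching affine function is taken at the left end of the increment, so that the
    increment is at least [b * h] with [b >= a]. *)
Lemma fan_ge a : al <= a <= ar -> {ae mu2, forall z : R * R, 0 < z.2 ->
  derive1 f a * z.2 < z.1 -> z.1 < derive1 f ar * z.2 -> a <= g z}.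
Proof.
move=> /andP[ala aar].
have := open_cone 1 (- derive1 f a) (- 1) (derive1 f ar).
set D := (X in open X) => oD.
have DE z : D z <-> [/\ 0 < z.2, derive1 f a * z.2 < z.1 & z.1 < derive1 f ar * z.2].
  by rewrite /D /= !mul1r !mulNr mul1r subr_gt0 addrC subr_gt0.
suff : {ae mu2, forall z, D z -> a - g z <= 0}.
  by apply: ae_imp => z H z0 z1 z2; rewrite -subr_le0; apply: H; apply/DE.
apply: avg_le0_ae => //; first by apply: bmfB => //; exact: bmf_cst.
case=> y t h k h0 k0 /= H; rewrite avgB//; last exact: bmf_cst.
rewrite avg_cst// subr_le0.
have yy : y <= y <= y + h by rewrite lexx lerDl ltW.
have tt' : t <= t <= t + k by rewrite lexx lerDl ltW.
have t0 : 0 <= t by have /DE[/ltW] := H (y, t) yy tt'.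
have [-> lI] := avg_increment v g M Mf h k y t sol gM vM fM h0 k0 t0.
rewrite mulrC ler_pdivlMr ?mulr_gt0//.
apply: (@le_trans _ _ (sint (fun=> a * h) t (t + k))).
  by rewrite sint_cst addrAC subrr add0r; apply: eq_le; ring.
apply: le_sint => //; [exact: lint_cst|by rewrite lerDl ltW|move=> s ts].
have /DE[/= s0 s1 s2] := H (y, s) yy ts.
have [|b [b1 b2 e]] := fan_speed y s s0 _ (le_trans ala aar).
  rewrite (ltW s2) andbT; apply: (le_trans _ (ltW s1)); rewrite ler_wpM2r ?(ltW s0)//.
  by move: ala; rewrite le_eqVlt => /predU1P[->//|/incr/ltW].
have ab : a <= b by apply: incrW; move: s1; rewrite e ltr_pM2r// => /ltW.
have bb : al <= b <= ar by rewrite b1.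
have := up b s bb (ltW s0); have := low b bb (y + h, s) (ltW s0); rewrite -e /= => h1 h2.
apply: (@le_trans _ _ (b * h)); first by rewrite ler_wpM2r// ltW.
by move: h1 h2; rewrite mulrDr; move: (U _) (U _) (b * y) (b * h) (f b * s) => *; lra.
Qed.

(** The one-sided bounds carry a null set for each level, so they are used for rational levels only;
    a rational strictly between [b] and [g z] would contradict one of them. *)
Lemma fan_ae : {ae mu2, forall z : R * R, 0 < z.2 -> forall b, al < b < ar ->
  z.1 = derive1 f b * z.2 -> g z = b}.
Proof.
have A1 (q : rat) : {ae mu2, forall z : R * R, al <= ratr q <= ar -> 0 < z.2 ->
    derive1 f al * z.2 < z.1 -> z.1 < derive1 f (ratr q) * z.2 -> g z <= ratr q}.
  have [h|h] := boolP (al <= ratr q <= ar); last exact: nearW.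
  by apply: ae_imp (fan_le _ h) => z H _.
have A2 (q : rat) : {ae mu2, forall z : R * R, al <= ratr q <= ar -> 0 < z.2 ->
    derive1 f (ratr q) * z.2 < z.1 -> z.1 < derive1 f ar * z.2 -> ratr q <= g z}.
  have [h|h] := boolP (al <= ratr q <= ar); last exact: nearW.
  by apply: ae_imp (fan_ge _ h) => z H _.
apply: ae_imp (ae_and _ _ _ _ _ (ae_countable _ _ A1) (ae_countable _ _ A2)) => z [H1 H2] z0 b /andP[b1 b2] e.
have sp c d : c < d -> derive1 f c * z.2 < derive1 f d * z.2 by move=> cd; rewrite ltr_pM2r// incr.
apply/le_anti/andP; split; rewrite leNgt; apply/negP => gb.
  have : b < Num.min ar (g z) by rewrite lt_min b2.
  move=> /rat_in_itvoo[q]; rewrite in_itv /= lt_min => /and3P[q1 q2 q3].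
  have := H1 q; rewrite e !sp//.
  by rewrite (ltW (lt_trans b1 q1)) (ltW q2) => /(_ isT z0 isT isT); rewrite leNgt q3.
have : Num.max al (g z) < b by rewrite gt_max b1.
move=> /rat_in_itvoo[q]; rewrite in_itv /= gt_max => /andP[/andP[q1 q2] q3].
have := H2 q; rewrite e !sp//.
by rewrite (ltW q1) (ltW (lt_trans q3 b2)) => /(_ isT z0 isT isT); rewrite leNgt q2.
Qed.

End fan.

End cone.

(** * Agreement of solutions beside a ray *)

Section cone_ae.
Context {R : realType}.
Notation mu2 := ((@lebesgue_measure R) \x (@lebesgue_measure R))%E.
Variable f : R -> R.
Hypotheses (df : forall v, derivable f v 1) (incr : {homo (derive1 f) : x y / x < y}).

Lemma cone_agree_ae (v1 v2 : R -> R) (g1 g2 : R * R -> R) (M1 Mf1 M2 Mf2 s a : R) :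
  bounded_entropy_solution f v1 g1 -> (forall z, `|g1 z| <= M1) ->
  (forall x, `|v1 x| <= M1) -> (forall z, `|f (g1 z)| <= Mf1) ->
  bounded_entropy_solution f v2 g2 -> (forall z, `|g2 z| <= M2) ->
  (forall x, `|v2 x| <= M2) -> (forall z, `|f (g2 z)| <= Mf2) -> s != 0 ->
  (forall y, s * y <= 0 -> potential f v1 g1 M1 (y, 0) = potential f v2 g2 M2 (y, 0)) ->
  (forall y, a * y <= potential f v1 g1 M1 (y, 0)) ->
  (forall y, a * y <= potential f v2 g2 M2 (y, 0)) ->
  potential f v1 g1 M1 (0, 0) = 0 ->
  {ae mu2, forall z, 0 < z.2 -> 0 < s * (derive1 f a * z.2 - z.1) -> g1 z = g2 z}.
Proof.
move=> sol1 gM1 vM1 fM1 sol2 gM2 vM2 fM2 s0 data low1 low2 U0.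
have U0' : potential f v2 g2 M2 (0, 0) = 0 by rewrite -data// mulr0.
have ray t : 0 <= t -> potential f v1 g1 M1 (derive1 f a * t, t) =
    potential f v2 g2 M2 (derive1 f a * t, t).
  move=> t0; transitivity (a * (derive1 f a * t) - f a * t); apply/le_anti/andP; split.
  - exact: ray_le f v1 g1 M1 Mf1 df incr sol1 gM1 vM1 fM1 a t t0 U0.
  - exact: (affine_le f v1 g1 M1 Mf1 df incr sol1 gM1 vM1 fM1 a low1 (derive1 f a * t, t)).
  - exact: (affine_le f v2 g2 M2 Mf2 df incr sol2 gM2 vM2 fM2 a low2 (derive1 f a * t, t)).
  - exact: ray_le f v2 g2 M2 Mf2 df incr sol2 gM2 vM2 fM2 a t t0 U0'.
have oD := open_cone (- s) (s * derive1 f a) (- s) (s * derive1 f a).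
have E z : - s * z.1 + s * derive1 f a * z.2 = s * (derive1 f a * z.2 - z.1) by ring.
apply: (ae_imp _ _ _ _ _ _ (potential_agree_ae f df v1 v2 g1 g2 M1 Mf1 M2 Mf2 _
  sol1 gM1 vM1 fM1 sol2 gM2 vM2 fM2 oD _ _)) => [z H z0 zs|z [z0]//|z [z0]].
  by apply: H; split; rewrite ?E.
rewrite E => zs _.
exact: (cone_agree f df incr v1 v2 g1 g2 M1 Mf1 M2 Mf2 s (derive1 f a)
  sol1 gM1 vM1 fM1 sol2 gM2 vM2 fM2 s0 data ray z (ltW z0) (ltW zs)).
Qed.

End cone_ae.

(** * The solution formula *)

Theorem theorem4 (R : realType) (f : R -> R) (ubl ubr p : R)
    (w0 : R -> R) (u ul ur : R * R -> R) :
  (* f in C^2 with f'' > 0 *)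
  (forall v, derivable f v 1) ->
  (forall v, derivable (derive1 f) v 1) ->
  continuous (derive1n 2 f) ->
  (forall v, 0 < (derive1n 2 f) v) ->
  ubl < ubr ->
  (* w0 in L^oo, p-periodic, zero average, nonnegative primitive on [0,p] *)
  0 < p ->
  Linfty1 w0 ->
  (forall x, w0 (x + p) = w0 x) ->
  Rintegral (@lebesgue_measure R) `[0, p] w0 = 0 ->
  (forall x, 0 <= x <= p -> 0 <= Rintegral (@lebesgue_measure R) `[0, x] w0) ->
  (* entropy solutions *)
  entropy_solution f (fun x => (if x < 0 then ubl else ubr) + w0 x) u ->
  entropy_solution f (fun x => ubl + w0 x) ul ->
  entropy_solution f (fun x => ubr + w0 x) ur ->
  {ae (@leb2 R), forall z : R * R, 0 < z.2 ->
     let x := z.1 in let t := z.2 in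
     (x / t < (derive1 f) ubl -> u z = ul z) /\
     ((derive1 f) ubl <= x / t <= (derive1 f) ubr -> u z = inverse_fun (derive1 f) (x / t)) /\
     ((derive1 f) ubr < x / t -> u z = ur z)}.
Proof.
move=> df ddf _ f2 lr p0 [mw0 [M0 w0M]] per av W0 solu soll solr.
have incr := derive_pos_increasing (derive1 f) ddf f2.
have cf := derivable_continuous f df.
(* Clamping acts on values, so the bounded version keeps exact periodicity; the maximum with 0
   ensures a nonnegative level. *)
pose w x := clamp (Num.max 0 M0) (w0 x).
have bw : bmf w.
  split; first exact: measurableT_comp (measurable_clamp _) mw0.
  by exists (Num.max 0 M0) => x; apply: clamp_bound; rewrite le_max lexx.
have ww : {ae (@lebesgue_measure R), forall x, w x = w0 x}.
  by apply: ae_imp w0M => x h; rewrite /w clamp_id// le_max h orbT.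
have wE x : 0 <= x -> sint w 0 x = Rintegral (@lebesgue_measure R) `[0, x] w0.
  move=> x0; rewrite -sintE//; apply: eq_sint_ae => //; first by case: bw.
  by apply: ae_imp ww.
have W : forall x, 0 <= sint w 0 x.
  apply: (periodic_primitive_ge0 w p p0 bw) => [x||x /andP[x0 xp]].
  - by rewrite /w per.
  - by rewrite wE// ltW.
  - by rewrite wE// W0// x0.
have [g [v [M [Mf [[sol gM vM fM] gu U0]]]]] := solution_version f (riemann_step ubl ubr)
  w0 w u cf (bmf_riemann_step ubl ubr) bw mw0 ww solu.
have [gl [vl [Ml [Mfl [[soll' gMl vMl fMl] gul U0l]]]]] := solution_version f (fun=> ubl)
  w0 w ul cf (bmf_cst ubl) bw mw0 ww soll.
have [gr [vr [Mr [Mfr [[solr' gMr vMr fMr] gur U0r]]]]] := solution_version f (fun=> ubr)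
  w0 w ur cf (bmf_cst ubr) bw mw0 ww solr.
have {}U0l y : potential f vl gl Ml (y, 0) = ubl * y + sint w 0 y.
  by rewrite U0l sint_cst subr0 mulrC.
have {}U0r y : potential f vr gr Mr (y, 0) = ubr * y + sint w 0 y.
  by rewrite U0r sint_cst subr0 mulrC.
have {}U0 y : potential f v g M (y, 0) = riemann_step ubl ubr y * y + sint w 0 y.
  by rewrite U0 sint_riemann_step.
have U00 : potential f v g M (0, 0) = 0 by rewrite U0 sintxx mulr0 addr0.
(* On y < 0 the slope [ubl] is at most [a], on y >= 0 the slope [ubr] is at least [a], so the step
   part dominates [a * y] on both sides; the periodic part only adds a nonnegative primitive. *)
have low a : ubl <= a <= ubr -> forall y, a * y <= potential f v g M (y, 0).
  move=> /andP[la ar] y; rewrite U0 -[leLHS]addr0; apply: lerD => //.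
  by rewrite /riemann_step; case: ltP => y0; [rewrite ler_wnM2r// ltW|rewrite ler_wpM2r].
have left_ae := cone_agree_ae f df incr v vl g gl M Mf Ml Mfl 1 ubl sol gM vM fM soll' gMl vMl fMl.
have right_ae := cone_agree_ae f df incr v vr g gr M Mf Mr Mfr (-1) ubr sol gM vM fM solr' gMr vMr fMr.
have {}left_ae : {ae (@leb2 R), forall z, 0 < z.2 ->
    0 < 1 * (derive1 f ubl * z.2 - z.1) -> g z = gl z}.
  apply: left_ae => // [y|y|y].
  (* At y = 0 the step has the value [ubr], which is harmless because it is multiplied by 0. *)
  - rewrite mul1r U0 U0l /riemann_step le_eqVlt => /predU1P[->|->//].
    by rewrite !mulr0.
  - by apply: low; rewrite lexx ltW.
  - by rewrite U0l lerDl.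
have {}right_ae : {ae (@leb2 R), forall z, 0 < z.2 ->
    0 < -1 * (derive1 f ubr * z.2 - z.1) -> g z = gr z}.
  apply: right_ae => // [y|y|y].
  - by rewrite mulN1r oppr_le0 U0 U0r /riemann_step ltNge => ->.
  - by apply: low; rewrite lexx ltW.
  - by rewrite U0r lerDl.
have fan : {ae (@leb2 R), forall z, 0 < z.2 -> forall b, ubl < b < ubr ->
    z.1 = derive1 f b * z.2 -> g z = b}.
  apply: (fan_ae f df incr v g M Mf ubl ubr sol gM vM fM ddf) => [a ha z|a t _ t0].
    exact: affine_le f v g M Mf df incr sol gM vM fM a (low a ha) z.
  exact: ray_le f v g M Mf df incr sol gM vM fM a t t0 U00.
apply: ae_imp (ae_and _ _ _ _ _ (ae_and _ _ _ _ _ left_ae right_ae) (ae_and _ _ _ _ _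
  (ae_and _ _ _ _ _ fan gu) (ae_and _ _ _ _ _ (ae_and _ _ _ _ _ gul gur)
  (ae_and _ _ _ _ _ (ae_off_line (derive1 f ubl)) (ae_off_line (derive1 f ubr)))))).
move=> [x t] [[hl hr] [[hf hu] [[hul hur] [/= nl nr]]]] /= t0.
rewrite -(hu t0) -(hul t0) -(hur t0).
rewrite ltr_pdivrMr// ltr_pdivlMr// ler_pdivlMr// ler_pdivrMr//; split; [|split].
- by move=> xl; apply: hl => //=; rewrite mul1r subr_gt0.
- move=> /andP[xl xr].
  have [|b [b1 b2 e]] := derive_intermediate f ubl ubr (x / t) ddf (ltW lr).
    by rewrite ler_pdivlMr// ler_pdivrMr// xl.
  have xb : x = derive1 f b * t by rewrite e divfK// gt_eqF.
  (* The fan is known only for [b] strictly between the end states; equality would put the point on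
     one of the two excluded rays. *)
  rewrite -e inverse_funK//; apply: hf => //; rewrite !lt_neqAle b1 b2 !andbT.
  by apply/andP; split; apply/eqP => eb; [apply: nl|apply: nr]; rewrite xb -eb.
- by move=> xr; apply: hr => //=; rewrite mulN1r oppr_gt0 subr_lt0.
Qed.
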